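(* Let $p$ be an odd prime number, $k$ be a positive integer, and let $X_{p^k}$ be the largest simple factor of $J_{p^k}$. The projection $J_{p^k}\to X_{p^k}$ induces an isomorphism $\operatorname{MT}(J_{p^k})\to\operatorname{MT}(X_{p^k})$ between the corresponding Mumford--Tate groups.
   Context: For $m\ge 3$, $J_m/\mathbb{Q}$ is the Jacobian of the smooth projective curve $C_m$ over $\mathbb{Q}$ with affine equation $y^2=x^m+1$ (and $J_1=0$). The variety $X_{p^k}$ is the quotient of $J_{p^k}$ by the image of the homomorphism $J_{p^{k-1}}\to J_{p^k}$ given by pullback along $C_{p^k}\to C_{p^{k-1}}$, $(x,y)\mapsto(x^p,y)$; it is geometrically simple of dimension $p^{k-1}(p-1)/2$ and is the simple isogeny factor of $J_{p^k}$ of largest dimension. The Mumford--Tate group $\operatorname{MT}(A)$ of an abelian variety $A$ (over $\mathbb{C}$, or over $\mathbb{Q}$ and base-changed to $\mathbb{C}$) is the smallest algebraic $\mathbb{Q}$-subgroup of $\operatorname{GL}_V$, $V=H^1(A(\mathbb{C}),\mathbb{Q})$, whose base change to $\mathbb{R}$ contains the image of $h:\operatorname{Res}_{\mathbb{C}/\mathbb{R}}\mathbb{G}_m\to\operatorname{GL}_{V,\mathbb{R}}$ defining the Hodge structure. The projection $J_{p^k}\to X_{p^k}$ makes $H^1(X_{p^k}(\mathbb{C}),\mathbb{Q})$ a sub-Hodge structure of $H^1(J_{p^k}(\mathbb{C}),\mathbb{Q})$, and the induced map on Mumford--Tate groups is restriction to this subspace. *)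

(* Defs.v *)
(* MathComp with MathComp-Analysis; complex numbers are R[i] for R : realType. *)
From HB Require Import structures.
From mathcomp Require Import all_boot all_order all_algebra.
From mathcomp Require Import all_classical all_reals all_analysis.
From mathcomp Require Import complex.
From mathcomp Require mpoly.
Set Implicit Arguments.
Unset Strict Implicit.
Unset Printing Implicit Defensive.
Import Order.TTheory GRing.Theory Num.Theory numFieldNormedType.Exports.
Local Open Scope classical_set_scope.
Local Open Scope complex_scope.
Local Open Scope ring_scope.

(** * Algebraic subgroups of GL_n over the rationals

    A closed subscheme of GL_n over Q is given by a set of polynomials in the
    n * n matrix entries (inverting the determinant needs no further equations).
    It is handled through its functor of points on commutative Q-algebras, that
    is, on commutative rings A together with a ring morphism from rat to A. *)

Definition equations (n : nat) := set (mpoly.mpoly (n * n) rat).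

Definition points n (S : equations n) (A : comUnitRingType)
    (f : {rmorphism rat -> A}) : set 'M[A]_n :=
  [set g | g \in unitmx /\
           forall P, S P -> mpoly.mmap f (fun i => mxvec g 0 i) P = 0].

Definition is_subgroup n (S : equations n) :=
  forall (A : comUnitRingType) (f : {rmorphism rat -> A}),
    [/\ points S f 1%:M,
        forall g h, points S f g -> points S f h -> points S f (g *m h)
      & forall g, points S f g -> points S f (invmx g)].

(** * Complex tori

    A complex torus A is encoded by its cotangent space W = H^0(A, Omega^1) and
    its lattice H_1(A, Z), embedded by integration in the dual of W, so that
    A = Hom(W, C) / H_1(A, Z).  W is a subset [cot] of an ambient type, and an
    element of its dual is a function on the ambient type of which only the
    values on [cot] matter. *)

Record torus (R : realType) := Torus {
  ambient : Type;
  cot : set ambient;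
  lattice : set (ambient -> R[i]) }.

Section Hodge.
Variables (R : realType) (X : torus R).
Implicit Types (l : ambient X -> R[i]).

(** H_1(X, Q), the rational span of the lattice. *)
Definition H1rat : set (ambient X -> R[i]) :=
  [set l | exists s (c : 'I_s -> rat) (u : 'I_s -> (ambient X -> R[i])),
     (forall i, lattice (u i)) /\
     forall w, cot w -> l w = \sum_(i < s) ratr (c i) * u i w].

Definition H1basis n (e : 'I_n -> (ambient X -> R[i])) :=
  [/\ forall i, H1rat (e i),
      forall l, H1rat l -> exists c : 'I_n -> rat,
        forall w, cot w -> l w = \sum_(i < n) ratr (c i) * e i w
    & forall c : 'I_n -> rat,
        (forall w, cot w -> \sum_(i < n) ratr (c i) * e i w = 0) ->
        forall i, c i = 0].

(** A basis e of H_1(X, Q) identifies V = H^1(X, Q) with column vectors through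
    the dual basis (phi corresponds to the column of the phi(e i)); the
    subspace H^{1,0} of V_C consists of the columns of the e i w, for w in
    [cot].  The matrix N below, being real, is the one that acts as z on
    H^{1,0} and as the conjugate of z on H^{0,1}, i.e. N = h(z).  (The other
    usual normalization, by the inverse of z, has the same image.) *)
Definition hodge_action n (e : 'I_n -> (ambient X -> R[i]))
    (z : R[i]) (N : 'M[R]_n) :=
  forall w, cot w ->
    map_mx (real_complex R) N *m (\col_i e i w) = z *: (\col_i e i w).

(** The base change of S to the reals contains the image of h.  It suffices to
    consider real points, as C^* is Zariski dense in Res_{C/R} G_m. *)
Definition contains_hodge n (e : 'I_n -> (ambient X -> R[i]))
    (S : equations n) :=
  forall (z : R[i]) (N : 'M[R]_n), z != 0 -> hodge_action e z N ->
    points S (ratr : {rmorphism rat -> R}) N.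

(** The intersection of all algebraic subgroups containing the image of h, cut
    out by the union of their equations. *)
Definition mumford_tate n (e : 'I_n -> (ambient X -> R[i])) : equations n :=
  [set P | exists2 S : equations n, is_subgroup S /\ contains_hodge e S & S P].

Lemma mumford_tate_min n (e : 'I_n -> (ambient X -> R[i])) (S : equations n) :
  is_subgroup S -> contains_hodge e S ->
  forall (A : comUnitRingType) (f : {rmorphism rat -> A}),
    points (mumford_tate e) f `<=` points S f.
Proof.
move=> gS hS A f g [ug hg]; split => // P SP.
by apply: hg; exists S.
Qed.

Lemma points_mumford_tate n (e : 'I_n -> (ambient X -> R[i]))
    (A : comUnitRingType) (f : {rmorphism rat -> A}) g :
  g \in unitmx ->
  (forall S, is_subgroup S -> contains_hodge e S -> points S f g) ->
  points (mumford_tate e) f g.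
Proof.
move=> ug H; split => // P [S [gS hS] SP].
by have [_] := H S gS hS; apply.
Qed.

Lemma mumford_tate_subgroup n (e : 'I_n -> (ambient X -> R[i])) :
  is_subgroup (mumford_tate e).
Proof.
move=> A f; split.
- apply: points_mumford_tate; first exact: unitmx1.
  by move=> S gS _; have [] := gS A f.
- move=> g h Hg Hh; apply: points_mumford_tate.
    by rewrite unitmx_mul; case: Hg => -> _; case: Hh => -> _.
  move=> S gS hS; have [_ + _] := gS A f.
  by apply; exact: (mumford_tate_min gS hS).
- move=> g Hg; apply: points_mumford_tate.
    by rewrite unitmx_inv; case: Hg.
  move=> S gS hS; have [_ _] := gS A f.
  by apply; exact: (mumford_tate_min gS hS).
Qed.

End Hodge.

(** * The curve C_m : y^2 = x^m + 1 and its Jacobian *)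

Section Curve.
Variable R : realType.
Local Notation C := R[i].

Definition on_curve (m : nat) (x y : C) := y ^+ 2 = x ^+ m + 1.

Definition tangent (m : nat) (x y dx dy : C) :=
  on_curve m x y /\ 2 * y * dy = m%:R * x ^+ m.-1 * dx.

(** The pair (a, b) is the 1-form a dx + b dy, with a, b in C[x][y]: the
    inner variable is x and the outer one is y. *)
Definition oneform : Type := ({poly {poly C}} * {poly {poly C}})%type.

Definition oneform_at (w : oneform) (x y dx dy : C) : C :=
  w.1.[y%:P].[x] * dx + w.2.[y%:P].[x] * dy.

(** The smooth projective model of C_m is obtained by gluing the affine curve
    y^2 = x^m + 1 and the affine curve t^2 = s^(2g+2-m) + s^(2g+2), with
    g = (m - 1)./2, along s = 1 / x, t = y / x^(g+1).  Both are smooth, so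
    their regular differentials are the restrictions of polynomial 1-forms, and
    a global differential is a pair of such that agree on the overlap. *)
Definition regular_forms (m : nat) : set oneform :=
  let g := (m.-1)./2 in
  [set w | exists w' : oneform, forall x y dx dy,
     tangent m x y dx dy -> x != 0 ->
     oneform_at w x y dx dy =
     oneform_at w' (x^-1) (y / x ^+ g.+1)
       (- dx / x ^+ 2) (dy / x ^+ g.+1 - g.+1%:R * y * dx / x ^+ g.+2)].

Definition path_deriv (z : R -> C) (t : R) : C :=
  derive1 (fun s => complex.Re (z s)) t +i*
  derive1 (fun s => complex.Im (z s)) t.

Definition real_C1 (u : R -> R) :=
  (forall t, derivable u t 1) /\ continuous (derive1 u).

Definition C1 (z : R -> C) :=
  real_C1 (fun s => complex.Re (z s)) /\ real_C1 (fun s => complex.Im (z s)).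

Definition complex_integral (u : R -> C) : C :=
  Rintegral lebesgue_measure `[0, 1] (fun t => complex.Re (u t)) +i*
  Rintegral lebesgue_measure `[0, 1] (fun t => complex.Im (u t)).

Definition loop (m : nat) (x y : R -> C) :=
  [/\ C1 x, C1 y, forall t, 0 <= t <= 1 -> on_curve m (x t) (y t),
      x 0 = x 1 & y 0 = y 1].

Definition period (x y : R -> C) (w : oneform) : C :=
  complex_integral
    (fun t => oneform_at w (x t) (y t) (path_deriv x t) (path_deriv y t)).

(** J_m = H^0(C_m, Omega^1)^dual / H_1(C_m, Z).  Every class in
    H_1(C_m(C), Z) is that of a C^1 loop avoiding the points at infinity. *)
Definition curve_jacobian (m : nat) : torus R :=
  Torus (regular_forms m) [set l | exists x y, loop m x y /\ l = period x y].

(** eta is the trace of w along C_(p m) -> C_m, (x, y) |-> (x^p, y), i.e. its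
    sum over the fibre {(x, y) | x^p = u}; at x, the tangent vector (du, dy)
    lifts to (du / (p x^(p-1)), dy). *)
Definition is_trace (p m : nat) (w eta : oneform) :=
  forall u y du dy, tangent m u y du dy -> u != 0 ->
  forall s : seq C, uniq s -> (forall x, (x \in s) = (x ^+ p == u)) ->
    oneform_at eta u y du dy =
    \sum_(x <- s) oneform_at w x y (du / (p%:R * x ^+ p.-1)) dy.

(** X_(p^k) = J_(p^k) / B, where B is the image of the pullback homomorphism
    J_(p^(k-1)) -> J_(p^k).  This homomorphism induces on cotangent spaces the
    trace H^0(C_(p^k), Omega^1) -> H^0(C_(p^(k-1)), Omega^1), so the cotangent
    space of the quotient is the kernel of the trace; its lattice is the image
    of that of J_(p^k), i.e. the same functionals restricted to this kernel. *)
Definition simple_factor (p k : nat) : torus R :=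
  let J := curve_jacobian (p ^ k) in
  Torus (cot (t := J) `&` [set w : oneform | is_trace p (p ^ k.-1) w 0])
    (lattice (t := J)).

(** B is the matrix of the pullback H^1(X_(p^k), Q) -> H^1(J_(p^k), Q) along the
    projection, in the bases dual to e' and e: it is the transpose of the
    matrix of the map H_1(J_(p^k), Q) -> H_1(X_(p^k), Q), which restricts a
    functional to the smaller cotangent space. *)
Definition projection_matrix (p k n r : nat) (e : 'I_n -> (oneform -> C))
    (e' : 'I_r -> (oneform -> C)) (B : 'M[rat]_(n, r)) :=
  forall j w, cot (t := simple_factor p k) w ->
    e j w = \sum_(i < r) ratr (B j i) * e' i w.

End Curve.

(** Let B be the matrix of an injective linear map Q^r -> Q^n.  The relation
    g B = B g' says that g stabilizes the image of B and restricts to g' on it.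
    Restriction is an isomorphism from the group scheme S to the group scheme S'
    when, on points in every commutative Q-algebra, it is defined on S with
    values in S' and bijective. *)
Definition restriction_iso n r (B : 'M[rat]_(n, r))
    (S : equations n) (S' : equations r) :=
  forall (A : comUnitRingType) (f : {rmorphism rat -> A}),
    (forall g, points S f g ->
       exists! g', points S' f g' /\ g *m map_mx f B = map_mx f B *m g') /\
    (forall g', points S' f g' ->
       exists! g, points S f g /\ g *m map_mx f B = map_mx f B *m g').

(* Main.v *)
Require Import Defs.
From HB Require Import structures.
From mathcomp Require Import all_boot all_order all_algebra.
From mathcomp Require Import all_classical all_reals all_analysis.
From mathcomp Require Import cyclic separable cyclotomic.
From mathcomp Require Import complex.
From mathcomp Require Import ring lra zify.
From mathcomp Require Import (canonicals) mpoly.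
Import Order.TTheory GRing.Theory Num.Theory numFieldNormedType.Exports.
Local Open Scope classical_set_scope.
Local Open Scope complex_scope.
Local Open Scope ring_scope.

Set Implicit Arguments.
Unset Strict Implicit.
Unset Printing Implicit Defensive.

(** Put m = p ^ k.  The rotation (x, y) |-> (zeta_m x, y) acts on the forms
    x ^ (j - 1) dx / y by zeta_m ^ j, and a loop whose periods along all of them
    are nonzero shows that H_1(J_m, Q) is a free module of rank one over
    Q[t] / (1 + t + ... + t ^ (m - 1)); the quotient X_m corresponds to the factor
    whose roots are the zeta_m ^ j with p not dividing j.  A point of either
    Mumford-Tate group thus commutes with the rotation and is given by characters
    chi_j, j in Z / m nonzero; h(z) has chi_j = z if j < m / 2 and the conjugate of z
    otherwise.  For q = p ^ a with a < k and u prime to p, the identity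
      chi_(u q) = \prod_(t < q) chi_(u + u t m / q) / (chi_u chi_(-u)) ^ ((q - 1) / 2)
    holds for h(z) and only involves, on the right, characters of X_m.  It defines
    a homomorphic section of the restriction, on an algebraic subgroup containing
    the image of h, hence on MT(X_m); the section takes values in MT(J_m), because
    the preimage of MT(J_m) contains the image of h, and it inverts the restriction
    on MT(J_m), because it does so on the image of h. *)

(** Points are therefore handled as polynomials in a rational matrix; eigenvectors over C only serve
    to prove identities between rational matrices, which then hold over every algebra, and to
    compute with h(z). The identity for chi_(u q) is a count: the indices u + u t m / q are all the
    lifts to Z / m of u modulo m / q, and (q - 1) / 2 or (q + 1) / 2 of them lie in the lower half,
    while chi_u chi_(-u) is z times its conjugate. For a general matrix commuting with the rotation,
    the values so prescribed need not come from one polynomial in the rotation of J_m; that they do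
    is imposed as a closed condition. The topology of C_m enters only through local primitives of x
    ^ (j - 1) dx / y. Between two charts they differ by a constant depending on j times the value at
    zeta_m ^ j of a rational polynomial which is the same for all j: this puts all periods in Q[t],
    up to scaling. *)

Section PowerCombinations.

(** * Linear combinations of the powers of a matrix *)

Variable A : comUnitRingType.

Definition power_comb d r (U : 'M[A]_r) (c : 'rV[A]_d) : 'M[A]_r :=
  \sum_(i < d) c 0 i *: U ^+ i.

Lemma power_comb_is_linear d r (U : 'M[A]_r) :
  linear (@power_comb d r U).
Proof.
move=> a c c'; rewrite /power_comb scaler_sumr -big_split; apply: eq_bigr => i _.
by rewrite !mxE scalerDl scalerA.
Qed.

Lemma power_comb_comm d r (c : 'rV[A]_d) (U g : 'M[A]_r) :
  GRing.comm g U -> GRing.comm g (power_comb U c).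
Proof.
move=> gU; apply: commr_sum => i _.
by rewrite /GRing.comm -!mulmxE -scalemxAr -scalemxAl !mulmxE (commrX i gU).
Qed.

Lemma power_comb_intertwine d n r (c : 'rV[A]_d) (T : 'M[A]_n) (U : 'M[A]_r)
    (b : 'M[A]_(n, r)) :
  T *m b = b *m U -> power_comb T c *m b = b *m power_comb U c.
Proof.
move=> Tb; have TXb i : T ^+ i *m b = b *m U ^+ i.
  elim: i => [|i IH]; first by rewrite !expr0 mul1mx mulmx1.
  by rewrite !exprSr -!mulmxE -mulmxA Tb mulmxA IH !mulmxA.
rewrite mulmx_suml mulmx_sumr; apply: eq_bigr => i _.
by rewrite -scalemxAl TXb scalemxAr.
Qed.

Lemma eigen_exp n (T : 'M[A]_n) a (v : 'cV[A]_n) i :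
  T *m v = a *: v -> T ^+ i *m v = a ^+ i *: v.
Proof.
move=> Tv; elim: i => [|i IH]; first by rewrite !expr0 mul1mx scale1r.
by rewrite !exprSr -!mulmxE -mulmxA Tv -scalemxAr IH scalerA mulrC.
Qed.

Lemma eigen_mul n (T U : 'M[A]_n) a b (v : 'cV[A]_n) :
  T *m v = a *: v -> U *m v = b *: v -> (T * U) *m v = (a * b) *: v.
Proof.
by move=> Tv Uv; rewrite -mulmxE -mulmxA Uv -scalemxAr Tv scalerA mulrC.
Qed.

Lemma eigen_prod n q (T : 'I_q -> 'M[A]_n) a (v : 'cV[A]_n) :
  (forall i, T i *m v = a i *: v) ->
  (\prod_i T i) *m v = (\prod_i a i) *: v.
Proof.
move=> Tv; elim/big_rec2: _ => [|i b U _ IH]; first by rewrite mul1mx scale1r.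
exact: eigen_mul.
Qed.

Lemma eigen_power_comb d r (U : 'M[A]_r) (c : 'rV[A]_d) a (v : 'cV[A]_r) :
  U *m v = a *: v ->
  power_comb U c *m v = (\sum_(i < d) c 0 i * a ^+ i) *: v.
Proof.
move=> Uv; rewrite mulmx_suml scaler_suml; apply: eq_bigr => i _.
by rewrite -scalemxAl (eigen_exp i Uv) scalerA.
Qed.

End PowerCombinations.

HB.instance Definition _ (A : comUnitRingType) d r (U : 'M[A]_r) :=
  GRing.isLinear.Build A 'rV[A]_d 'M[A]_r _ (@power_comb A d r U)
    (power_comb_is_linear U).

Lemma map_power_comb (A A' : comUnitRingType) (h : {rmorphism A -> A'}) d r
    (c : 'rV[A]_d) (U : 'M[A]_r) :
  map_mx h (power_comb U c) = power_comb (map_mx h U) (map_mx h c).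
Proof.
rewrite /power_comb raddf_sum; apply: eq_bigr => i _.
by rewrite /= map_mxZ rmorphXn /= mxE.
Qed.

(** * The commutant of a matrix with a cyclic vector *)

Definition krylov n (T : 'M[rat]_n) (y : 'rV[rat]_n) : 'M[rat]_n :=
  \matrix_(i < n) (y *m T ^+ i).

Section Commutant.
Variables (n : nat) (T : 'M[rat]_n) (y : 'rV[rat]_n).
Hypothesis unit_krylov : krylov T y \in unitmx.
Variables (A : comUnitRingType) (f : {rmorphism rat -> A}).
Local Notation "M ^f" := (map_mx f M) : ring_scope.

(** The coordinates of [y *m g] in the basis of the [y *m T ^+ i]. The basis is rational, so it
    remains one over every Q-algebra, and these coordinates determine any [g] commuting with [T]. *)
Definition commutant_coef (g : 'M[A]_n) : 'rV[A]_n :=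
  y^f *m g *m (invmx (krylov T y))^f.

Lemma mul_row_krylov (c : 'rV[A]_n) :
  y^f *m power_comb T^f c = c *m (krylov T y)^f.
Proof.
apply/rowP => l; rewrite mulmx_sumr summxE !mxE; apply: eq_bigr => i _.
by rewrite -scalemxAr -rmorphXn -map_mxM !mxE.
Qed.

Lemma power_combK (c : 'rV[A]_n) : commutant_coef (power_comb T^f c) = c.
Proof. by rewrite /commutant_coef mul_row_krylov -mulmxA -map_mxM mulmxV // map_mx1 mulmx1. Qed.

(** A matrix that commutes with [T] and kills [y] kills every row [y *m T ^+ i], and these rows form
    a basis. *)
Lemma commutant_eq0 (X : 'M[A]_n) : GRing.comm X T^f -> y^f *m X = 0 -> X = 0.
Proof.
move=> XT yX; have KX : (krylov T y)^f *m X = 0.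
  apply/row_matrixP => i; rewrite row_mul row0 -map_row rowK map_mxM rmorphXn /=.
  by rewrite -mulmxA mulmxE -(commrX i XT) -mulmxE mulmxA yX mul0mx.
by rewrite -[X]mul1mx -(map_mx1 f) -(mulVmx unit_krylov) map_mxM -mulmxA KX mulmx0.
Qed.

Lemma commutant_coefK (g : 'M[A]_n) :
  GRing.comm g T^f -> power_comb T^f (commutant_coef g) = g.
Proof.
move=> gT; apply/eqP; rewrite -subr_eq0; apply/eqP/commutant_eq0.
  apply/commr_sym/commrB; last exact: commr_sym.
  exact: power_comb_comm.
rewrite mulmxBr mul_row_krylov /commutant_coef -mulmxA -map_mxM mulVmx // map_mx1.
by rewrite mulmx1 subrr.
Qed.

Lemma commutant_comm (g h : 'M[A]_n) :
  GRing.comm g T^f -> GRing.comm h T^f -> GRing.comm g h.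
Proof.
by move=> gT hT; rewrite -(commutant_coefK hT); apply: power_comb_comm.
Qed.

End Commutant.

(* When g = P(T) for a polynomial P over A, [transport T y f U g] is P(U). *)
Definition transport n (T : 'M[rat]_n) y (A : comUnitRingType)
    (f : {rmorphism rat -> A}) r (U : 'M[rat]_r) (g : 'M[A]_n) : 'M[A]_r :=
  power_comb (map_mx f U) (commutant_coef T y f g).

Lemma map_commutant_coef n (T : 'M[rat]_n) y (A A' : comUnitRingType)
    (f : {rmorphism rat -> A}) (f' : {rmorphism rat -> A'})
    (h : {rmorphism A -> A'}) (g : 'M[A]_n) :
  (forall x, h (f x) = f' x) ->
  map_mx h (commutant_coef T y f g) = commutant_coef T y f' (map_mx h g).
Proof.
move=> hf; rewrite /commutant_coef !map_mxM -!map_mx_comp.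
by congr (_ *m _ *m _); apply/matrixP => i j; rewrite !mxE /=.
Qed.

Lemma map_transport n (T : 'M[rat]_n) y (A A' : comUnitRingType)
    (f : {rmorphism rat -> A}) (f' : {rmorphism rat -> A'})
    (h : {rmorphism A -> A'}) r (U : 'M[rat]_r) (g : 'M[A]_n) :
  (forall x, h (f x) = f' x) ->
  map_mx h (transport T y f U g) = transport T y f' U (map_mx h g).
Proof.
move=> hf; rewrite /transport map_power_comb (map_commutant_coef _ _ _ hf) -map_mx_comp.
by congr power_comb; apply/matrixP => i j; rewrite !mxE /=.
Qed.

(** * Transport from polynomials in T to polynomials in U *)

Section Transport.
Variables (n : nat) (T : 'M[rat]_n) (y : 'rV[rat]_n).
Hypothesis unit_krylov : krylov T y \in unitmx.
Variables (r : nat) (U : 'M[rat]_r).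
Let id_rat : {rmorphism rat -> rat} := idfun.
(** The definition of [transport] only uses exponents below [n]. Asking this for all [l], over the
    rationals, says that sending [T] to [U] respects the relations between the powers of [T];
    multiplicativity over every algebra follows. *)
Hypothesis transportX : forall l, transport T y id_rat U (T ^+ l) = U ^+ l.
Variables (A : comUnitRingType) (f : {rmorphism rat -> A}).
Local Notation "M ^f" := (map_mx f M) : ring_scope.
Local Notation kappa := (transport T y f U).

Lemma transport_is_linear : linear kappa.
Proof.
move=> a g h; rewrite /transport /commutant_coef.
by rewrite mulmxDr mulmxDl -scalemxAr -scalemxAl linearP.
Qed.

HB.instance Definition _ :=
  GRing.isLinear.Build A 'M[A]_n 'M[A]_r _ kappa transport_is_linear.

Lemma transport_exp l : kappa (T^f ^+ l) = U^f ^+ l.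
Proof.
rewrite -!rmorphXn /= -transportX (map_transport _ _ (f' := f)) ?map_mx_id //.
Qed.

Lemma transport1 : kappa 1%:M = 1%:M.
Proof. exact: (transport_exp 0). Qed.

Lemma transportM (g h : 'M[A]_n) :
  GRing.comm g T^f -> GRing.comm h T^f -> kappa (g *m h) = kappa g *m kappa h.
Proof.
move=> gT hT; rewrite -[in LHS](commutant_coefK unit_krylov gT).
rewrite -[in LHS](commutant_coefK unit_krylov hT) {2 3}/transport.
rewrite !mulmx_suml linear_sum; apply: eq_bigr => i _ /=.
rewrite !mulmx_sumr linear_sum; apply: eq_bigr => j _ /=.
rewrite -!scalemxAl -!scalemxAr !linearZ /= !mulmxE -!exprD.
by rewrite transport_exp !scalerA; congr (_ *: _); apply: mulrC.
Qed.

Lemma transport_power_comb (c : 'rV[A]_n) :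
  kappa (power_comb T^f c) = power_comb U^f c.
Proof. by rewrite /transport power_combK. Qed.

Lemma transport_comm (g : 'M[A]_n) (V : 'M[A]_r) :
  GRing.comm V U^f -> GRing.comm V (kappa g).
Proof. exact: power_comb_comm. Qed.

(** If g = P(T), the normalization of [v] gives b = P(a), which is also the eigenvalue of P(U) at
    [w]. *)
Lemma eigen_transport (g : 'M[A]_n) a b (v : 'cV[A]_n) (w : 'cV[A]_r) :
  GRing.comm g T^f -> T^f *m v = a *: v -> y^f *m v = 1 -> U^f *m w = a *: w ->
  g *m v = b *: v -> kappa g *m w = b *: w.
Proof.
move=> gT Tv yv Uw gv; rewrite (eigen_power_comb _ Uw); congr (_ *: _).
have := congr1 (mulmx y^f) gv; rewrite -[in LHS](commutant_coefK unit_krylov gT).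
rewrite (eigen_power_comb _ Tv) -!scalemxAr yv => /matrixP/(_ 0 0).
by rewrite !mxE !mulr1.
Qed.

End Transport.

(** * Cyclic algebras and their eigenvectors *)

Section CyclicModel.
Variables (C : fieldType) (iota : {rmorphism rat -> C}) (zeta : C).
Local Notation "M ^f" := (map_mx iota M) : ring_scope.

(* A model of Q[t] modulo the polynomial with roots zeta ^+ j, j in S: T is
   multiplication by t, y is a cyclic vector, and E j is the eigenvector
   given by evaluation at zeta ^+ j. *)
Definition cyclic_model (S : pred nat) n (T : 'M[rat]_n) (y : 'rV[rat]_n)
    (E : nat -> 'cV[C]_n) :=
  [/\ forall j, S j -> T^f *m E j = zeta ^+ j *: E j,
      forall j, S j -> y^f *m E j = 1,
      krylov T y \in unitmx
    & forall c : 'rV[C]_n,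
        (forall j, S j -> \sum_(i < n) c 0 i * (zeta ^+ j) ^+ i = 0) -> c = 0].

Section OneModel.
Variables (S : pred nat) (n : nat) (T : 'M[rat]_n) (y : 'rV[rat]_n).
Variable E : nat -> 'cV[C]_n.
Hypothesis model : cyclic_model S T y E.

Lemma mul_krylov_eigen (c : 'rV[C]_n) j : S j ->
  (c *m (krylov T y)^f) *m E j = (\sum_(i < n) c 0 i * (zeta ^+ j) ^+ i)%:M.
Proof.
have [TE yE _ _] := model => Sj.
rewrite -mul_row_krylov -mulmxA (eigen_power_comb _ (TE _ Sj)) -scalemxAr yE //.
by rewrite scalemx1.
Qed.

(** A row written in the Krylov basis with coefficients [c] pairs with [E j] to the value at zeta ^
    j of the polynomial [c], which has degree below [n]. Matrix identities can thus be tested on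
    eigenvectors. *)
Lemma eigenvectors_separate q (X : 'M[C]_(q, n)) :
  (forall j, S j -> X *m E j = 0) -> X = 0.
Proof.
have [_ _ uK c0] := model => XE.
apply/row_matrixP => i; rewrite row0.
have defX : row i X = row i X *m (invmx (krylov T y))^f *m (krylov T y)^f.
  by rewrite -mulmxA -map_mxM mulVmx // map_mx1 mulmx1.
rewrite defX [X in X *m _]c0 ?mul0mx // => j Sj.
have := mul_krylov_eigen (row i X *m (invmx (krylov T y))^f) Sj.
rewrite -defX -row_mul XE // row0 => /matrixP/(_ 0 0).
by rewrite !mxE eqxx mulr1n => <-.
Qed.

Lemma eigenvectors_eq q (X Y : 'M[C]_(q, n)) :
  (forall j, S j -> X *m E j = Y *m E j) -> X = Y.
Proof.
move=> XY; apply/eqP; rewrite -subr_eq0; apply/eqP/eigenvectors_separate.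
by move=> j Sj; rewrite mulmxBl XY ?subrr.
Qed.

Lemma eigen_comm (g : 'M[C]_n) (chi : nat -> C) :
  (forall j, S j -> g *m E j = chi j *: E j) -> GRing.comm g T^f.
Proof.
have [TE _ _ _] := model => gE; apply: eigenvectors_eq => j Sj.
by rewrite (eigen_mul (gE _ Sj) (TE _ Sj)) (eigen_mul (TE _ Sj) (gE _ Sj)) mulrC.
Qed.

Lemma eigenvector_neq0 j : S j -> E j != 0.
Proof.
have [_ yE _ _] := model => Sj; apply/eqP => E0.
have := yE _ Sj; rewrite E0 mulmx0 => /matrixP/(_ 0 0).
by rewrite !mxE => /esym/eqP; rewrite oner_eq0.
Qed.

End OneModel.

Section TwoModels.
Variables (S S' : pred nat) (n r : nat).
Variables (T : 'M[rat]_n) (y : 'rV[rat]_n) (E : nat -> 'cV[C]_n).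
Variables (T' : 'M[rat]_r) (y' : 'rV[rat]_r) (E' : nat -> 'cV[C]_r).
Hypothesis model : cyclic_model S T y E.
Hypothesis model' : cyclic_model S' T' y' E'.
Variable e : nat.
Hypothesis Se : forall u, S' u -> S (u * e)%N.

Lemma eigen_model_exp u : S' u ->
  (T' ^+ e)^f *m E' u = zeta ^+ (u * e) *: E' u.
Proof.
have [TE' _ _ _] := model' => Su.
by rewrite rmorphXn /= (eigen_exp _ (TE' _ Su)) exprM.
Qed.

Lemma eigen_model_transport (g : 'M[C]_n) (chi : nat -> C) :
  (forall j, S j -> g *m E j = chi j *: E j) ->
  forall u, S' u -> transport T y iota (T' ^+ e) g *m E' u = chi (u * e)%N *: E' u.
Proof.
have [TE yE uK _] := model => gE u Su.
have Sue := Se Su.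
apply: (@eigen_transport _ _ _ uK _ _ _ _ _ (zeta ^+ (u * e)) _ (E (u * e)%N)).
- exact: (eigen_comm model gE).
- exact: TE.
- exact: yE.
- exact: eigen_model_exp.
- exact: gE.
Qed.

(** By [Se], t |-> t ^ e carries roots of the second model to roots of the first, so [T' ^+ e]
    satisfies the relations of [T]. The identity is between rational matrices but is read on
    eigenvectors. *)
Lemma model_transportX l :
  transport T y (idfun : {rmorphism rat -> rat}) (T' ^+ e) (T ^+ l) =
  (T' ^+ e) ^+ l.
Proof.
have [TE _ _ _] := model; apply: (map_mx_inj (f := iota)).
rewrite (map_transport _ _ (f' := iota)) //.
apply: (eigenvectors_eq model') => u Su.
rewrite (eigen_model_transport (chi := fun j => (zeta ^+ j) ^+ l)) //; last first.
  by move=> j Sj; rewrite rmorphXn /= (eigen_exp _ (TE _ Sj)).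
by rewrite [in RHS]rmorphXn /= (eigen_exp _ (eigen_model_exp Su)).
Qed.

End TwoModels.
End CyclicModel.

(** * The section of the restriction, as a map on matrices *)

Section ReciprocalSection.
Variables (C : fieldType) (iota : {rmorphism rat -> C}) (zeta : C).
Variables (p k : nat).
Hypotheses (p_prime : prime p) (k_gt0 : (0 < k)%N).
Local Notation m := (p ^ k)%N.
Variables (n r : nat).
Variables (T : 'M[rat]_n) (y : 'rV[rat]_n) (E : nat -> 'cV[C]_n).
Variables (T' : 'M[rat]_r) (y' : 'rV[rat]_r) (E' : nat -> 'cV[C]_r).
Hypothesis model : cyclic_model iota zeta (fun j => ~~ (m %| j)%N) T y E.
Hypothesis model' : cyclic_model iota zeta (fun j => ~~ (p %| j)%N) T' y' E'.

Let unit_krylov : krylov T y \in unitmx. Proof. by case: model. Qed.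
Let unit_krylov' : krylov T' y' \in unitmx. Proof. by case: model'. Qed.

Lemma coprime_mul_ndvd u v :
  ~~ (p %| v)%N -> ~~ (p %| u)%N -> ~~ (p %| u * v)%N.
Proof. by move=> pv pu; rewrite Euclid_dvdM // negb_or pu. Qed.

Lemma ndvd_twist a t : (a < k)%N -> ~~ (p %| 1 + t * p ^ (k - a))%N.
Proof.
move=> ak; rewrite dvdn_addl ?dvdn1 ?neq_ltn ?prime_gt1 ?orbT //.
by apply: dvdn_mull; rewrite dvdn_exp // subn_gt0.
Qed.

Lemma ndvd_pred : ~~ (p %| m.-1)%N.
Proof.
apply/negP => pm; have : (p %| 1)%N.
  rewrite -(dvdn_addl 1 pm) add1n prednK ?expn_gt0 ?prime_gt0 //.
  exact: dvdn_exp.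
by rewrite dvdn1 => /eqP p1; move: (prime_gt1 p_prime); rewrite p1.
Qed.

Lemma ndvd_level a u : (a < k)%N -> ~~ (p %| u)%N -> ~~ (m %| u * p ^ a)%N.
Proof.
move=> ak; apply: contra => mu; rewrite -(@dvdn_pmul2r (p ^ a)%N) ?expn_gt0 ?prime_gt0 //.
by apply: dvdn_trans mu; rewrite -expnS dvdn_exp2l.
Qed.

(** When p does not divide [e], this is the automorphism t |-> t ^ e of the algebra of X_m: it
    replaces chi_u by chi_(u e). *)
Definition twist (A : comUnitRingType) (f : {rmorphism rat -> A}) e (g : 'M[A]_r) :=
  transport T' y' f (T' ^+ e) g.

(* The right-hand side of the identity expressing chi_(u q), q = p ^ a, for the
   characters of g; the argument h stands for the inverse of g. *)
Definition level (A : comUnitRingType) (f : {rmorphism rat -> A}) a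
    (g h : 'M[A]_r) : 'M[A]_r :=
  (\prod_(t < p ^ a) twist f (1 + t * p ^ (k - a))%N g) *
  (h * twist f m.-1 h) ^+ (p ^ a)%N.-1./2.

Definition levels (A : comUnitRingType) (x : nat -> 'M[A]_r) : 'rV[A]_(k * (r * r)) :=
  mxvec (\matrix_(a < k) mxvec (x a)).

(** The map t |-> (t ^ (p ^ a))_(a < k) from the algebra of J_m to k copies of that of X_m, on the
    powers of t. Its values are flattened into rows so that a pseudo-inverse yields a rational left
    inverse. *)
Definition levels_mx : 'M[rat]_(n, k * (r * r)) :=
  \matrix_(i < n) levels (fun a => (T' ^+ (p ^ a)) ^+ i).

Lemma levels_inj (A : comUnitRingType) (x x' : nat -> 'M[A]_r) :
  levels x = levels x' -> forall a, (a < k)%N -> x a = x' a.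
Proof.
move/(can_inj mxvecK) => /row_matrixP xx' a ak.
by have := xx' (Ordinal ak); rewrite !rowK => /(can_inj mxvecK).
Qed.

Lemma eq_levels (A : comUnitRingType) (x x' : nat -> 'M[A]_r) :
  (forall a, (a < k)%N -> x a = x' a) -> levels x = levels x'.
Proof.
move=> xx'; congr mxvec; apply/row_matrixP => a.
by rewrite !rowK xx'.
Qed.

Lemma mul_levels_mx (A : comUnitRingType) (f : {rmorphism rat -> A}) (c : 'rV[A]_n) :
  c *m map_mx f levels_mx =
  levels (fun a => power_comb (map_mx f (T' ^+ (p ^ a))) c).
Proof.
have -> : c *m map_mx f levels_mx =
    \sum_(i < n) c 0 i *: levels (fun a => map_mx f (T' ^+ (p ^ a)) ^+ i).
  rewrite mulmx_sum_row; apply: eq_bigr => i _; congr (_ *: _).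
  rewrite -map_row rowK /levels map_mxvec; congr mxvec.
  apply/row_matrixP => a; rewrite -map_row !rowK map_mxvec; congr mxvec.
  by rewrite !rmorphXn.
rewrite /levels.
transitivity (mxvec (\sum_(i < n) c 0 i *:
    \matrix_(a < k) mxvec (map_mx f (T' ^+ (p ^ a)) ^+ i))).
  by rewrite linear_sum; apply: eq_bigr => i _; rewrite linearZ.
congr mxvec; apply/row_matrixP => a; rewrite rowK !raddf_sum.
by apply: eq_bigr => i _; rewrite /= !linearZ /= rowK.
Qed.

(** Every j not divisible by m is u p ^ a with p not dividing u and a < k, so the k levels together
    see all the roots of the first model. *)
Lemma levels_comb_inj (c c' : 'rV[C]_n) :
  (forall a, (a < k)%N ->
     power_comb (map_mx iota (T' ^+ (p ^ a))) c =
     power_comb (map_mx iota (T' ^+ (p ^ a))) c') -> c = c'.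
Proof.
move=> cc'; apply/eqP; rewrite -subr_eq0; apply/eqP.
have [_ _ _ c0] := model; apply: c0 => j mj.
have [j0|j_gt0] := posnP j; first by rewrite j0 dvdn0 in mj.
have [u pu jE] := pfactor_coprime p_prime j_gt0.
have ak : (logn p j < k)%N by rewrite ltnNge -pfactor_dvdn.
have pu' : ~~ (p %| u)%N by rewrite -prime_coprime.
have cc'u := congr1 (mulmx^~ (E' u)) (cc' _ ak).
rewrite !(eigen_power_comb _ (eigen_model_exp model' (p ^ logn p j) pu')) -jE in cc'u.
move/eqP: cc'u; rewrite -subr_eq0 -scalerBl scaler_eq0.
rewrite (negPf (eigenvector_neq0 model' pu')) orbF -sumrB => /eqP s0; rewrite -[RHS]s0.
by apply: eq_bigr => i _; rewrite !mxE mulrBl.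
Qed.

Lemma levels_mx_free : row_free levels_mx.
Proof.
apply: inj_row_free => v vL; apply: (map_mx_inj (f := iota)); rewrite map_mx0.
apply: levels_comb_inj; apply: levels_inj; rewrite -!mul_levels_mx.
by rewrite mul0mx -map_mxM vL map_mx0.
Qed.

Section Points.
Variables (A : comUnitRingType) (f : {rmorphism rat -> A}).
Implicit Types g h : 'M[A]_r.

Let commT g := GRing.comm g (map_mx f T').

Lemma commT_twist e g : commT (twist f e g).
Proof.
by apply/commr_sym/transport_comm; rewrite rmorphXn; apply: commrX.
Qed.

Lemma twistM e g h : ~~ (p %| e)%N -> commT g -> commT h ->
  twist f e (g * h) = twist f e g * twist f e h.
Proof.
move=> pe gT hT; apply: (transportM unit_krylov') => // l.
apply: (model_transportX model' model') => u; exact: coprime_mul_ndvd.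
Qed.

Lemma twist1 e : ~~ (p %| e)%N -> twist f e 1 = 1.
Proof.
move=> pe; apply: transport1 => l.
apply: (model_transportX model' model') => u; exact: coprime_mul_ndvd.
Qed.

(** The order in [h' * h] is that of the inverse of [g * g']. All factors lie in the commutant of
    [T'], which is commutative, and each twist is multiplicative there. *)
Lemma levelM a g g' h h' : (a < k)%N ->
  commT g -> commT g' -> commT h -> commT h' ->
  level f a (g * g') (h' * h) = level f a g h * level f a g' h'.
Proof.
move=> ak gT g'T hT h'T; rewrite /level.
have comm x x' : commT x -> commT x' -> GRing.comm x x'.
  exact: (commutant_comm unit_krylov').
have twM e x x' : ~~ (p %| e)%N -> commT x -> commT x' ->
    twist f e (x * x') = twist f e x * twist f e x' by exact: twistM.
have -> : \prod_(t < p ^ a) twist f (1 + t * p ^ (k - a)) (g * g') =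
    (\prod_(t < p ^ a) twist f (1 + t * p ^ (k - a)) g) *
    \prod_(t < p ^ a) twist f (1 + t * p ^ (k - a)) g'.
  rewrite -prodrM_comm; last by move=> i j _ _; apply: comm; exact: commT_twist.
  by apply: eq_bigr => t _; rewrite twM // ndvd_twist.
have -> : h' * h * twist f m.-1 (h' * h) =
    (h * twist f m.-1 h) * (h' * twist f m.-1 h').
  rewrite twM ?ndvd_pred // (comm h' h) // -!mulrA; congr (_ * _).
  rewrite mulrA (comm (h' * _)) //; last exact: commT_twist.
  by apply/commr_sym/commrM; apply/commr_sym => //; exact: commT_twist.
have commS x : commT x -> commT (x * twist f m.-1 x).
  move=> xT; apply: commr_sym; apply: commrM; apply: commr_sym => //.
  exact: commT_twist.
rewrite exprMn_comm; last by apply: comm; apply: commS.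
rewrite !mulrA; congr (_ * _); rewrite -!mulrA; congr (_ * _).
apply: comm; first by apply/commr_sym/commr_prod => t _; exact/commr_sym/commT_twist.
by apply/commr_sym/commrX/commr_sym/commS.
Qed.

Lemma level1 a : (a < k)%N -> level f a 1 1 = 1.
Proof.
move=> ak; rewrite /level twist1 ?ndvd_pred // mulr1 expr1n mulr1.
by apply: big1 => t _; rewrite twist1 // ndvd_twist.
Qed.

Definition section_coef g h : 'rV[A]_n :=
  levels (fun a => level f a g h) *m map_mx f (pinvmx levels_mx).

Definition section_mx g h : 'M[A]_n := power_comb (map_mx f T) (section_coef g h).

(** A family of levels need not lie in the image of [levels_mx], and the pseudo-inverse in
    [section_coef] is a true preimage only when it does. This is a polynomial equation in [g] and
    [h], so it can be imposed on points of a group scheme. *)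
Definition in_section_range g h :=
  section_coef g h *m map_mx f levels_mx = levels (fun a => level f a g h).

(** The range condition is imposed in both orders so that the domain is stable under inversion,
    which exchanges the two arguments. *)
Definition section_dom g h :=
  [/\ commT g, commT h, in_section_range g h & in_section_range h g].

Lemma section_dom_sym g h : section_dom g h -> section_dom h g.
Proof. by case. Qed.

Lemma section_levels g h a : in_section_range g h -> (a < k)%N ->
  power_comb (map_mx f (T' ^+ (p ^ a))) (section_coef g h) = level f a g h.
Proof. by rewrite /in_section_range mul_levels_mx => /levels_inj; apply. Qed.

Lemma section_coef_unique (c : 'rV[A]_n) g h :
  c *m map_mx f levels_mx = levels (fun a => level f a g h) ->
  section_coef g h = c.
Proof.
rewrite /section_coef => <-.
by rewrite -mulmxA -map_mxM mulmxVp ?levels_mx_free // map_mx1 mulmx1.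
Qed.

(** The product of the two sections is a polynomial in [T] whose levels are the products of the
    levels, that is the levels of the product. Injectivity of [levels_mx] identifies it with the
    section there, and the range condition comes for free. *)
Lemma section_mul_range g g' h h' :
  commT g -> commT g' -> commT h -> commT h' ->
  in_section_range g h -> in_section_range g' h' ->
  in_section_range (g * g') (h' * h) /\
  section_mx (g * g') (h' * h) = section_mx g h * section_mx g' h'.
Proof.
move=> gT g'T hT h'T gR g'R.
set s := section_mx g h * section_mx g' h'.
have comm_section x x' : GRing.comm (section_mx x x') (map_mx f T).
  by apply: commr_sym; apply: power_comb_comm.
have sT : GRing.comm s (map_mx f T).
  by apply: commr_sym; apply: commrM; apply: commr_sym; apply: comm_section.
have sE : power_comb (map_mx f T) (commutant_coef T y f s) = s.
  exact: (commutant_coefK unit_krylov sT).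
have cL : commutant_coef T y f s *m map_mx f levels_mx =
    levels (fun a => level f a (g * g') (h' * h)).
  rewrite mul_levels_mx; apply: eq_levels => a ak.
  rewrite -[LHS]/(transport T y f (T' ^+ (p ^ a)) s) /s.
  have tX := model_transportX model model' (fun u => @ndvd_level a u ak).
  rewrite [LHS](transportM unit_krylov tX (comm_section g h) (comm_section g' h')).
  by rewrite !transport_power_comb // !section_levels // levelM.
have cE := section_coef_unique cL.
by split; rewrite /in_section_range /section_mx cE.
Qed.

Lemma section_domM g g' h h' : section_dom g h -> section_dom g' h' ->
  section_dom (g * g') (h' * h) /\
  section_mx (g * g') (h' * h) = section_mx g h * section_mx g' h'.
Proof.
move=> [gT hT gR hR] [g'T h'T g'R h'R].
have [R1 ->] := section_mul_range gT g'T hT h'T gR g'R.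
have [R2 _] := section_mul_range h'T hT g'T gT h'R hR.
by split=> //; split=> //; apply: commr_sym; apply: commrM; apply: commr_sym.
Qed.

Lemma section_dom1 : section_dom 1 1 /\ section_mx 1 1 = 1.
Proof.
have cL : commutant_coef T y f 1 *m map_mx f levels_mx =
    levels (fun a => level f a 1 1).
  rewrite mul_levels_mx; apply: eq_levels => a ak; rewrite level1 //.
  apply: transport1; exact: (model_transportX model model' (fun u => @ndvd_level a u ak)).
have cE := section_coef_unique cL.
have R1 : in_section_range 1 1 by rewrite /in_section_range cE.
split; first by split=> //; exact: commr_sym (commr1 _).
by rewrite /section_mx cE (commutant_coefK unit_krylov) //; exact: commr_sym (commr1 _).
Qed.

Lemma section_mx_restrict (B : 'M[rat]_(n, r)) g h :
  T *m B = B *m T' -> section_dom g h ->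
  section_mx g h *m map_mx f B = map_mx f B *m g.
Proof.
move=> TB [gT _ gR _]; rewrite (power_comb_intertwine _ (U := map_mx f T')); last first.
  by rewrite -!map_mxM TB.
congr (_ *m _); have := section_levels gR k_gt0; rewrite expn0 expr1 => ->.
(* Level 0 recovers [g]: the product has the single factor [twist f 1 g], and the exponent (1 - 1) /
   2 is 0. *)
rewrite /level expn0 big_ord1 /= mulr1 mul0n addn0 /twist expr1.
exact: (commutant_coefK unit_krylov' gT).
Qed.

End Points.

Section BaseChange.
Variables (A A' : comUnitRingType) (f : {rmorphism rat -> A}).
Variables (f' : {rmorphism rat -> A'}) (h : {rmorphism A -> A'}).
Hypothesis hf : forall x, h (f x) = f' x.

Let map_rat q s (X : 'M[rat]_(q, s)) : map_mx h (map_mx f X) = map_mx f' X.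
Proof. by rewrite -map_mx_comp; apply/matrixP => i j; rewrite !mxE /= hf. Qed.

Lemma map_level a g g' :
  map_mx h (level f a g g') = level f' a (map_mx h g) (map_mx h g').
Proof.
rewrite /level rmorphM rmorph_prod rmorphXn rmorphM /=.
rewrite /twist !(map_transport _ _ (f' := f')) //; congr (_ * _).
by apply: eq_bigr => t _; rewrite (map_transport _ _ (f' := f')).
Qed.

Lemma map_levels (x : nat -> 'M[A]_r) :
  map_mx h (levels x) = levels (fun a => map_mx h (x a)).
Proof.
rewrite /levels map_mxvec; congr mxvec; apply/row_matrixP => a.
by rewrite -map_row !rowK map_mxvec.
Qed.

Lemma map_section_coef g g' :
  map_mx h (section_coef f g g') = section_coef f' (map_mx h g) (map_mx h g').
Proof.
rewrite /section_coef map_mxM map_rat map_levels; congr (_ *m _).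
by apply: eq_levels => a _; rewrite map_level.
Qed.

Lemma map_section_mx g g' :
  map_mx h (section_mx f g g') = section_mx f' (map_mx h g) (map_mx h g').
Proof. by rewrite /section_mx map_power_comb map_rat map_section_coef. Qed.

(** Applied to the inclusion of R in C: the range condition is verified over C, where eigenvectors
    exist, and descends. *)
Lemma map_in_section_range g g' : injective h ->
  in_section_range f' (map_mx h g) (map_mx h g') -> in_section_range f g g'.
Proof.
move=> h_inj; rewrite /in_section_range -map_section_coef -map_rat -map_mxM.
rewrite (eq_levels (x' := fun a => map_mx h (level f a g g'))) => [|a _]; last first.
  by rewrite map_level.
rewrite -map_levels => /matrixP e; apply/matrixP => i j; apply: h_inj.
by have := e i j; rewrite !mxE.
Qed.

End BaseChange.

Section Eigenvalues.
Variables (g h : 'M[C]_r) (chi : nat -> C).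
Hypothesis gE : forall u, ~~ (p %| u)%N -> g *m E' u = chi u *: E' u.
Hypothesis hE : forall u, ~~ (p %| u)%N -> h *m E' u = (chi u)^-1 *: E' u.
Hypothesis chi_level : forall a u, (a < k)%N -> ~~ (p %| u)%N ->
  (\prod_(t < p ^ a) chi (u * (1 + t * p ^ (k - a)))%N) *
  ((chi u)^-1 * (chi (u * m.-1)%N)^-1) ^+ (p ^ a)%N.-1./2 = chi (u * p ^ a)%N.
Hypothesis chi_interp : exists c : 'rV[C]_n, forall j, ~~ (m %| j)%N ->
  \sum_(i < n) c 0 i * (zeta ^+ j) ^+ i = chi j.

Lemma eigen_level a u : (a < k)%N -> ~~ (p %| u)%N ->
  level iota a g h *m E' u = chi (u * p ^ a)%N *: E' u.
Proof.
move=> ak pu; rewrite -chi_level //.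
have tw e x psi : ~~ (p %| e)%N ->
    (forall v, ~~ (p %| v)%N -> x *m E' v = psi v *: E' v) ->
    twist iota e x *m E' u = psi (u * e)%N *: E' u.
  move=> pe xE; apply: (eigen_model_transport model' model') => // v.
  exact: coprime_mul_ndvd.
apply: eigen_mul.
  by apply: eigen_prod => t; apply: tw => //; exact: ndvd_twist.
apply: eigen_exp; apply: eigen_mul; first exact: hE.
exact: (tw _ _ (fun v => (chi v)^-1) ndvd_pred).
Qed.

(** The polynomial [c] interpolating the characters has, by [chi_level], the prescribed levels. By
    uniqueness its coefficients are those of the section, whose eigenvalue at [E j] is therefore
    chi_j. *)
Lemma eigen_section :
  in_section_range iota g h /\
  forall j, ~~ (m %| j)%N -> section_mx iota g h *m E j = chi j *: E j.
Proof.
have [c cE] := chi_interp; have [TE _ _ _] := model.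
have cL : c *m map_mx iota levels_mx = levels (fun a => level iota a g h).
  rewrite mul_levels_mx; apply: eq_levels => a ak.
  apply: (eigenvectors_eq model') => u pu; rewrite eigen_level //.
  rewrite (eigen_power_comb _ (eigen_model_exp model' (p ^ a) pu)) cE //.
  exact: ndvd_level.
have sE := section_coef_unique cL.
split=> [|j mj]; first by rewrite /in_section_range sE.
by rewrite /section_mx sE (eigen_power_comb _ (TE _ mj)) cE.
Qed.

End Eigenvalues.
End ReciprocalSection.

(** * The identity between the Hodge characters *)

Lemma modn_opp_half m x : odd m -> ~~ (m %| x)%N ->
  (((x * m.-1) %% m).*2 < m)%N = ~~ ((x %% m).*2 < m)%N.
Proof.
move=> m_odd mx; have m_gt0 : (0 < m)%N by case: (m) m_odd.
(* Multiplication by [m.-1] is negation modulo m: the two residues are nonzero and add up to m,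
   which is odd, so exactly one of them is below m / 2. *)
have : (m %| x * m.-1 %% m + x %% m)%N.
  by rewrite /dvdn modnDm -mulnSr prednK // modnMl.
have := ltn_pmod (x * m.-1) m_gt0; have := ltn_pmod x m_gt0.
have : (0 < x %% m)%N by rewrite lt0n.
move: (x * m.-1 %% m)%N (x %% m)%N => b a a_gt0 am bm /dvdnP[c bac].
clear x mx.
have {bac} ba : (b + a)%N = m.
  case: c bac => [|[|c]]; [lia | lia |].
  by move=> bac; exfalso; move: bac; rewrite !mulSn; lia.
apply/idP/idP; rewrite -leqNgt; lia.
Qed.

(** The u0 + s M with s < q are the lifts of u0 to Z / (q M). For q = 2 b + 1 the lower half
    contains b + 1 of them if u0 < M / 2 and b otherwise: hence the large or strict inequality. *)
Lemma double_shift_half q M u0 s : odd q -> odd M -> (u0 < M)%N ->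
  ((u0 + s * M).*2 < q * M)%N = if (u0.*2 < M)%N then (s <= q.-1./2)%N
                               else (s < q.-1./2)%N.
Proof.
move=> q_odd M_odd u0M.
have [b qE] : exists b, q = b.*2.+1 by exists q./2; rewrite -[LHS]odd_double_half q_odd.
rewrite {}qE /= doubleK.
have [d ME] : exists d, M = d.*2.+1 by exists M./2; rewrite -[LHS]odd_double_half M_odd.
rewrite mulSn -doubleMl.
have le1 : (s <= b -> s * M <= b * M)%N by move=> ?; rewrite leq_mul2r; apply/orP; right.
have le2 : (b < s -> M + b * M <= s * M)%N.
  by move=> ?; rewrite -mulSn leq_mul2r; apply/orP; right.
have le3 : (s < b -> M + s * M <= b * M)%N.
  by move=> ?; rewrite -mulSn leq_mul2r; apply/orP; right.
have le4 : (b <= s -> b * M <= s * M)%N by move=> ?; rewrite leq_mul2r; apply/orP; right.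
move: (s * M)%N (b * M)%N le1 le2 le3 le4 => P Q le1 le2 le3 le4.
rewrite {}ME in u0M le2 le3 *; clear q_odd M_odd q M.
case: (ltnP u0.*2 d.*2.+1) => u0d; [case: (leqP s b) | case: (ltnP s b)] => sb.
- by have := le1 sb; clear -u0d; lia.
- by apply/negbTE; rewrite -leqNgt; have := le2 sb; clear -u0d; lia.
- by have := le3 sb; clear -u0M; lia.
- by apply/negbTE; rewrite -leqNgt; have := le4 sb; clear -u0d; lia.
Qed.

(* The character of h(z) on the eigenline of zeta_m ^+ j, with w the conjugate
   of z. *)
Definition hodge_char (C : Type) m (z w : C) j := if ((j %% m).*2 < m)%N then z else w.

(** Put M = m / q and q = 2 b + 1. The product runs over all lifts of u modulo M, so z and w occur b
    + 1 and b times, or b and b + 1 times. Division by (z w) ^ b leaves one factor, chosen by the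
    position of u modulo M; since u q modulo m is q times u modulo M, it is chi at u q. *)
Lemma hodge_char_level (C : fieldType) p k (z w : C) a u :
  prime p -> odd p -> z != 0 -> w != 0 -> (a < k)%N -> ~~ (p %| u)%N ->
  let chi := hodge_char (p ^ k) z w in
  (\prod_(t < p ^ a) chi (u * (1 + t * p ^ (k - a)))%N) *
  ((chi u)^-1 * (chi (u * (p ^ k).-1)%N)^-1) ^+ (p ^ a)%N.-1./2 =
  chi (u * p ^ a)%N.
Proof.
move=> p_prime p_odd z0 w0 ak pu chi.
have mE : (p ^ k)%N = (p ^ a * p ^ (k - a))%N by rewrite -expnD subnKC // ltnW.
have m_odd : odd (p ^ k) by rewrite oddX p_odd orbT.
have mu : ~~ (p ^ k %| u)%N.
  by apply: contra pu; apply: dvdn_trans; rewrite dvdn_exp // (leq_ltn_trans _ ak).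
have -> : (chi u)^-1 * (chi (u * (p ^ k).-1)%N)^-1 = (z * w)^-1.
  rewrite /chi /hodge_char modn_opp_half // -invfM.
  by case: ifP => _; rewrite ?(mulrC w).
have q_gt0 : (0 < p ^ a)%N by rewrite expn_gt0 prime_gt0.
have q_odd : odd (p ^ a) by rewrite oddX p_odd orbT.
have uq : coprime u (p ^ a) by rewrite coprimeXr // coprime_sym prime_coprime.
have M_gt0 : (0 < p ^ (k - a))%N by rewrite expn_gt0 prime_gt0.
have M_odd : odd (p ^ (k - a)) by rewrite oddX p_odd orbT.
rewrite /chi /hodge_char mE.
move: (p ^ a)%N (p ^ (k - a))%N q_gt0 q_odd uq M_gt0 M_odd => q M q_gt0 q_odd uq M_gt0 M_odd.
set u0 := (u %% M)%N; have u0M : (u0 < M)%N by rewrite ltn_mod.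
have shift t : ((u * (1 + t * M)) %% (q * M) = u0 + (u %/ M + u * t) %% q * M)%N.
  have -> : (u * (1 + t * M) = (u %/ M + u * t) * M + u0)%N.
    by rewrite mulnDr muln1 {1}(divn_eq u M) mulnDl addnAC mulnA.
  rewrite [X in (X * M + _)%N](divn_eq _ q) mulnDl -addnA -mulnA modnMDl.
  rewrite modn_small 1?addnC //.
  have : ((u %/ M + u * t) %% q < q)%N by rewrite ltn_mod.
  move: (_ %% q)%N => s sq; apply: leq_trans (leq_mul sq (leqnn M)).
  by rewrite mulSn ltn_add2r.
(* The residue of u (1 + t M) modulo q M is u0 + sg(t) M, and [sg] permutes Z / q because u is prime
   to q. *)
pose sg (t : 'I_q) : 'I_q := Ordinal (ltn_pmod (u %/ M + u * t) q_gt0).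
have sg_inj : injective sg.
  move=> t t' /(congr1 val)/eqP; rewrite /= eqn_modDl => utt'.
  apply/val_inj => /=; wlog tt' : t t' utt' / (t' <= t)%N.
    by case: (leqP t' t) => [|/ltnW] le H; [|apply/esym]; apply: H; rewrite // eq_sym.
  move: utt'; rewrite eqn_mod_dvd ?leq_mul2l ?tt' ?orbT // -mulnBr Gauss_dvdr 1?coprime_sym //.
  move=> /dvdn_leq; rewrite subn_gt0 => qt.
  apply/eqP; rewrite eqn_leq tt' andbT leqNgt; apply/negP => /qt.
  by rewrite leqNgt => /negP; apply; apply: leq_ltn_trans (leq_subr _ _) (ltn_ord t).
have -> : \prod_(t < q) (if ((u * (1 + t * M) %% (q * M)).*2 < q * M)%N then z else w) =
          \prod_(s < q) (if ((u0 + s * M).*2 < q * M)%N then z else w).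
  rewrite [RHS](reindex_inj sg_inj) /=; apply: eq_bigr => t _.
  by rewrite shift.
have -> : ((u * q) %% (q * M) = u0 * q)%N by rewrite [(q * M)%N]mulnC -muln_modl.
have -> : ((u0 * q).*2 < q * M)%N = (u0.*2 < M)%N.
  by rewrite doubleMl mulnC ltn_pmul2l.
under eq_bigr do rewrite double_shift_half //.
have [b qE] : exists b, q = b.*2.+1 by exists q./2; rewrite -[LHS]odd_double_half q_odd.
rewrite qE /= doubleK exprVn exprMn invfM.
case: ifP => _.
- rewrite -(big_mkord xpredT (fun s => if (s <= b)%N then z else w)).
  rewrite (big_cat_nat _ (n := b.+1)) //=; last by rewrite ltnS -addnn leq_addr.
  rewrite (eq_big_nat _ _ (F2 := fun=> z)) => [|s /andP[_]]; last by rewrite ltnS => ->.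
  rewrite [X in _ * X * _](eq_big_nat _ _ (F2 := fun=> w)) => [|s /andP[bs _]]; last first.
    by rewrite leqNgt bs.
  rewrite !prodr_const_nat subn0 subSS -addnn addnK exprS.
  by rewrite mulrACA [z * _ * _]mulfK ?expf_neq0 // divff ?mulr1 // expf_neq0.
- rewrite -(big_mkord xpredT (fun s => if (s < b)%N then z else w)).
  rewrite (big_cat_nat _ (n := b)) //=; last by rewrite -addnn -addnS leq_addr.
  rewrite (eq_big_nat _ _ (F2 := fun=> z)) => [|s /andP[_ ->]] //.
  rewrite [X in _ * X * _](eq_big_nat _ _ (F2 := fun=> w)) => [|s /andP[bs _]]; last first.
    by rewrite ltnNge bs.
  rewrite !prodr_const_nat subn0 -addnn -addnS addKn exprSr.
  rewrite mulrACA divff ?mul1r ?expf_neq0 // mulrAC.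
  by rewrite divff ?mul1r // expf_neq0.
Qed.

(** * Regular functions on GL_n over Q *)

Definition rat_point_fun n :=
  forall A : comUnitRingType, {rmorphism rat -> A} -> 'M[A]_n -> A.

Definition eval_entries n (A : comUnitRingType) (f : {rmorphism rat -> A})
    (g : 'M[A]_n) (P : mpoly.mpoly (n * n) rat) : A :=
  mpoly.mmap f (fun i => mxvec g 0 i) P.

(** Membership in Q[x_ij, 1 / det]: the same numerator and the same exponent must serve for all
    Q-algebras at once. *)
Definition regular n (phi : rat_point_fun n) :=
  exists P D, forall A f g, g \in unitmx ->
    phi A f g * \det g ^+ D = eval_entries f g P.

Definition regular_mx n q s
    (Phi : forall A : comUnitRingType, {rmorphism rat -> A} -> 'M[A]_n -> 'M[A]_(q, s)) :=
  forall i j, regular (fun A f g => Phi A f g i j).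

Section Regular.
Variable n : nat.
Implicit Types phi psi : rat_point_fun n.

Definition det_poly : mpoly.mpoly (n * n) rat :=
  \det (\matrix_(i < n, j < n) mpoly.mpolyX rat (mpoly.mnm1 (mxvec_index i j))).

Definition eval_hom (A : comUnitRingType) (f : {rmorphism rat -> A}) (g : 'M[A]_n) :
    {rmorphism mpoly.mpoly (n * n) rat -> A} :=
  mpoly.mmap f (fun i => mxvec g 0 i).

Lemma eval_homE (A : comUnitRingType) (f : {rmorphism rat -> A}) (g : 'M[A]_n) P :
  eval_entries f g P = eval_hom f g P.
Proof. by []. Qed.

Lemma eval_entry (A : comUnitRingType) (f : {rmorphism rat -> A}) (g : 'M[A]_n) i j :
  eval_entries f g (mpoly.mpolyX rat (mpoly.mnm1 (mxvec_index i j))) = g i j.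
Proof. by rewrite /eval_entries mpoly.mmapX mpoly.mmap1U mxvecE. Qed.

Lemma eval_det (A : comUnitRingType) (f : {rmorphism rat -> A}) (g : 'M[A]_n) :
  eval_entries f g det_poly = \det g.
Proof.
rewrite eval_homE -det_map_mx; congr (\det _).
by apply/matrixP => i j; rewrite !mxE -eval_homE eval_entry.
Qed.

Lemma eq_regular phi psi :
  (forall A f g, g \in unitmx -> phi A f g = psi A f g) ->
  regular phi -> regular psi.
Proof.
by move=> e [P [D H]]; exists P, D => A f g ug; rewrite -e // H.
Qed.

Lemma regular_poly P : regular (fun A f (g : 'M[A]_n) => eval_entries f g P).
Proof. by exists P, 0%N => A f g _; rewrite expr0 mulr1. Qed.

Lemma regular_const c : regular (fun A f (g : 'M[A]_n) => f c).
Proof.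
by exists (mpoly.mpolyC _ c), 0%N => A f g _; rewrite expr0 mulr1 /eval_entries mpoly.mmapC.
Qed.

Lemma regular_entry i j : regular (fun A f (g : 'M[A]_n) => g i j).
Proof.
apply: eq_regular (regular_poly (mpoly.mpolyX rat (mpoly.mnm1 (mxvec_index i j)))).
by move=> A f g _; exact: eval_entry.
Qed.

Lemma regularD phi psi : regular phi -> regular psi ->
  regular (fun A f g => phi A f g + psi A f g).
Proof.
move=> [P [D HP]] [Q [D' HQ]].
exists (P * det_poly ^+ D' + Q * det_poly ^+ D), (D + D')%N => A f g ug.
rewrite eval_homE rmorphD !rmorphM !rmorphXn /= -!eval_homE eval_det -HP // -HQ //.
by rewrite mulrDl exprD; congr (_ + _); rewrite -!mulrA // [_ ^+ D * _]mulrC.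
Qed.

Lemma regularM phi psi : regular phi -> regular psi ->
  regular (fun A f g => phi A f g * psi A f g).
Proof.
move=> [P [D HP]] [Q [D' HQ]].
exists (P * Q), (D + D')%N => A f g ug.
by rewrite eval_homE rmorphM /= -!eval_homE -HP // -HQ // exprD mulrACA.
Qed.

Lemma regularN phi : regular phi -> regular (fun A f g => - phi A f g).
Proof.
move=> phiR; apply: eq_regular (regularM (regular_const (-1)) phiR) => A f g _.
by rewrite rmorphN1 mulN1r.
Qed.

Lemma regular_sum I (s : seq I) (phi : I -> rat_point_fun n) :
  (forall i, regular (phi i)) -> regular (fun A f g => \sum_(i <- s) phi i A f g).
Proof.
move=> phiR; elim: s => [|i s IH].
  apply: eq_regular (regular_const 0) => A f g _.
  by rewrite big_nil rmorph0.
by apply: eq_regular (regularD (phiR i) IH) => A f g _; rewrite big_cons.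
Qed.

Lemma regular_prod I (s : seq I) (phi : I -> rat_point_fun n) :
  (forall i, regular (phi i)) -> regular (fun A f g => \prod_(i <- s) phi i A f g).
Proof.
move=> phiR; elim: s => [|i s IH].
  apply: eq_regular (regular_const 1) => A f g _.
  by rewrite big_nil rmorph1.
by apply: eq_regular (regularM (phiR i) IH) => A f g _; rewrite big_cons.
Qed.

Lemma regular_exp phi d : regular phi -> regular (fun A f g => phi A f g ^+ d).
Proof.
move=> phiR; apply: eq_regular (regular_prod (index_enum 'I_d) (fun=> phiR)) => A f g _.
by rewrite prodr_const card_ord.
Qed.

Lemma regular_mx_entries (q s : nat)
    (Phi : forall A : comUnitRingType, {rmorphism rat -> A} -> 'M[A]_n -> 'M[A]_(q, s)) :
  regular_mx Phi -> forall l, regular (fun A f g => mxvec (Phi A f g) 0 l).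
Proof.
move=> PhiR l; case/mxvec_indexP: l => i j.
by apply: eq_regular (PhiR i j) => A f g _; rewrite mxvecE.
Qed.

Lemma regular_eval q
    (Phi : forall A : comUnitRingType, {rmorphism rat -> A} -> 'M[A]_n -> 'M[A]_q) P :
  regular_mx Phi -> regular (fun A f g => eval_entries f (Phi A f g) P).
Proof.
move=> PhiR; apply: regular_sum => a; apply: regularM; first exact: regular_const.
by apply: regular_prod => l; apply: regular_exp; exact: regular_mx_entries.
Qed.

Lemma regular_mx_id : regular_mx (fun A f (g : 'M[A]_n) => g).
Proof. by move=> i j; exact: regular_entry. Qed.

(** Cramer's rule: the adjugate is polynomial and the determinant is the only denominator. *)
Lemma regular_mx_inv : regular_mx (fun A f (g : 'M[A]_n) => invmx g).
Proof.
move=> i j; exists (\adj (\matrix_(i < n, j < n)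
  mpoly.mpolyX rat (mpoly.mnm1 (mxvec_index i j))) i j), 1%N => A f g ug.
have ud : \det g \is a GRing.unit by rewrite -unitmxE.
rewrite /invmx ug mxE expr1 mulrAC mulVr // mul1r eval_homE.
transitivity (\adj (map_mx (eval_hom f g) (\matrix_(i < n, j < n)
    mpoly.mpolyX rat (mpoly.mnm1 (mxvec_index i j)))) i j); last first.
  by rewrite -map_mx_adj mxE.
congr (\adj _ i j); apply/matrixP => i' j'.
by rewrite !mxE -eval_homE eval_entry.
Qed.

Section Matrices.
Variables q s t : nat.
Local Notation mxfun q s :=
  (forall A : comUnitRingType, {rmorphism rat -> A} -> 'M[A]_n -> 'M[A]_(q, s)).
Implicit Types (Phi : mxfun q s) (Psi : mxfun s t).

Lemma eq_regular_mx Phi (Phi' : mxfun q s) :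
  (forall A f g, g \in unitmx -> Phi A f g = Phi' A f g) ->
  regular_mx Phi -> regular_mx Phi'.
Proof.
by move=> e PhiR i j; apply: eq_regular (PhiR i j) => A f g ug; rewrite e.
Qed.

Lemma regular_mx_const (M : 'M[rat]_(q, s)) : regular_mx (fun A f (g : 'M[A]_n) => map_mx f M).
Proof.
by move=> i j; apply: eq_regular (regular_const (M i j)) => A f g _; rewrite mxE.
Qed.

Lemma regular_mxM Phi Psi : regular_mx Phi -> regular_mx Psi ->
  regular_mx (fun A f g => Phi A f g *m Psi A f g).
Proof.
move=> PhiR PsiR i j.
apply: eq_regular (regular_sum (index_enum 'I_s)
  (fun l => regularM (PhiR i l) (PsiR l j))) => A f g _.
by rewrite mxE.
Qed.

Lemma regular_mxZ phi Phi : regular phi -> regular_mx Phi ->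
  regular_mx (fun A f g => phi A f g *: Phi A f g).
Proof.
move=> phiR PhiR i j.
by apply: eq_regular (regularM phiR (PhiR i j)) => A f g _; rewrite !mxE.
Qed.

Lemma regular_mx_sum I (r : seq I) (Phi : I -> mxfun q s) :
  (forall i, regular_mx (Phi i)) ->
  regular_mx (fun A f g => \sum_(i <- r) Phi i A f g).
Proof.
move=> PhiR i j.
apply: eq_regular (regular_sum r (fun l => PhiR l i j)) => A f g _.
by rewrite summxE.
Qed.

End Matrices.

Lemma regular_mx_prod q I (r : seq I)
    (Phi : I -> forall A : comUnitRingType, {rmorphism rat -> A} -> 'M[A]_n -> 'M[A]_q) :
  (forall i, regular_mx (Phi i)) ->
  regular_mx (fun A f g => \prod_(i <- r) Phi i A f g).
Proof.
move=> PhiR; elim: r => [|i r IH].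
  apply: eq_regular_mx (regular_mx_const 1%:M) => A f g _.
  by rewrite big_nil map_mx1.
by apply: eq_regular_mx (regular_mxM (PhiR i) IH) => A f g _; rewrite big_cons.
Qed.

Lemma regular_mx_exp q d
    (Phi : forall A : comUnitRingType, {rmorphism rat -> A} -> 'M[A]_n -> 'M[A]_q) :
  regular_mx Phi -> regular_mx (fun A f g => Phi A f g ^+ d).
Proof.
move=> PhiR.
apply: eq_regular_mx (regular_mx_prod (index_enum 'I_d) (fun=> PhiR)) => A f g _.
by rewrite prodr_const card_ord.
Qed.

End Regular.

Lemma invmxM (A : comUnitRingType) n (g h : 'M[A]_n) :
  g \in unitmx -> h \in unitmx -> invmx (g *m h) = invmx h *m invmx g.
Proof.
move=> ug uh; have ugh : g *m h \in unitmx by rewrite unitmx_mul ug.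
rewrite -[RHS](mulKmx ugh) -!mulmxA (mulmxA h) mulmxV // mul1mx.
by rewrite mulmxV // mulmx1.
Qed.

(** * Closed conditions on points of GL_n *)

Definition rat_point_pred n :=
  forall A : comUnitRingType, {rmorphism rat -> A} -> 'M[A]_n -> Prop.

Definition closed_pred n (Z : rat_point_pred n) :=
  exists S : equations n, forall A f g, points S f g <-> g \in unitmx /\ Z A f g.

Section Closed.
Variable n : nat.
Implicit Types Z : rat_point_pred n.

Lemma closed_pred_and Z Z' : closed_pred Z -> closed_pred Z' ->
  closed_pred (fun A f g => Z A f g /\ Z' A f g).
Proof.
move=> [S HS] [S' HS']; exists (S `|` S') => A f g; split.
- move=> [ug gSS'].
  have /HS[_ Zg] : points S f g by split=> // P SP; apply: gSS'; left.
  have /HS'[_ Zg'] : points S' f g by split=> // P SP; apply: gSS'; right.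
  by [].
- move=> [ug [Zg Zg']]; split=> // P [SP|SP].
    by have /HS[_] := conj ug Zg; apply.
  by have /HS'[_] := conj ug Zg'; apply.
Qed.

Lemma closed_pred_forall I (D : set I) (Z : I -> rat_point_pred n) :
  (forall i, D i -> closed_pred (Z i)) ->
  closed_pred (fun A f g => forall i, D i -> Z i A f g).
Proof.
move=> Zc; have /boolp.choice[S HS] : forall i, exists S : equations n,
    D i -> forall A f g, points S f g <-> g \in unitmx /\ Z i A f g.
  move=> i; have [Di|nDi] := pselect (D i); last by exists set0.
  by have [S HS] := Zc i Di; exists S.
exists [set P | exists2 i, D i & S i P] => A f g; split.
- move=> [ug gS]; split=> // i Di.
  have /HS[//|_ Zg//] : points (S i) f g by split=> // P SP; apply: gS; exists i.
- move=> [ug Zg]; split=> // P [i Di SP].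
  by have /HS[//|_] := conj ug (Zg i Di); apply.
Qed.

(** The determinant is a unit at every point, so [phi] vanishes exactly where its numerator does. *)
Lemma closed_pred_eq0 (phi : rat_point_fun n) :
  regular phi -> closed_pred (fun A f g => phi A f g = 0).
Proof.
move=> [P [D HP]]; exists [set P] => A f g; split.
- move=> [ug gP]; split=> //; have := HP A f g ug.
  rewrite [RHS](gP P) // => /(congr1 (fun x => x * \det g ^- D)).
  by rewrite mul0r mulrK // unitrX // -unitmxE.
- move=> [ug g0]; split=> // Q ->.
  by rewrite -[LHS](HP A f g ug) g0 mul0r.
Qed.

Lemma closed_pred_mx_eq q s
    (Phi Psi : forall A : comUnitRingType, {rmorphism rat -> A} -> 'M[A]_n -> 'M[A]_(q, s)) :
  regular_mx Phi -> regular_mx Psi -> closed_pred (fun A f g => Phi A f g = Psi A f g).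
Proof.
move=> PhiR PsiR.
have [S HS] : closed_pred (fun A f g => forall ij : 'I_q * 'I_s, setT ij ->
    Phi A f g ij.1 ij.2 - Psi A f g ij.1 ij.2 = 0).
  apply: closed_pred_forall => ij _; apply: closed_pred_eq0.
  exact: regularD (PhiR _ _) (regularN (PsiR _ _)).
exists S => A f g; rewrite HS; split=> -[ug H]; split=> //.
- apply/matrixP => i j; apply/eqP; rewrite -subr_eq0; apply/eqP.
  exact: (H (i, j)).
- by move=> ij _; rewrite H subrr.
Qed.

Lemma closed_pred_comp q (S : equations q)
    (Phi : forall A : comUnitRingType, {rmorphism rat -> A} -> 'M[A]_n -> 'M[A]_q) :
  regular_mx Phi ->
  closed_pred (fun A f g => forall P, S P -> eval_entries f (Phi A f g) P = 0).
Proof.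
move=> PhiR; apply: closed_pred_forall => P _; apply: closed_pred_eq0.
exact: regular_eval.
Qed.

End Closed.

(** * From a regular section to an isomorphism of Mumford-Tate groups *)

Section RestrictionIso.
Variables (R : realType) (X X' : torus R).
Variables (n r : nat) (e : 'I_n -> (ambient X -> R[i])).
Variable (e' : 'I_r -> (ambient X' -> R[i])).
Variables (B : 'M[rat]_(n, r)) (B' : 'M[rat]_(r, n)).
Hypothesis BK : B' *m B = 1%:M.
(** In [dom] and [sec] the second matrix stands for the inverse of the first, so that inversion
    becomes the exchange of the two arguments. *)
Variable dom : forall A : comUnitRingType, {rmorphism rat -> A} -> 'M[A]_r -> 'M[A]_r -> Prop.
Variable sec : forall A : comUnitRingType, {rmorphism rat -> A} -> 'M[A]_r -> 'M[A]_r -> 'M[A]_n.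
Arguments dom {A}.
Arguments sec {A}.
Hypothesis dom_closed : forall q
    (Phi Psi : forall A : comUnitRingType, {rmorphism rat -> A} -> 'M[A]_q -> 'M[A]_r),
  regular_mx Phi -> regular_mx Psi ->
  closed_pred (fun A f g => dom f (Phi A f g) (Psi A f g)).
Hypothesis sec_regular : forall q
    (Phi Psi : forall A : comUnitRingType, {rmorphism rat -> A} -> 'M[A]_q -> 'M[A]_r),
  regular_mx Phi -> regular_mx Psi ->
  regular_mx (fun A f g => sec f (Phi A f g) (Psi A f g)).
Hypothesis dom_sym : forall (A : comUnitRingType) (f : {rmorphism rat -> A}) g h,
  dom f g h -> dom f h g.
Hypothesis dom1 : forall (A : comUnitRingType) (f : {rmorphism rat -> A}),
  dom f 1%:M 1%:M /\ sec f 1%:M 1%:M = 1%:M.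
Hypothesis domM : forall (A : comUnitRingType) (f : {rmorphism rat -> A}) g g' h h',
  dom f g h -> dom f g' h' ->
  dom f (g *m g') (h' *m h) /\ sec f (g *m g') (h' *m h) = sec f g h *m sec f g' h'.
Hypothesis sec_restrict : forall (A : comUnitRingType) (f : {rmorphism rat -> A}) g h,
  dom f g h -> sec f g h *m map_mx f B = map_mx f B *m g.
Let ratr_R : {rmorphism rat -> R} := ratr.
Hypothesis hodge_unit : forall z (N : 'M[R]_n), z != 0 -> hodge_action e z N -> N \in unitmx.
Hypothesis hodge_dom : forall z (N : 'M[R]_n), z != 0 -> hodge_action e z N ->
  exists N' : 'M[R]_r,
    [/\ N' \in unitmx, hodge_action e' z N', dom ratr_R N' (invmx N')
      & sec ratr_R N' (invmx N') = N].
Hypothesis hodge_sec : forall z (N' : 'M[R]_r), z != 0 -> hodge_action e' z N' ->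
  [/\ N' \in unitmx, dom ratr_R N' (invmx N')
    & hodge_action e z (sec ratr_R N' (invmx N'))].

Let res (A : comUnitRingType) (f : {rmorphism rat -> A}) (g : 'M[A]_n) : 'M[A]_r :=
  map_mx f B' *m g *m map_mx f B.

Let resE (A : comUnitRingType) (f : {rmorphism rat -> A}) (g : 'M[A]_n) g' :
  g *m map_mx f B = map_mx f B *m g' -> res f g = g'.
Proof.
by move=> gB; rewrite /res -mulmxA gB mulmxA -map_mxM BK map_mx1 mul1mx.
Qed.

Let secK (A : comUnitRingType) (f : {rmorphism rat -> A}) g h :
  dom f g h -> g *m h = 1%:M -> h *m g = 1%:M -> sec f g h *m sec f h g = 1%:M.
Proof.
move=> gD gh hg; have [_ <-] := domM gD (dom_sym gD).
by rewrite gh; case: (dom1 f).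
Qed.

Let sec_unit (A : comUnitRingType) (f : {rmorphism rat -> A}) g :
  g \in unitmx -> dom f g (invmx g) ->
  sec f g (invmx g) \in unitmx /\ invmx (sec f g (invmx g)) = sec f (invmx g) g.
Proof.
move=> ug gD; have sK := secK gD (mulmxV ug) (mulVmx ug).
have [us _] := mulmx1_unit sK; split=> //.
by rewrite -[RHS](mulKmx us) sK mulmx1.
Qed.

(** The image of the section. Restriction is defined and injective on it, with inverse [sec]; it is
    shown to contain the first Mumford-Tate group. *)
Let graph (A : comUnitRingType) (f : {rmorphism rat -> A}) (g : 'M[A]_n) :=
  exists g', [/\ g' \in unitmx, dom f g' (invmx g') & sec f g' (invmx g') = g].

Let graph_restrict (A : comUnitRingType) (f : {rmorphism rat -> A}) (g : 'M[A]_n) :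
  graph f g ->
  [/\ g *m map_mx f B = map_mx f B *m res f g, res f g \in unitmx,
      dom f (res f g) (invmx (res f g)), sec f (res f g) (invmx (res f g)) = g
    & res f (invmx g) = invmx (res f g)].
Proof.
move=> [g' [ug' g'D sg']].
have gB : g *m map_mx f B = map_mx f B *m g' by rewrite -sg' sec_restrict.
rewrite (resE gB); split=> //; apply: resE; rewrite -sg'.
by have [_ ->] := sec_unit ug' g'D; rewrite sec_restrict //; apply: dom_sym.
Qed.

Let graph_group : exists S : equations n,
  is_subgroup S /\ forall (A : comUnitRingType) (f : {rmorphism rat -> A}) (g : 'M[A]_n),
    points S f g <-> g \in unitmx /\ graph f g.
Proof.
have resR : regular_mx (fun A f (g : 'M[A]_n) => res f g).
  by apply: regular_mxM (regular_mx_const _ _); apply: regular_mxM (regular_mx_const _ _) (@regular_mx_id _).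
have res_invR : regular_mx (fun A f (g : 'M[A]_n) => res f (invmx g)).
  by apply: regular_mxM (regular_mx_const _ _); apply: regular_mxM (regular_mx_const _ _) (@regular_mx_inv _).
(* The witness in [graph] can only be [res f g], which removes the quantifier. Its inverse is
   replaced by [res f (invmx g)], regular in [g] although [res f g] is not known to be invertible;
   the last equation then forces it to be the inverse. *)
have [S HS] : closed_pred (fun A f (g : 'M[A]_n) =>
    dom f (res f g) (res f (invmx g)) /\
    sec f (res f g) (res f (invmx g)) = g /\
    res f g *m res f (invmx g) = 1%:M).
  apply: closed_pred_and; first exact: dom_closed.
  apply: closed_pred_and.
    by apply: closed_pred_mx_eq (@regular_mx_id _); apply: sec_regular.
  apply: closed_pred_mx_eq; first exact: regular_mxM.
  by apply: eq_regular_mx (regular_mx_const _ 1%:M) => A f g _; rewrite map_mx1.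
have {}HS (A : comUnitRingType) (f : {rmorphism rat -> A}) (g : 'M[A]_n) :
    points S f g <-> g \in unitmx /\ graph f g.
  rewrite HS; split=> -[ug H]; split=> //.
    have [gD [sg gg']] := H; have [ug' _] := mulmx1_unit gg'.
    have eg' : res f (invmx g) = invmx (res f g).
      by rewrite -[RHS]mulmx1 -gg' mulKmx.
    by exists (res f g); rewrite -eg'; split.
  have [gB ug' gD sg eg'] := graph_restrict H.
  by rewrite eg' sg mulmxV.
exists S; split=> // A f; split.
- apply/HS; split; first exact: unitmx1.
  by exists 1%:M; rewrite invmx1; have [D1 s1] := dom1 f; split=> //; exact: unitmx1.
- move=> g h /HS[ug [g' [ug' gD <-]]] /HS[uh [h' [uh' hD <-]]]; apply/HS.
  have [ugs _] := sec_unit ug' gD; have [uhs _] := sec_unit uh' hD.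
  split; first by rewrite unitmx_mul ugs.
  have [D s] := domM gD hD; exists (g' *m h'); rewrite unitmx_mul ug' uh'.
  by rewrite invmxM.
- move=> g /HS[ug [g' [ug' gD sg]]]; apply/HS; split; first by rewrite unitmx_inv.
  exists (invmx g'); rewrite unitmx_inv invmxK; split=> //; first exact: dom_sym.
  by rewrite -sg; have [_ ->] := sec_unit ug' gD.
Qed.

Let MT_graph (A : comUnitRingType) (f : {rmorphism rat -> A}) (g : 'M[A]_n) :
  points (mumford_tate e) f g -> graph f g.
Proof.
have [S [Sgrp HS]] := graph_group.
move/(mumford_tate_min Sgrp) => H; have /HS[] // : points S f g.
apply: H => z N z0 zN; apply/HS; split; first exact: hodge_unit zN.
by have [N' [uN' _ ND sN]] := hodge_dom z0 zN; exists N'.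
Qed.

(** For an arbitrary [g] the map [res] is not multiplicative. The condition that [res f g] lies in
    the second Mumford-Tate group is therefore imposed together with [graph], where it cuts out a
    closed subgroup; minimality applies to that subgroup. *)
Let MT_restrict (A : comUnitRingType) (f : {rmorphism rat -> A}) (g : 'M[A]_n) :
  points (mumford_tate e) f g -> points (mumford_tate e') f (res f g).
Proof.
have [S [Sgrp HS]] := graph_group.
have resR : regular_mx (fun A f (g : 'M[A]_n) => res f g).
  by apply: regular_mxM (regular_mx_const _ _); apply: regular_mxM (regular_mx_const _ _) (@regular_mx_id _).
have [S1 HS1] := closed_pred_comp (mumford_tate e') resR.
have HS2 (A' : comUnitRingType) (f' : {rmorphism rat -> A'}) (h : 'M[A']_n) :
    points (S `|` S1) f' h <->
    [/\ h \in unitmx, graph f' h & points (mumford_tate e') f' (res f' h)].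
  split.
    move=> [uh hS].
    have /HS[_ hG] : points S f' h by split=> // P SP; apply: hS; left.
    have /HS1[_ hM] : points S1 f' h by split=> // P SP; apply: hS; right.
    by split=> //; split=> //; have [] := graph_restrict hG.
  move=> [uh hG [_ hM]]; split=> // P [SP|SP].
    by have /HS[_] := conj uh hG; apply.
  by have /HS1[_] := conj uh hM; apply.
have S2grp : is_subgroup (S `|` S1).
  move=> A' f'; have [m1 mM mV] := mumford_tate_subgroup e' f'.
  have [s1 sM sV] := Sgrp A' f'; split.
  - have /HS[u1 G1] := s1; apply/HS2; split=> //.
    by rewrite /res mulmx1 -map_mxM BK map_mx1.
  - move=> g1 g2 /HS2[u1 G1 M1] /HS2[u2 G2 M2]; apply/HS2.
    have /HS[u12 G12] : points S f' (g1 *m g2) by apply: sM; apply/HS.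
    split=> //; have [gB1 _ _ _ _] := graph_restrict G1.
    have [gB2 _ _ _ _] := graph_restrict G2.
    rewrite (@resE _ _ _ (res f' g1 *m res f' g2)); first exact: mM.
    by rewrite -mulmxA gB2 mulmxA gB1 mulmxA.
  - move=> g1 /HS2[u1 G1 M1]; apply/HS2.
    have /HS[u1' G1'] : points S f' (invmx g1) by apply: sV; apply/HS.
    by split=> //; have [_ _ _ _ ->] := graph_restrict G1; exact: mV.
move/(mumford_tate_min S2grp) => H; have /HS2[] // : points (S `|` S1) f g.
apply: H => z N z0 zN; apply/HS2.
have [N' [uN' zN' ND sN]] := hodge_dom z0 zN.
split; [exact: hodge_unit zN | by exists N' |].
rewrite (@resE _ _ _ N'); last by rewrite -sN sec_restrict.
apply: points_mumford_tate => // S' _ hS'; exact: hS' zN'.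
Qed.

(** The points of the domain whose section lies in the first Mumford-Tate group form a closed
    subgroup containing the image of h, so minimality of the second group applies. *)
Let MT_section (A : comUnitRingType) (f : {rmorphism rat -> A}) (g' : 'M[A]_r) :
  points (mumford_tate e') f g' ->
  dom f g' (invmx g') /\ points (mumford_tate e) f (sec f g' (invmx g')).
Proof.
have [S1 HS1] := dom_closed (@regular_mx_id r) (@regular_mx_inv r).
have [S2 HS2] := closed_pred_comp (mumford_tate e)
  (sec_regular (@regular_mx_id r) (@regular_mx_inv r)).
have HS (A' : comUnitRingType) (f' : {rmorphism rat -> A'}) (h : 'M[A']_r) :
    points (S1 `|` S2) f' h <->
    [/\ h \in unitmx, dom f' h (invmx h)
      & points (mumford_tate e) f' (sec f' h (invmx h))].
  split.
    move=> [uh hS].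
    have /HS1[_ hD] : points S1 f' h by split=> // P SP; apply: hS; left.
    have /HS2[_ hM] : points S2 f' h by split=> // P SP; apply: hS; right.
    by split=> //; split=> //; have [] := sec_unit uh hD.
  move=> [uh hD [_ hM]]; split=> // P [SP|SP].
    by have /HS1[_] := conj uh hD; apply.
  by have /HS2[_] := conj uh hM; apply.
have Sgrp : is_subgroup (S1 `|` S2).
  move=> A' f'; have [m1 mM mV] := mumford_tate_subgroup e f'; split.
  - by apply/HS; rewrite invmx1; have [D1 s1] := dom1 f'; rewrite s1 unitmx1.
  - move=> g1 g2 /HS[u1 D1 M1] /HS[u2 D2 M2]; apply/HS.
    have [D s] := domM D1 D2.
    by rewrite unitmx_mul u1 u2 invmxM // s; split=> //; exact: mM.
  - move=> g1 /HS[u1 D1 M1]; apply/HS; rewrite unitmx_inv invmxK; split=> //.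
      exact: dom_sym.
    by have [_ <-] := sec_unit u1 D1; exact: mV.
move/(mumford_tate_min Sgrp) => H.
have /HS[] // : points (S1 `|` S2) f g'.
apply: H => z N z0 zN; apply/HS; have [uN ND sN] := hodge_sec z0 zN; split=> //.
apply: points_mumford_tate => [|S' _ hS']; first by have [] := sec_unit uN ND.
exact: hS' sN.
Qed.

Lemma restriction_iso_of_section :
  restriction_iso B (mumford_tate e) (mumford_tate e').
Proof.
move=> A f; split=> [g gM|g' g'M].
- have [gB _ _ _ _] := graph_restrict (MT_graph gM).
  exists (res f g); split; first by split=> //; exact: MT_restrict.
  by move=> g' [_ gB']; exact: resE.
- have [gD sM] := MT_section g'M; have [ug' _] := g'M.
  exists (sec f g' (invmx g')); split; first by split=> //; exact: sec_restrict.
  move=> g [gM gB]; have [_ _ _ sg _] := graph_restrict (MT_graph gM).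
  by rewrite (resE gB) in sg.
Qed.

End RestrictionIso.

(** * Regularity of the section and closedness of its domain *)

Section RegularSection.
Variable q : nat.
Variables (n : nat) (T : 'M[rat]_n) (r : nat) (T' : 'M[rat]_r) (y' : 'rV[rat]_r).
Variables (p k : nat).
Local Notation mxfun s t :=
  (forall A : comUnitRingType, {rmorphism rat -> A} -> 'M[A]_q -> 'M[A]_(s, t)).

Lemma regular_power_comb d s (U : 'M[rat]_s) (c : mxfun 1%N d) :
  regular_mx c -> regular_mx (fun A f g => power_comb (map_mx f U) (c A f g)).
Proof.
move=> cR; apply: regular_mx_sum => i; apply: regular_mxZ; first exact: cR.
by apply: regular_mx_exp; exact: regular_mx_const.
Qed.

Lemma regular_twist e (Phi : mxfun r r) :
  regular_mx Phi -> regular_mx (fun A f g => twist T' y' f e (Phi A f g)).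
Proof.
move=> PhiR; apply: regular_power_comb.
apply: regular_mxM; last exact: regular_mx_const.
by apply: regular_mxM => //; exact: regular_mx_const.
Qed.

Lemma regular_level a (Phi Psi : mxfun r r) : regular_mx Phi -> regular_mx Psi ->
  regular_mx (fun A f g => level p k T' y' f a (Phi A f g) (Psi A f g)).
Proof.
move=> PhiR PsiR; apply: regular_mxM.
  by apply: regular_mx_prod => t; exact: regular_twist.
by apply: regular_mx_exp; apply: regular_mxM => //; exact: regular_twist.
Qed.

Lemma regular_levels (Phi : nat -> mxfun r r) :
  (forall a, regular_mx (Phi a)) ->
  regular_mx (fun A f g => levels k (fun a => Phi a A f g)).
Proof.
move=> PhiR i l; rewrite (ord1 i); move: l; apply: regular_mx_entries => a b.
apply: eq_regular (regular_mx_entries (PhiR a) b) => A f g _.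
by rewrite mxE.
Qed.

Lemma regular_section_coef (Phi Psi : mxfun r r) : regular_mx Phi -> regular_mx Psi ->
  regular_mx (fun A f g => section_coef p k n T' y' f (Phi A f g) (Psi A f g)).
Proof.
move=> PhiR PsiR; apply: regular_mxM; last exact: regular_mx_const.
by apply: regular_levels => a; exact: regular_level.
Qed.

Lemma regular_section_mx (Phi Psi : mxfun r r) : regular_mx Phi -> regular_mx Psi ->
  regular_mx (fun A f g => section_mx p k T T' y' f (Phi A f g) (Psi A f g)).
Proof. by move=> PhiR PsiR; apply: regular_power_comb; exact: regular_section_coef. Qed.

Lemma closed_section_dom (Phi Psi : mxfun r r) : regular_mx Phi -> regular_mx Psi ->
  closed_pred (fun A f g => section_dom p k n T' y' f (Phi A f g) (Psi A f g)).
Proof.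
move=> PhiR PsiR.
have comR (Phi0 : mxfun r r) : regular_mx Phi0 ->
    closed_pred (fun A f g => Phi0 A f g *m map_mx f T' = map_mx f T' *m Phi0 A f g).
  move=> Phi0R; have TR := @regular_mx_const q r r T'.
  by apply: closed_pred_mx_eq; exact: regular_mxM.
have ranR (Phi0 Psi0 : mxfun r r) : regular_mx Phi0 -> regular_mx Psi0 ->
    closed_pred (fun A f g => in_section_range p k n T' y' f (Phi0 A f g) (Psi0 A f g)).
  move=> Phi0R Psi0R; apply: closed_pred_mx_eq.
    by apply: regular_mxM; [exact: regular_section_coef | exact: regular_mx_const].
  by apply: regular_levels => a; exact: regular_level.
have [S HS] := closed_pred_and (comR _ PhiR) (closed_pred_and (comR _ PsiR)
  (closed_pred_and (ranR _ _ PhiR PsiR) (ranR _ _ PsiR PhiR))).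
exists S => A f g; rewrite HS; split=> -[ug H]; split=> //.
  by case: H => [H1 [H2 [H3 H4]]]; split.
by case: H => [H1 H2 H3 H4]; split.
Qed.

End RegularSection.

(** * The isomorphism for a pair of cyclic models *)

Section ModelIso.
Variable R : realType.
Local Notation C := R[i].
Local Notation rc := (real_complex R).
Let rC : {rmorphism rat -> C} := ratr.
Let rR : {rmorphism rat -> R} := ratr.
Variables (p k : nat).
Hypotheses (p_prime : prime p) (p_odd : odd p) (k_gt0 : (0 < k)%N).
Local Notation m := (p ^ k)%N.
Variables (zeta : C) (n r : nat).
Variables (T : 'M[rat]_n) (y : 'rV[rat]_n) (E : nat -> 'cV[C]_n).
Variables (T' : 'M[rat]_r) (y' : 'rV[rat]_r) (E' : nat -> 'cV[C]_r).
Hypothesis model : cyclic_model rC zeta (fun j => ~~ (m %| j)%N) T y E.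
Hypothesis model' : cyclic_model rC zeta (fun j => ~~ (p %| j)%N) T' y' E'.
Hypothesis interp : forall chi : nat -> C, (forall j, chi (j %% m)%N = chi j) ->
  exists c : 'rV[C]_n, forall j, ~~ (m %| j)%N ->
    \sum_(i < n) c 0 i * (zeta ^+ j) ^+ i = chi j.
Variables (X X' : torus R).
Variables (e : 'I_n -> (ambient X -> C)) (e' : 'I_r -> (ambient X' -> C)).
Hypothesis hodgeE : forall z (N : 'M[R]_n), hodge_action e z N <->
  forall j, ~~ (m %| j)%N -> map_mx rc N *m E j = hodge_char m z (z^*) j *: E j.
Hypothesis hodgeE' : forall z (N : 'M[R]_r), hodge_action e' z N <->
  forall j, ~~ (p %| j)%N -> map_mx rc N *m E' j = hodge_char m z (z^*) j *: E' j.
Variable B : 'M[rat]_(n, r).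
Hypothesis BE : forall j, ~~ (p %| j)%N -> map_mx rC B *m E' j = E j.

Let rC_rR x : rc (rR x) = rC x.
Proof. exact: (fmorph_eq_rat (rc \o rR)). Qed.

Let map_rat q s (M : 'M[rat]_(q, s)) : map_mx rc (map_mx rR M) = map_mx rC M.
Proof. by rewrite -map_mx_comp; apply/matrixP => i j; rewrite !mxE /= rC_rR. Qed.

Let ndvd_level0 j : ~~ (p %| j)%N -> ~~ (m %| j)%N.
Proof. by apply: contra; apply: dvdn_trans; exact: dvdn_exp. Qed.

Let TB : T *m B = B *m T'.
Proof.
have [TE _ _ _] := model; have [TE' _ _ _] := model'.
apply: (map_mx_inj (f := rC)); apply: (eigenvectors_eq model') => j pj.
rewrite !map_mxM -!mulmxA BE // TE' // -scalemxAr BE // TE //.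
exact: ndvd_level0.
Qed.

(** On eigenvectors one sees that [y *m B = y'], and [B] intertwines [T] and [T']. Hence the first
    [r] rows [y *m T ^+ i], multiplied by [B], form the invertible Krylov matrix of the second
    model. *)
Let B_left_inverse : exists B' : 'M[rat]_(r, n), B' *m B = 1%:M.
Proof.
have [_ yE _ _] := model; have [_ yE' uK _] := model'.
have yB : y *m B = y'.
  apply: (map_mx_inj (f := rC)); apply: (eigenvectors_eq model') => j pj.
  by rewrite map_mxM -mulmxA BE // yE' // yE // ndvd_level0.
have TXB i : T ^+ i *m B = B *m T' ^+ i.
  elim: i => [|i IH]; first by rewrite !expr0 mul1mx mulmx1.
  by rewrite !exprSr -!mulmxE -mulmxA TB mulmxA IH !mulmxA.
exists (invmx (krylov T' y') *m \matrix_(i < r) (y *m T ^+ i)).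
rewrite -mulmxA -[RHS](mulVmx uK); congr (_ *m _).
by apply/row_matrixP => i; rewrite row_mul !rowK -mulmxA TXB mulmxA yB.
Qed.

Let hodge_char_inv (z : C) j : (hodge_char m z (z^*) j)^-1 = hodge_char m z^-1 (z^-1)^* j.
Proof. by rewrite /hodge_char; case: ifP => _ //; rewrite fmorphV. Qed.

Let conj_neq0 (z : C) : z != 0 -> z^* != 0.
Proof. by rewrite conjC_eq0. Qed.

Let hodge_char_neq0 (z : C) j : z != 0 -> hodge_char m z (z^*) j != 0.
Proof. by rewrite /hodge_char; case: ifP => // _; exact: conj_neq0. Qed.

Let eigen_unit S s (U : 'M[rat]_s) v F (N : 'M[R]_s) (chi : nat -> C) :
  cyclic_model rC zeta S U v F -> (forall j, chi j != 0) ->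
  (forall j, S j -> map_mx rc N *m F j = chi j *: F j) -> N \in unitmx.
Proof.
move=> mod chi0 NF; rewrite -(map_unitmx rc) -row_free_unit.
apply: inj_row_free => x xN; apply: (eigenvectors_separate mod) => j Sj.
apply/eqP; have := scaler_eq0 (chi j) (x *m F j); rewrite (negPf (chi0 j)) /= => <-.
by rewrite scalemxAr -NF // mulmxA xN mul0mx.
Qed.

Let eigen_inv s (N : 'M[R]_s) (v : 'cV[C]_s) a : N \in unitmx -> a != 0 ->
  map_mx rc N *m v = a *: v -> map_mx rc (invmx N) *m v = a^-1 *: v.
Proof.
move=> uN a0 Nv; rewrite -[in LHS](scale1r v) -(mulVf a0) -scalerA -Nv -scalemxAr.
by rewrite mulmxA -map_mxM mulVmx // map_mx1 mul1mx.
Qed.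

Let comm_real (N : 'M[R]_r) : GRing.comm (map_mx rc N) (map_mx rC T') ->
  GRing.comm N (map_mx rR T').
Proof.
move=> NT; apply: (map_mx_inj (f := rc)).
by rewrite -!mulmxE !map_mxM map_rat; exact: NT.
Qed.

(** [section_dom] asks for the range condition at [N] and at its inverse. The second is the first
    one for [z^-1], whose characters are the inverses; hence the two applications of
    [eigen_section]. *)
Let hodge_section z (N : 'M[R]_r) : z != 0 -> hodge_action e' z N ->
  [/\ N \in unitmx, section_dom p k n T' y' rR N (invmx N)
    & hodge_action e z (section_mx p k T T' y' rR N (invmx N))].
Proof.
move=> z0 /hodgeE' NE; have zC0 := conj_neq0 z0.
have uN : N \in unitmx.
  by apply: (eigen_unit model' _ NE) => j; exact: hodge_char_neq0.
have NVE j : ~~ (p %| j)%N ->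
    map_mx rc (invmx N) *m E' j = (hodge_char m z (z^*) j)^-1 *: E' j.
  by move=> pj; apply: eigen_inv => //; [exact: hodge_char_neq0 | exact: NE].
have periodic w w' j : hodge_char (C := C) m w w' (j %% m)%N = hodge_char m w w' j.
  by rewrite /hodge_char modn_mod.
have [rng secE] := eigen_section p_prime k_gt0 model model' NE NVE
  (fun a u => hodge_char_level (u := u) p_prime p_odd z0 zC0) (interp (periodic _ _)).
have NE' j : ~~ (p %| j)%N ->
    map_mx rc N *m E' j = (hodge_char m z^-1 (z^-1)^* j)^-1 *: E' j.
  by move=> pj; rewrite -hodge_char_inv invrK NE.
have NVE' j : ~~ (p %| j)%N ->
    map_mx rc (invmx N) *m E' j = hodge_char m z^-1 (z^-1)^* j *: E' j.
  by move=> pj; rewrite -hodge_char_inv NVE.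
have zV0 : z^-1 != 0 by rewrite invr_eq0.
have [rng' _] := eigen_section p_prime k_gt0 model model' NVE' NE'
  (fun a u => hodge_char_level (u := u) p_prime p_odd zV0 (conj_neq0 zV0))
  (interp (periodic _ _)).
split=> //.
  split.
  - exact/comm_real/(eigen_comm model' NE).
  - exact/comm_real/(eigen_comm model' NVE).
  - exact: (map_in_section_range (f := rR) (f' := rC) (h := rc) rC_rR (fmorph_inj rc) rng).
  - exact: (map_in_section_range (f := rR) (f' := rC) (h := rc) rC_rR (fmorph_inj rc) rng').
apply/hodgeE => j mj; rewrite (map_section_mx (f := rR) (f' := rC) (h := rc) p k T T' y' rC_rR).
exact: secE.
Qed.

Lemma restriction_iso_of_models :
  restriction_iso B (mumford_tate e) (mumford_tate e').
Proof.
have [B' BK] := B_left_inverse.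
apply: (@restriction_iso_of_section R X X' n r e e' B B' BK
  (fun A f => section_dom p k n T' y' f) (fun A f => section_mx p k T T' y' f)).
- by move=> q Phi Psi; exact: closed_section_dom.
- by move=> q Phi Psi; exact: regular_section_mx.
- by move=> A f g h; exact: section_dom_sym.
- by move=> A f; exact: (section_dom1 p_prime k_gt0 model model').
- by move=> A f g g' h h'; exact: (section_domM p_prime k_gt0 model model').
- by move=> A f g h; exact: (section_mx_restrict k_gt0 model' TB).
- move=> z N z0 /hodgeE NE; apply: (eigen_unit model _ NE) => j.
  exact: hodge_char_neq0.
- move=> z N z0 zN; have /hodgeE NE := zN.
  (* By [BE], this compression has on [E' j] the eigenvalue of [N] on [E j], so it is h(z) for the
     quotient. *)
  pose N' := map_mx rR B' *m N *m map_mx rR B.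
  have zN' : hodge_action e' z N'.
    apply/hodgeE' => j pj.
    rewrite !map_mxM !map_rat -!mulmxA BE // NE; last exact: ndvd_level0.
    by rewrite -scalemxAr -(BE pj) mulmxA -map_mxM BK map_mx1 mul1mx.
  have [uN' ND /hodgeE sE] := hodge_section z0 zN'.
  exists N'; split=> //; apply: (map_mx_inj (f := rc)).
  by apply: (eigenvectors_eq model) => j mj; rewrite sE // NE.
- exact: hodge_section.
Qed.

End ModelIso.

(** * The cyclic model of a complex torus *)

Lemma row_poly_eval (C : fieldType) n (c : 'rV[C]_n) x :
  (rVpoly c).[x] = \sum_(i < n) c 0 i * x ^+ i.
Proof.
rewrite (horner_coef_wide _ (size_poly _ _)); apply: eq_bigr => i _.
by rewrite coef_rVpoly_ord.
Qed.

Lemma row_poly_eq0 (C : fieldType) n (c : 'rV[C]_n) (s : seq C) :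
  uniq s -> (n <= size s)%N ->
  (forall x, x \in s -> \sum_(i < n) c 0 i * x ^+ i = 0) -> c = 0.
Proof.
move=> s_uniq ns c0; have cp0 : rVpoly c = 0.
  apply: (roots_geq_poly_eq0 _ s_uniq).
    by apply/allP => x xs; rewrite /root row_poly_eval c0.
  exact: leq_trans (size_poly _ _) ns.
by rewrite -(rVpolyK c) cp0 linear0.
Qed.

Section TorusModel.
Variable R : realType.
Local Notation C := R[i].
Local Notation rc := (real_complex R).
Let rC : {rmorphism rat -> C} := ratr.
Variables (m : nat) (zeta : C).
Hypothesis prim_zeta : m.-primitive_root zeta.
Variable S : pred nat.
Hypothesis S_mod : forall j, S (j %% m)%N = S j.
Hypothesis S_opp : forall j, (j <= m)%N -> S (m - j)%N = S j.
Hypothesis S_half : forall j, S j -> j.*2 != m.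
Variables (X : torus R) (coord : ambient X -> nat -> C) (c : nat -> C).
Let half j := S j && (j.*2 < m)%N.
Hypothesis c_neq0 : forall j, half j -> c j != 0.
Hypothesis coord_dual : forall j, half j ->
  exists2 w, cot w & forall i, half i -> coord w i = (i == j)%:R.
(** The homology class attached to an element [F] of Q[t] / Psi, with period c_j F(zeta ^ j) on the
    j-th form. Only the lower half of the roots appears because H^{1,0} is half of H^1; the values
    at the others are complex conjugates. *)
Definition functional (F : {poly rat}) : ambient X -> C := fun w =>
  \sum_(j < m | half j) coord w j * (c j * (map_poly rC F).[zeta ^+ j]).
Hypothesis H1E : forall l, H1rat l <->
  exists F, forall w, cot w -> l w = functional F w.
Variable Psi : {poly rat}.
Let d := #|[pred j : 'I_m | S j]|.
Hypothesis size_Psi : size Psi = d.+1.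
Hypothesis root_Psi : forall j, S j -> root (map_poly rC Psi) (zeta ^+ j).

Let m_gt0 : (0 < m)%N. Proof. exact: prim_order_gt0 prim_zeta. Qed.

Let rc_rat x : (rC x)^* = rC x.
Proof. exact: (fmorph_eq_rat (Num.conj \o rC)). Qed.

Let conj_zeta j : (j <= m)%N -> (zeta ^+ (m - j))^* = zeta ^+ j.
Proof.
move=> jm; have z_norm : `|zeta| = 1.
  apply/eqP; rewrite -(@pexpr_eq1 _ _ m) // -normrX.
  by rewrite (prim_expr_order prim_zeta) normr1.
have z_conj : zeta^* = zeta^-1.
  by rewrite invC_norm z_norm expr1n invr1 mul1r.
have z0 : zeta != 0 by rewrite -normr_gt0 z_norm ltr01.
rewrite rmorphXn /= z_conj exprVn -[LHS]mulr1 -[X in _ * X](prim_expr_order prim_zeta).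
by rewrite -{2}(subnK jm) exprD mulKf // expf_neq0.
Qed.

Let zeta_mod j : zeta ^+ (j %% m) = zeta ^+ j.
Proof. exact: prim_expr_mod. Qed.

(** The roots zeta ^ j and zeta ^ (m - j) are conjugate, and since 2 j differs from m exactly one of
    them belongs to the lower half. *)
Let S_ind (P : C -> Prop) : (forall j, half j -> P (zeta ^+ j)) ->
  (forall x, P x -> P x^*) -> forall j, S j -> P (zeta ^+ j).
Proof.
move=> Phalf Pconj j; rewrite -S_mod -zeta_mod.
have : (j %% m < m)%N by rewrite ltn_mod.
move: (j %% m)%N => {}j jm Sj; have [jh|jh] := ltnP j.*2 m.
  by apply: Phalf; rewrite /half Sj.
rewrite -(conj_zeta (ltnW jm)); apply/Pconj/Phalf.
rewrite /half S_opp ?(ltnW jm) // Sj /=; have := S_half Sj.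
move: jh jm; clear; lia.
Qed.

Let half_lt j : half j -> (j < m)%N.
Proof. by case/andP => _; apply: leq_ltn_trans; rewrite -addnn leq_addr. Qed.

Let functional_dual F w j : half j ->
  (forall i, half i -> coord w i = (i == j)%:R) ->
  functional F w = c j * (map_poly rC F).[zeta ^+ j].
Proof.
move=> hj wE; rewrite /functional (bigD1 (Ordinal (half_lt hj))) //=.
rewrite wE // eqxx mul1r big1 ?addr0 // => i /andP[hi ij].
by rewrite wE // (negPf (_ : val i != j)) ?mul0r.
Qed.

Let poly_conj (F : {poly rat}) x : (map_poly rC F).[x^*] = (map_poly rC F).[x]^*.
Proof.
rewrite -horner_map /= -map_poly_comp; congr (_.[_]).
by apply: eq_map_poly => a /=; rewrite rc_rat.
Qed.

Lemma functional_inj F G : (forall w, cot w -> functional F w = functional G w) ->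
  forall j, S j -> (map_poly rC F).[zeta ^+ j] = (map_poly rC G).[zeta ^+ j].
Proof.
move=> FG; apply: (S_ind (P := fun x => (map_poly rC F).[x] = (map_poly rC G).[x]))
  => [j hj|x xE]; last by rewrite !poly_conj xE.
have [w cw wE] := coord_dual hj; have := FG w cw.
by rewrite !(functional_dual _ hj wE) => /(mulfI (c_neq0 hj)).
Qed.

Lemma functional_sum I (r : seq I) (a : I -> rat) (F : I -> {poly rat}) w :
  functional (\sum_(i <- r) a i *: F i) w = \sum_(i <- r) rC (a i) * functional (F i) w.
Proof.
rewrite /functional; under [RHS]eq_bigr do rewrite mulr_sumr.
rewrite exchange_big; apply: eq_bigr => j _ /=.
rewrite raddf_sum horner_sum !mulr_sumr; apply: eq_bigr => i _.
by rewrite /= map_polyZ hornerZ [rC _ * (_ * _)]mulrCA [rC _ * (_ * _)]mulrCA.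
Qed.

Let roots := [seq zeta ^+ (val j) | j <- enum [pred j : 'I_m | S j]].

Let size_roots : size roots = d.
Proof. by rewrite size_map -cardE. Qed.

Let uniq_roots : uniq roots.
Proof.
rewrite map_inj_uniq ?enum_uniq // => i j /eqP.
rewrite (eq_prim_root_expr prim_zeta) (modn_small (ltn_ord i)).
by rewrite (modn_small (ltn_ord j)) => /eqP/val_inj.
Qed.

Let roots_S x : x \in roots -> exists2 j, S j & x = zeta ^+ j.
Proof. by case/mapP => j; rewrite mem_enum => Sj ->; exists (val j). Qed.

Variables (n : nat) (e : 'I_n -> (ambient X -> C)).
Hypothesis e_basis : H1basis e.

(** The F_i represent the basis [e] in Q[t] / Psi and [E j] is their evaluation at zeta ^ j; [T] is
    multiplication by t in this basis and [y] the coordinates of 1. The Krylov matrix is square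
    because n = d, obtained from two inequalities. *)
Lemma torus_model : exists (F : 'I_n -> {poly rat}) (T : 'M[rat]_n) (y : 'rV[rat]_n),
  let E j := \col_i (map_poly rC (F i)).[zeta ^+ j] in
  [/\ cyclic_model rC zeta S T y E,
      forall w i, cot w -> e i w = functional (F i) w,
      forall z (N : 'M[R]_n), hodge_action e z N <->
        forall j, S j -> map_mx rc N *m E j = hodge_char m z (z^*) j *: E j
    & forall chi : nat -> C, (forall j, chi (j %% m)%N = chi j) ->
        exists a : 'rV[C]_n, forall j, S j ->
          \sum_(i < n) a 0 i * (zeta ^+ j) ^+ i = chi j].
Proof.
have [e_rat e_span e_free] := e_basis.
have /choice[F eF] : forall i, exists F, forall w, cot w -> e i w = functional F w.
  by move=> i; apply/H1E.
have span G : exists a : 'rV[rat]_n, forall j, S j ->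
    (map_poly rC G).[zeta ^+ j] = \sum_i rC (a 0 i) * (map_poly rC (F i)).[zeta ^+ j].
  have [a aE] : exists a : 'I_n -> rat, forall w, cot w ->
      functional G w = \sum_i rC (a i) * e i w.
    by apply: e_span; apply/H1E; exists G.
  exists (\row_i a i) => j Sj.
  have -> : (map_poly rC G).[zeta ^+ j] = (map_poly rC (\sum_i a i *: F i)).[zeta ^+ j].
    apply: functional_inj Sj => w cw; rewrite aE // functional_sum.
    by apply: eq_bigr => i _; rewrite eF.
  rewrite raddf_sum horner_sum; apply: eq_bigr => i _.
  by rewrite /= map_polyZ hornerZ mxE.
have /choice[t tE] := fun i => span ('X * F i).
have [y yE] := span 1.
pose T := \matrix_(i < n) t i.
pose E j := \col_i (map_poly rC (F i)).[zeta ^+ j].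
have TE j : S j -> map_mx rC T *m E j = zeta ^+ j *: E j.
  move=> Sj; apply/colP => i; rewrite !mxE.
  have := tE i j Sj; rewrite rmorphM /= map_polyX hornerM hornerX => ->.
  by apply: eq_bigr => l _; rewrite !mxE.
have yE1 j : S j -> map_mx rC y *m E j = 1.
  move=> Sj; apply/rowP => i; rewrite !mxE !ord1 eqxx.
  have := yE j Sj; rewrite rmorph1 hornerC => ->.
  by apply: eq_bigr => l _; rewrite !mxE.
have yTE i j : S j -> map_mx rC (y *m T ^+ i) *m E j = ((zeta ^+ j) ^+ i)%:M.
  move=> Sj; rewrite map_mxM rmorphXn /= -mulmxA (eigen_exp i (TE j Sj)).
  by rewrite -scalemxAr yE1 // -scalemx1.
have krylov_eval q (a : 'rV[rat]_q) : a *m \matrix_(i < q) (y *m T ^+ i) = 0 ->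
    forall j, S j -> \sum_(i < q) rC (a 0 i) * (zeta ^+ j) ^+ i = 0.
  move=> a0 j Sj; have := congr1 (fun M => (map_mx rC M *m E j) 0 0) a0.
  rewrite /= map_mx0 mul0mx [RHS]mxE => aE0.
  rewrite -[RHS]aE0 [a *m _]mulmx_sum_row raddf_sum mulmx_suml summxE.
  apply: eq_bigr => i _; rewrite /= rowK map_mxZ -scalemxAl yTE //.
  by rewrite !mxE mulr1n.
have roots_eq0 q (a : 'rV[C]_q) : (q <= d)%N ->
    (forall j, S j -> \sum_(i < q) a 0 i * (zeta ^+ j) ^+ i = 0) -> a = 0.
  move=> qd a0; apply: (row_poly_eq0 uniq_roots); first by rewrite size_roots.
  by move=> x /roots_S[j Sj ->]; exact: a0.
have krylov_free q : (q <= d)%N -> row_free (\matrix_(i < q) (y *m T ^+ i)).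
  move=> qd; apply: inj_row_free => a /krylov_eval a0.
  apply: (map_mx_inj (f := rC)); rewrite map_mx0; apply: roots_eq0 => // j Sj.
  by rewrite -[RHS](a0 j Sj); apply: eq_bigr => i _; rewrite mxE.
(* A combination of the F_i divisible by [Psi] is zero as a functional, so independence of [e]
   passes to the remainders modulo [Psi], which live in dimension d. *)
have nd : (n <= d)%N.
  pose M : 'M[rat]_(n, d) := \matrix_i poly_rV (F i %% Psi).
  have : row_free M; last by rewrite /row_free => /eqP <-; exact: rank_leq_col.
  apply: inj_row_free => a aM; apply/rowP => l; rewrite mxE; move: l.
  apply: e_free => w cw.
  have Psi0 : Psi != 0 by rewrite -size_poly_gt0 size_Psi.
  have F0 : \sum_i a 0 i *: F i = (\sum_i a 0 i *: (F i %/ Psi)) * Psi.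
    have : \sum_i a 0 i *: (F i %% Psi) = 0.
      have aP : rVpoly (a *m M) = 0 by rewrite aM linear0.
      rewrite -[RHS]aP mulmx_sum_row raddf_sum.
      apply: eq_bigr => i _ /=; rewrite linearZ /= rowK poly_rV_K //.
      by rewrite -ltnS -size_Psi ltn_modp.
    move=> a0; rewrite -[RHS]addr0 -[X in _ = _ + X]a0 mulr_suml -big_split; apply: eq_bigr => i _ /=.
    by rewrite -scalerAl -scalerDr -divp_eq.
  under eq_bigr do rewrite eF //.
  rewrite -functional_sum F0 /functional big1 // => j /andP[Sj _].
  by rewrite rmorphM hornerM /= (rootP (root_Psi Sj)) !mulr0.
have dn : (d <= n)%N.
  by have /eqP <- := krylov_free d (leqnn d); exact: rank_leq_col.
have model : cyclic_model rC zeta S T y E.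
  split=> //; last by move=> a; exact: roots_eq0.
  by rewrite -row_free_unit; exact: krylov_free.
exists F, T, y; rewrite -/E; split=> //; first by move=> w i; exact: eF.
- have eE w : cot w -> \col_i e i w = \sum_(j < m | half j) (coord w j * c j) *: E j.
    move=> cw; apply/colP => i; rewrite !mxE eF // summxE; apply: eq_bigr => j _.
    by rewrite !mxE mulrA.
  move=> z N; split=> [zN j Sj|NE w cw].
    have hE i : half i -> map_mx rc N *m E i = z *: E i.
      move=> hi; have [w cw wE] := coord_dual hi.
      have weE : \col_l e l w = c i *: E i.
        by apply/colP => l; rewrite !mxE eF // (functional_dual _ hi wE).
      have := zN w cw; rewrite weE -scalemxAr scalerA mulrC -scalerA.
      by move/(scalerI (c_neq0 hi)).
    have Emod i : E (i %% m)%N = E i by rewrite /E zeta_mod.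
    rewrite /hodge_char -Emod; move: Sj; rewrite -S_mod.
    have : (j %% m < m)%N by rewrite ltn_mod.
    move: (j %% m)%N => {}j jm Sj; case: ltnP => jh; first by rewrite hE // /half Sj.
    have hj : half (m - j)%N.
      rewrite /half S_opp ?(ltnW jm) // Sj /=; have := S_half Sj.
      move: jh jm; clear; lia.
    (* In the upper half, [E j] is the conjugate of the eigenvector at m - j and [N] is real; this
       is where the conjugate of z appears. *)
    have Econj : E j = map_mx Num.conj (E (m - j)%N).
      by apply/colP => i; rewrite !mxE -poly_conj conj_zeta // ltnW.
    have Nconj : map_mx rc N = map_mx Num.conj (map_mx rc N).
      by apply/matrixP => i l; rewrite !mxE conj_Creal // complex_real.
    by rewrite Econj Nconj -map_mxM hE // map_mxZ.
  rewrite eE // mulmx_sumr scaler_sumr; apply: eq_bigr => j /andP[Sj jh].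
  rewrite -scalemxAr NE // !scalerA mulrC; congr (_ *: _); congr (_ * _).
  by rewrite /hodge_char modn_small ?jh // half_lt // /half Sj.
- move=> chi chi_mod.
  (* The Vandermonde matrix of the d distinct roots, square because n = d; being invertible, it
     interpolates any prescribed values. *)
  pose W : 'M[C]_(n, d) := \matrix_(i, l) (zeta ^+ val (enum_val l)) ^+ i.
  have W_full : row_full W.
    rewrite /row_full; apply/eqP/anti_leq; rewrite rank_leq_col /=.
    have /eqP -> // : row_free W.
    apply: inj_row_free => a /rowP aW; apply: roots_eq0 => // j.
    rewrite -S_mod -zeta_mod => Sj.
    have jS : Ordinal (ltn_pmod j m_gt0) \in [pred j : 'I_m | S j] by rewrite inE.
    have := aW (enum_rank_in jS (Ordinal (ltn_pmod j m_gt0))); rewrite !mxE => {2}<-.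
    by apply: eq_bigr => i _; rewrite mxE enum_rankK_in.
  have /submxP[a aE] : (\row_l chi (val (enum_val l)) <= W)%MS by exact: submx_full.
  exists a => j; rewrite -S_mod -zeta_mod -chi_mod => Sj.
  have jS : Ordinal (ltn_pmod j m_gt0) \in [pred j : 'I_m | S j] by rewrite inE.
  have /rowP/(_ (enum_rank_in jS (Ordinal (ltn_pmod j m_gt0)))) := aE.
  rewrite !mxE enum_rankK_in //= => ->.
  by apply: eq_bigr => i _; rewrite mxE enum_rankK_in.
Qed.

End TorusModel.

(** * Regular differentials on C_m *)

Lemma nat_roots_poly_eq0 (C : numDomainType) (p : {poly C}) :
  (forall i : nat, p.[i.+1%:R] = 0) -> p = 0.
Proof.
move=> p0; apply: (@roots_geq_poly_eq0 _ p [seq i.+1%:R | i <- iota 0 (size p)]).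
- by apply/allP => _ /mapP[i _ ->]; apply/rootP.
- rewrite map_inj_uniq ?iota_uniq // => i j /eqP.
  by rewrite eqr_nat => /eqP[].
- by rewrite size_map size_iota.
Qed.

(* p grows at most like x ^ (d - e) at infinity. *)
Lemma size_poly_reciprocal (C : numFieldType) (p q : {poly C}) e d :
  (forall i : nat, p.[i.+1%:R] * i.+1%:R ^+ e = i.+1%:R ^+ d * q.[i.+1%:R^-1]) ->
  p != 0 -> (size p + e <= d.+1)%N.
Proof.
move=> pq p0; set N := size q.
pose Q := \sum_(i < N) q`_i *: 'X^(N - i).
have sQ : (size Q <= N.+1)%N.
  apply: leq_trans (size_sum _ _ _) _; apply/bigmax_leqP => i _.
  by apply: leq_trans (size_scale_leq _ _) _; rewrite size_polyXn ltnS leq_subr.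
have pQ : p * 'X^(e + N) = 'X^d * Q.
  apply/eqP; rewrite -subr_eq0; apply/eqP/nat_roots_poly_eq0 => i.
  rewrite !hornerE exprD mulrA pq -mulrA; apply/eqP; rewrite subr_eq0; apply/eqP.
  congr (_ * _); rewrite horner_coef mulr_suml horner_sum; apply: eq_bigr => l _.
  rewrite !hornerE -mulrA; congr (_ * _).
  by rewrite exprVn mulrC expfB.
have := size_mulXn (e + N) p0; rewrite pQ => sp.
have : (size ('X^d * Q)%R <= d + N.+1)%N.
  apply: leq_trans (size_polyMleq _ _) _; rewrite size_polyXn addSn /=.
  by rewrite leq_add2l.
by rewrite sp addnS -addSn addnAC leq_add2r addnC.
Qed.

Section RegularForms.
Variable R : realType.
Local Notation C := R[i].
Variable m : nat.
Hypotheses (m_odd : odd m) (m_gt1 : (1 < m)%N).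
Let g := m.-1./2.

Let mE : m = g.*2.+1.
Proof. by rewrite /g; move: m_odd m_gt1; clear; lia. Qed.

Let g_gt0 : (0 < g)%N.
Proof. by rewrite /g; move: m_odd m_gt1; clear; lia. Qed.

Let m_neq0 : m%:R != 0 :> C.
Proof. by rewrite mE pnatr_eq0. Qed.

Let hE := (@hornerD, @hornerN, @hornerM, @hornerZ, @hornerXn, @hornerX, @hornerC).

(** On the curve this is dx / y, written as a polynomial form so that it also makes sense where y =
    0. *)
Definition theta (x y dx dy : C) : C := y * dx - 2 / m%:R * x * dy.

Lemma tangent_theta (x y dx dy : C) : tangent m x y dx dy ->
  dx = y * theta x y dx dy /\ dy = m%:R / 2 * x ^+ m.-1 * theta x y dx dy.
Proof.
move=> [cxy txy]; rewrite /on_curve in cxy.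
have xm : x ^+ m = x ^+ m.-1 * x by rewrite mE exprSr.
have ymx : x ^+ m.-1 * dx = 2 / m%:R * y * dy.
  apply: (mulfI m_neq0); rewrite mulrA -txy; field; exact: m_neq0.
split; rewrite /theta.
- rewrite mulrBr mulrA -expr2 cxy xm mulrDl mul1r.
  rewrite (mulrAC (x ^+ m.-1)) ymx; ring.
- transitivity (m%:R / 2 * (y * (x ^+ m.-1 * dx) - 2 / m%:R * (x ^+ m.-1 * x) * dy)); last by ring.
  rewrite ymx -xm.
  have -> : x ^+ m = y ^+ 2 - 1 by rewrite cxy addrK.
  by field; exact: m_neq0.
Qed.

Lemma theta_tangent (x y t : C) : on_curve m x y ->
  tangent m x y (y * t) (m%:R / 2 * x ^+ m.-1 * t).
Proof. by move=> cxy; split=> //; field. Qed.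

Lemma thetaK (x y t : C) : on_curve m x y ->
  theta x y (y * t) (m%:R / 2 * x ^+ m.-1 * t) = t.
Proof.
move=> cxy; rewrite /theta.
transitivity ((y ^+ 2 - x ^+ m.-1 * x) * t); first by field; exact: m_neq0.
by rewrite -exprSr prednK ?(ltn_trans _ m_gt1) // cxy addrAC subrr add0r mul1r.
Qed.

Lemma reduce_quadratic (q : {poly C}) (u : {poly {poly C}}) :
  exists a b : {poly C}, forall x y, y ^+ 2 = q.[x] ->
    u.[y%:P].[x] = a.[x] + b.[x] * y.
Proof.
elim/poly_ind: u => [|u c [a [b ab]]].
  by exists 0, 0 => x y _; rewrite !horner0 mul0r addr0.
exists (b * q + c), a => x y yq; rewrite !hE ab // -yq; ring.
Qed.

Definition represents (w : oneform R) (P : {poly C}) :=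
  forall x y dx dy : C, tangent m x y dx dy ->
    oneform_at w x y dx dy = P.[x] * theta x y dx dy.

(** The two expressions of [w] give a(x) + b(x) y = x ^ (g - 1) (a'(1 / x) + b'(1 / x) y / x ^ (g +
    1)). Changing the sign of y separates this into a(x) = x ^ (g - 1) a'(1 / x), which bounds the
    degree of a by g - 1, and b(x) x ^ 2 = b'(1 / x), which forces b = 0. *)
Lemma regular_represents w : regular_forms m w ->
  exists2 P : {poly C}, (size P <= g)%N & represents w P.
Proof.
move=> [w' ww'].
(* As m = 2 g + 1, the affine curve at infinity is t ^ 2 = s + s ^ (m + 1), whose right-hand side is
   [q']. *)
pose q : {poly C} := 'X^m + 1; pose q' : {poly C} := 'X + 'X^(m.+1).
have [a1 [b1 ab1]] := reduce_quadratic q w.1.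
have [a2 [b2 ab2]] := reduce_quadratic q w.2.
have [a1' [b1' ab1']] := reduce_quadratic q' w'.1.
have [a2' [b2' ab2']] := reduce_quadratic q' w'.2.
pose a := b1 * q + a2 * ((m%:R / 2) *: 'X^(m.-1)).
pose b := a1 + b2 * ((m%:R / 2) *: 'X^(m.-1)).
(* The value of this polynomial at 1 / x is the factor of x ^ (g - 1) theta in d(y / x ^ (g +
   1)). *)
pose s := - 2^-1%:P - (g.+1%:R *: 'X^m) : {poly C}.
pose a' := - (b1' * q') + a2' * s.
pose b' := - a1' + b2' * s.
have wE (x y dx dy : C) : tangent m x y dx dy ->
    oneform_at w x y dx dy = (a.[x] + b.[x] * y) * theta x y dx dy.
  move=> txy; have [dxE dyE] := tangent_theta txy; have [cxy _] := txy.
  move: (theta x y dx dy) dxE dyE => t -> ->.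
  have yq : y ^+ 2 = q.[x] by rewrite cxy !hE.
  rewrite /oneform_at ab1 // ab2 // /a /b !hE -[_ ^+ m + 1]cxy. ring.
have w'E (x y : C) : x != 0 -> on_curve m x y ->
    a.[x] + b.[x] * y = x ^+ g.-1 * (a'.[x^-1] + b'.[x^-1] * (y / x ^+ g.+1)).
  move=> x0 cxy; have txy := theta_tangent 1 cxy.
  have := ww' _ _ _ _ txy x0; rewrite wE // thetaK // !mulr1 => ->.
  have tq : (y / x ^+ g.+1) ^+ 2 = q'.[x^-1].
    rewrite !hE expr_div_n cxy mE exprVn -exprM.
    have -> : (g.+1 * 2 = g.*2.+2)%N by rewrite muln2 doubleS.
    rewrite !exprS; have := expf_neq0 g.*2 x0; move: (x ^+ g.*2) => P P0.
    by field; rewrite x0 P0.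
  rewrite /oneform_at ab1' // ab2' //.
  have := expf_neq0 g.-1 x0; set G := x ^+ g.-1 => G0; rewrite -/g.
  have xg1 : x ^+ g.+1 = G * x ^+ 2 by rewrite -exprD addn2 prednK.
  have xg2 : x ^+ g.+2 = G * x ^+ 3 by rewrite -exprD addn3 prednK.
  have xm1 : x ^+ m.-1 = G * G * x ^+ 2.
    by rewrite -!exprD mE; congr (_ ^+ _); move: g_gt0; clear; lia.
  have xm : x ^+ m = G * G * x ^+ 3.
    by rewrite -!exprD mE; congr (_ ^+ _); move: g_gt0; clear; lia.
  have mR : m%:R = 2 * g.+1%:R - 1 :> C.
    by rewrite mE -addnn -!natr1 natrD; ring.
  have dsE : - y / x ^+ 2 = - (y / x ^+ g.+1) * G by rewrite xg1; field; rewrite x0 G0.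
  have dtE : m%:R / 2 * x ^+ m.-1 / x ^+ g.+1 - g.+1%:R * y * y / x ^+ g.+2 =
            G * s.[x^-1].
    rewrite -(mulrA g.+1%:R y y) -expr2 cxy /s !hE exprVn xg1 xg2 xm xm1 mR.
    by field; rewrite x0 G0.
  clearbody q' s; rewrite dsE dtE; move: tq; rewrite /a' /b' !hornerD !hornerN !hornerM.
  by move: (y / x ^+ g.+1) (q'.[x^-1]) => t Q <-; ring.
have ab x : x != 0 -> x ^+ m + 1 != 0 ->
    a.[x] = x ^+ g.-1 * a'.[x^-1] /\ b.[x] * x ^+ 2 = b'.[x^-1].
  move=> x0 xm1; pose y := sqrtC (x ^+ m + 1).
  have cy : on_curve m x y by exact: sqrtCK.
  have y0 : y != 0 by rewrite sqrtC_eq0.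
  have cNy : on_curve m x (- y) by rewrite /on_curve sqrrN.
  have e1 := w'E _ _ x0 cy; have e2 := w'E _ _ x0 cNy.
  have G0 : x ^+ g.-1 != 0 by exact: expf_neq0.
  have xg1 : x ^+ g.+1 = x ^+ g.-1 * x ^+ 2 by rewrite -exprD addn2 prednK.
  rewrite xg1 in e1 e2; move: (x ^+ g.-1) G0 e1 e2 => G G0 e1 e2; split.
    apply: (mulfI (_ : 2 != 0)); first by rewrite pnatr_eq0.
    transitivity ((a.[x] + b.[x] * y) + (a.[x] + b.[x] * - y)); first by ring.
    by rewrite e1 e2; field; rewrite G0 x0.
  apply: (mulfI (_ : 2 * y != 0)); first by rewrite mulf_neq0 ?pnatr_eq0.
  transitivity (((a.[x] + b.[x] * y) - (a.[x] + b.[x] * - y)) * x ^+ 2); first by ring.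
  by rewrite e1 e2; field; rewrite G0 x0.
have xm1 (i : nat) : i.+1%:R ^+ m + 1 != 0 :> C by rewrite -natrX natr1 pnatr_eq0.
have b0 : b = 0.
  apply/eqP/negPn/negP => /(@size_poly_reciprocal _ b b' 2 0) H.
  suff : (size b + 2 <= 1)%N by rewrite addn2.
  apply: H => i; rewrite expr0 mul1r.
  by have [_ ->] := ab i.+1%:R (lt0r_neq0 (ltr0Sn _ i)) (xm1 i).
exists a.
  have [->|a0] := eqVneq a 0; first by rewrite size_poly0.
  rewrite -[size a]addn0 -(prednK g_gt0).
  apply: (@size_poly_reciprocal _ a a' 0 g.-1) a0 => i; rewrite expr0 mulr1.
  by have [-> _] := ab i.+1%:R (lt0r_neq0 (ltr0Sn _ i)) (xm1 i).
by move=> x y dx dy txy; rewrite wE // b0 horner0 mul0r addr0.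
Qed.

Lemma represents_inj w P Q : represents w P -> represents w Q -> P = Q.
Proof.
move=> wP wQ; apply/eqP; rewrite -subr_eq0; apply/eqP/nat_roots_poly_eq0 => i.
have cy : on_curve m (i.+1%:R : C) (sqrtC (i.+1%:R ^+ m + 1)) by exact: sqrtCK.
have txy := theta_tangent 1 cy; have := wP _ _ _ _ txy; rewrite (wQ _ _ _ _ txy).
by rewrite thetaK // !mulr1 hornerD hornerN => ->; rewrite subrr.
Qed.

Definition theta_form (P : {poly C}) : oneform R :=
  (P%:P * 'X, (- ((2 / m%:R) *: (P * 'X)))%:P).

Lemma theta_formE P x y dx dy :
  oneform_at (theta_form P) x y dx dy = P.[x] * theta x y dx dy.
Proof. by rewrite /oneform_at /theta_form /= !hE /theta; ring. Qed.

Lemma theta_form_represents P : represents (theta_form P) P.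
Proof. by move=> x y dx dy _; exact: theta_formE. Qed.

Lemma theta_form_regular j : (0 < j <= g)%N -> regular_forms m (theta_form 'X^(j.-1)).
Proof.
case/andP=> j_gt0 jg.
(* At infinity theta = s ^ (1 - g) theta', where ds = - t theta' and
   dt = - (1/2 + (g + 1) s ^ m) theta'; the coefficients below solve the Bezout
   identity expressing theta' through ds and dt. *)
pose k : C := g.+1%:R; pose beta1 := - (4 * k / m%:R); pose a0 := 4 * k ^+ 2 / m%:R.
exists ((a0 *: 'X^(g - j + m.-1))%:P * 'X,
        ('X^(g - j) * ((-2)%:P + beta1 *: 'X^m))%:P) => x y dx dy txy x0.
rewrite theta_formE; have [dxE dyE] := tangent_theta txy; have [cxy _] := txy.
move: (theta x y dx dy) dxE dyE => t -> ->; rewrite /oneform_at /= -/g.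
rewrite !hE exprD !exprVn.
have := expf_neq0 g.-1 x0; set G := x ^+ g.-1 => G0.
have xg1 : x ^+ g.+1 = G * x ^+ 2 by rewrite -exprD addn2 prednK.
have xg2 : x ^+ g.+2 = G * x ^+ 3 by rewrite -exprD addn3 prednK.
have xm1 : x ^+ m.-1 = G * G * x ^+ 2.
  by rewrite -!exprD mE; congr (_ ^+ _); move: g_gt0; clear; lia.
have xm : x ^+ m = G * G * x ^+ 3.
  by rewrite -!exprD mE; congr (_ ^+ _); move: g_gt0; clear; lia.
have mR : m%:R = 2 * k - 1 :> C by rewrite mE -addnn /k -!natr1 natrD; ring.
have k0 : 2 * k - 1 != 0 by rewrite -mR.
have xj : G = x ^+ j.-1 * x ^+ (g - j).
  by rewrite -exprD; congr (_ ^+ _); move: j_gt0 jg; clear; lia.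
have xgj0 : x ^+ (g - j) != 0 by exact: expf_neq0.
have -> : x ^+ j.-1 = G / x ^+ (g - j) by rewrite xj mulfK.
rewrite -/k /beta1 /a0 xg1 xg2 xm xm1 mR; clearbody k; clear beta1 a0.
move: cxy; rewrite /on_curve xm => yy.
transitivity ((x ^+ (g - j))^-1 *
   ((4 * k ^+ 2 / (2 * k - 1) / (G * G * x ^+ 2) * (- (y ^+ 2) / (G * x ^+ 4))) +
    (-2 - 4 * k / (2 * k - 1) / (G * G * x ^+ 3)) *
    ((2 * k - 1) / 2 * G - k * y ^+ 2 / (G * x ^+ 3))) * t).
  by rewrite yy; field; rewrite x0 G0 k0 xgj0.
by field; rewrite x0 G0 k0 xgj0.
Qed.

(** The coordinate along x ^ (j - 1) dx / y. The numbering starts at 1 so that the rotation acts on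
    the j-th form by zeta ^ j; index 0 would repeat index 1, hence the bounds 0 < j in what
    follows. *)
Definition regular_coord (w : oneform R) (j : nat) : C :=
  (xget 0 [set P : {poly C} | (size P <= g)%N /\ represents w P])`_j.-1.

Lemma regular_coordE w x y dx dy : regular_forms m w -> tangent m x y dx dy ->
  oneform_at w x y dx dy =
  \sum_(1 <= j < g.+1) regular_coord w j * x ^+ j.-1 * theta x y dx dy.
Proof.
move=> wreg txy; rewrite /regular_coord; case: xgetP => [P _ [sP wP]|H]; last first.
  by have [P sP wP] := regular_represents wreg; have := H P; case.
rewrite wP // -mulr_suml big_add1 /= big_mkord.
by rewrite (horner_coef_wide _ sP).
Qed.

Lemma regular_coord_theta_form j i : (0 < j <= g)%N -> (0 < i)%N ->
  regular_coord (theta_form 'X^(j.-1)) i = (i == j)%:R.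
Proof.
case/andP=> j_gt0 jg i_gt0; rewrite /regular_coord.
case: xgetP => [P _ [sP wP]|H].
  rewrite (represents_inj wP (theta_form_represents _)) coefXn.
  by rewrite -(prednK j_gt0) -{2}(prednK i_gt0).
have := H 'X^(j.-1); case; split; last exact: theta_form_represents.
by rewrite size_polyXn prednK.
Qed.

End RegularForms.

(** * Roots of unity and fibres of the p-th power map *)

Lemma prim_root_exists (C : numClosedFieldType) n : (0 < n)%N ->
  exists z : C, n.-primitive_root z.
Proof.
move=> n_gt0; pose q : {poly C} := 'X^n - 1; have [r Dq] := closed_field_poly_normal q.
rewrite (monicP _) ?monicXnsubC // scale1r in Dq.
have rn1 : all n.-unity_root r by apply/allP => z; rewrite -root_prod_XsubC -Dq.
have sz_r : (n < (size r).+1)%N by rewrite -(size_prod_XsubC r id) -Dq size_XnsubC.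
have [|z] := hasP (has_prim_root n_gt0 rn1 _ sz_r); last by exists z.
by rewrite -separable_prod_XsubC -Dq separable_Xn_sub_1 // pnatr_eq0 -lt0n.
Qed.

Section NthRoots.
Variables (C : numClosedFieldType) (p : nat) (u : C).
Hypotheses (p_gt0 : (0 < p)%N) (u0 : u != 0).

Lemma nth_roots_exist : exists s : seq C,
  [/\ uniq s, forall x, (x \in s) = (x ^+ p == u) & (0 < size s)%N].
Proof.
have [z prim_z] := prim_root_exists C p_gt0.
pose r := p.-root u; have rp : r ^+ p = u by exact: rootCK.
have r0 : r != 0 by apply: contraNneq u0 => r0; rewrite -rp r0 expr0n gtn_eqF.
exists [seq r * z ^+ i | i <- iota 0 p]; split; last by rewrite size_map size_iota.
- rewrite map_inj_in_uniq ?iota_uniq // => i j; rewrite !mem_iota /= !add0n => ip jp.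
  move/(mulfI r0)/eqP; rewrite (eq_prim_root_expr prim_z) !modn_small //.
  by move/eqP.
- move=> x; apply/mapP/eqP => [[i _ ->]|xp].
    by rewrite exprMn rp exprAC (prim_expr_order prim_z) expr1n mulr1.
  have /(prim_rootP prim_z)[i iE] : (x / r) ^+ p = 1 by rewrite expr_div_n xp rp divff.
  by exists (val i); rewrite ?mem_iota //= -iE mulrCA divff // mulr1.
Qed.

(** The fibre is stable under a primitive p-th root of unity z, so the sum is unchanged by
    multiplication by z ^ j, which differs from 1 unless p divides j. *)
Lemma nth_roots_power_sum (s : seq C) j : uniq s ->
  (forall x, (x \in s) = (x ^+ p == u)) ->
  \sum_(x <- s) x ^+ j = if (p %| j)%N then (size s)%:R * u ^+ (j %/ p) else 0.
Proof.
move=> s_uniq sE; case: ifP => [pj|/negbT pj].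
  rewrite (eq_big_seq (fun=> u ^+ (j %/ p))) => [|x].
    by rewrite big_const_seq count_predT iter_addr_0 mulr_natl.
  by rewrite sE => /eqP <-; rewrite -exprM mulnC divnK.
have [z prim_z] := prim_root_exists C p_gt0.
have z0 : z != 0.
  apply: contraNneq (oner_neq0 C) => z0.
  by rewrite -(prim_expr_order prim_z) z0 expr0n gtn_eqF.
have zs : perm_eq s [seq z * x | x <- s].
  have [] := uniq_min_size s_uniq (s2 := [seq z * x | x <- s]).
  - move=> x; rewrite sE => xp; apply/mapP; exists (x / z); last by rewrite mulrCA divff ?mulr1.
    by rewrite sE expr_div_n (prim_expr_order prim_z) divr1.
  - by rewrite size_map.
  - by move=> _ e; apply: uniq_perm => //; rewrite map_inj_uniq //; exact: mulfI.
have := perm_big _ zs (op := +%R) (x := 0) (P := xpredT) (F := fun x => x ^+ j).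
rewrite big_map /= => /eqP; under [X in _ == X]eq_bigr do rewrite exprMn.
rewrite -mulr_sumr -subr_eq0 -{1}[X in X - _]mul1r -mulrBl mulf_eq0.
by rewrite subr_eq0 eq_sym -(prim_order_dvd prim_z) (negPf pj) => /eqP.
Qed.

End NthRoots.

(** * The kernel of the trace *)

Section Trace.
Variable R : realType.
Local Notation C := R[i].
Variables (p k : nat).
Hypotheses (p_prime : prime p) (p_odd : odd p) (k_gt0 : (0 < k)%N).
Let m := (p ^ k)%N.
Let g := m.-1./2.

Let m_odd : odd m. Proof. by rewrite oddX p_odd orbT. Qed.
Let m_gt1 : (1 < m)%N. Proof. by rewrite -(expn0 p) ltn_exp2l // prime_gt1. Qed.
Let mE : m = (p * p ^ k.-1)%N. Proof. by rewrite -expnS prednK. Qed.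
Let p_gt0 : (0 < p)%N. Proof. exact: prime_gt0. Qed.
Let p_neq0 : p%:R != 0 :> C. Proof. by rewrite pnatr_eq0 -lt0n. Qed.
Let m_neq0 : m%:R != 0 :> C. Proof. by rewrite pnatr_eq0 -lt0n expn_gt0 p_gt0. Qed.

(** At the lifted tangent vector theta equals x times [kappa], which is the same at all points of
    the fibre. The j-th form thus contributes [kappa] x ^ j, and the power sums retain only the j
    divisible by p. *)
Lemma sum_fibre (w : oneform R) (u y du dy : C) (s : seq C) : regular_forms m w ->
  tangent (p ^ k.-1) u y du dy -> u != 0 -> uniq s ->
  (forall x, (x \in s) = (x ^+ p == u)) ->
  \sum_(x <- s) oneform_at w x y (du / (p%:R * x ^+ p.-1)) dy =
  (y * du / (p%:R * u) - 2 / m%:R * dy) * (size s)%:R *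
  \sum_(1 <= j < g.+1 | (p %| j)%N) regular_coord m w j * u ^+ (j %/ p).
Proof.
move=> wreg [cuy tuy] u0 s_uniq sE; set kappa := _ - _.
have wE x : x \in s -> oneform_at w x y (du / (p%:R * x ^+ p.-1)) dy =
    kappa * \sum_(1 <= j < g.+1) regular_coord m w j * x ^+ j.
  rewrite sE => /eqP xp; have x0 : x != 0.
    by apply: contraNneq u0 => x0; rewrite -xp x0 expr0n gtn_eqF.
  have ux : u = x ^+ p.-1 * x by rewrite -xp -{1}(prednK p_gt0) exprSr.
  have xp0 : x ^+ p.-1 != 0 by exact: expf_neq0.
  have txy : tangent m x y (du / (p%:R * x ^+ p.-1)) dy.
    split; first by rewrite /on_curve cuy mE exprM xp.
    rewrite tuy mE natrM.
    have -> : x ^+ (p * p ^ k.-1).-1 = u ^+ (p ^ k.-1).-1 * x ^+ p.-1.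
      rewrite -xp -exprM -exprD; congr (_ ^+ _).
      have : (0 < p ^ k.-1)%N by rewrite expn_gt0 p_gt0.
      case: (p ^ k.-1)%N => // q _; rewrite mulnS /= -(prednK p_gt0) addSn /=.
      by rewrite addnC.
    by field; rewrite xp0 p_neq0.
  rewrite (regular_coordE m_odd m_gt1 wreg txy) mulr_sumr.
  rewrite !big_nat; apply: eq_bigr => j /andP[j_gt0 _].
  have -> : x ^+ j = x ^+ j.-1 * x by rewrite -exprSr prednK.
  rewrite /theta /kappa ux.
  by field; rewrite ?x0 ?xp0 ?p_neq0 ?m_neq0.
rewrite (eq_big_seq _ wE) -mulr_sumr -mulrA; congr (_ * _).
rewrite exchange_big mulr_sumr [RHS]big_mkcond /=; apply: eq_bigr => j _.
rewrite -mulr_sumr (nth_roots_power_sum (u := u) p_gt0) //.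
by case: ifP => _; rewrite ?mulr0 // mulrCA.
Qed.

Lemma trace_kernelP (w : oneform R) : regular_forms m w ->
  is_trace p (p ^ k.-1) w 0 <->
  forall j, (0 < j <= g)%N -> (p %| j)%N -> regular_coord m w j = 0.
Proof.
move=> wreg; have at0 (x y dx dy : C) : oneform_at (0 : oneform R) x y dx dy = 0.
  by rewrite /oneform_at /= !horner0 !mul0r addr0.
split=> [tr j /andP[j_gt0 jg] pj|w0 u y du dy tuy u0 s s_uniq sE]; last first.
  rewrite at0 (sum_fibre wreg tuy u0 s_uniq sE) big_nat_cond big1 ?mulr0 // => j /andP[/andP[j1 j2] pj].
  by rewrite w0 ?mul0r // j1.
(* At the tangent vector of the lower curve given by [theta_tangent 1], the common factor is 1 / (p
   u), which is not 0. If the trace vanishes, this polynomial therefore vanishes at all positive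
   integers u. *)
pose Q : {poly C} := \sum_(1 <= j < g.+1 | (p %| j)%N) regular_coord m w j *: 'X^(j %/ p).
have Q0 : Q = 0.
  apply: nat_roots_poly_eq0 => i; set u : C := i.+1%:R.
  have u0 : u != 0 by rewrite pnatr_eq0. clearbody u.
  have cuy : on_curve (p ^ k.-1) u (sqrtC (u ^+ (p ^ k.-1) + 1)) by exact: sqrtCK.
  have [s [s_uniq sE s_gt0]] := nth_roots_exist p_gt0 u0.
  have tuy := theta_tangent 1 cuy.
  have := tr _ _ _ _ tuy u0 s s_uniq sE; rewrite at0 (sum_fibre wreg tuy u0 s_uniq sE) => /esym/eqP.
  rewrite mulf_eq0 mulf_eq0 pnatr_eq0 (gtn_eqF s_gt0) orbF => /orP[|/eqP sum0].
    rewrite !mulr1 -expr2 sqrtCK mE natrM.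
    have q0 : (p ^ k.-1)%:R != 0 :> C by rewrite pnatr_eq0 expn_eq0 (gtn_eqF p_gt0).
    have -> : u ^+ (p ^ k.-1) = u * u ^+ (p ^ k.-1).-1.
      by rewrite -exprS prednK // expn_gt0 p_gt0.
    have -> : (u * u ^+ (p ^ k.-1).-1 + 1) / (p%:R * u) -
       2 / (p%:R * (p ^ k.-1)%:R) * ((p ^ k.-1)%:R / 2 * u ^+ (p ^ k.-1).-1) =
       (p%:R * u)^-1 by field; rewrite p_neq0 u0 q0.
    by rewrite invr_eq0 mulf_eq0 (negPf p_neq0) (negPf u0).
  rewrite /Q horner_sum -[RHS]sum0; apply: eq_bigr => l _.
  by rewrite hornerZ hornerXn.
have := congr1 (fun P : {poly C} => P`_(j %/ p)) Q0; rewrite coef0 coef_sum.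
rewrite big_mkcond (bigD1_seq j) ?mem_index_iota ?j_gt0 ?iota_uniq //= pj.
rewrite coefZ coefXn eqxx mulr1 big1 ?addr0 // => l lj; case: ifP => // pl.
by rewrite coefZ coefXn -(eqn_pmul2r p_gt0) !divnK // eq_sym (negPf lj) mulr0.
Qed.

End Trace.

(** * Calculus of complex functions of a real variable; exponential and powers *)

Section ComplexCalculus.
Variable R : realType.
Local Notation C := R[i].
Local Notation Re := (@complex.Re R).
Local Notation Im := (@complex.Im R).
Implicit Types (z w : R -> C) (t : R) (d : C).

Lemma cReM (x y : C) : Re (x * y) = Re x * Re y - Im x * Im y.
Proof. by case: x y => [a b] [a' b']. Qed.

Lemma cImM (x y : C) : Im (x * y) = Re x * Im y + Im x * Re y.
Proof. by case: x y => [a b] [a' b']. Qed.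

Lemma cReD (x y : C) : Re (x + y) = Re x + Re y. Proof. exact: raddfD. Qed.
Lemma cImD (x y : C) : Im (x + y) = Im x + Im y. Proof. exact: raddfD. Qed.
Lemma cReN (x : C) : Re (- x) = - Re x. Proof. exact: raddfN. Qed.
Lemma cImN (x : C) : Im (- x) = - Im x. Proof. exact: raddfN. Qed.

Lemma complex_eq (x y : C) : Re x = Re y -> Im x = Im y -> x = y.
Proof. by case: x y => [a b] [a' b'] /= -> ->. Qed.

Lemma normc_sq (x : C) : `|x| ^+ 2 = (Re x ^+ 2 + Im x ^+ 2)%:C.
Proof.
by case: x => a b; rewrite normc_def /= -rmorphXn sqr_sqrtr // addr_ge0 ?sqr_ge0.
Qed.

Definition cder z t d :=
  is_derive t 1 (fun s => Re (z s)) (Re d) /\ is_derive t 1 (fun s => Im (z s)) (Im d).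

Lemma cder_eq z t d d' : cder z t d -> d = d' -> cder z t d'.
Proof. by move=> zd <-. Qed.

Lemma is_derive_eqd (f : R -> R) (t a b : R) : is_derive t 1 f a -> a = b -> is_derive t 1 f b.
Proof. by move=> fa <-. Qed.

Lemma is_derive_add (f g : R -> R) (t a b : R) : is_derive t 1 f a -> is_derive t 1 g b ->
  is_derive t 1 (fun s => f s + g s) (a + b).
Proof. by move=> fa gb; exact: is_deriveD. Qed.

Lemma is_derive_sub (f g : R -> R) (t a b : R) : is_derive t 1 f a -> is_derive t 1 g b ->
  is_derive t 1 (fun s => f s - g s) (a - b).
Proof. by move=> fa gb; exact: is_deriveB. Qed.

Lemma is_derive_mul (f g : R -> R) (t a b : R) : is_derive t 1 f a -> is_derive t 1 g b ->
  is_derive t 1 (fun s => f s * g s) (a * g t + f t * b).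
Proof.
move=> fa gb; have fgd : is_derive t 1 (f * g) _ := is_deriveM fa gb.
apply: (is_derive_eqd fgd).
by rewrite /GRing.scale /= addrC [g t * a]mulrC.
Qed.

Lemma is_derive_chain (f g : R -> R) (t a b : R) : is_derive (g t) 1 f a -> is_derive t 1 g b ->
  is_derive t 1 (fun s => f (g s)) (a * b).
Proof. by move=> fa gb; exact: (is_derive1_comp fa gb). Qed.

Lemma cder_cst t (c : C) : cder (fun=> c) t 0.
Proof. by split; exact: is_derive_cst. Qed.

Lemma cderD z w t d d' : cder z t d -> cder w t d' -> cder (fun s => z s + w s) t (d + d').
Proof.
move=> [zR zI] [wR wI]; split; rewrite ?cReD ?cImD.
- by under eq_fun do rewrite cReD; exact: is_deriveD.
- by under eq_fun do rewrite cImD; exact: is_deriveD.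
Qed.

Lemma cderN z t d : cder z t d -> cder (fun s => - z s) t (- d).
Proof.
move=> [zR zI]; split; rewrite ?cReN ?cImN.
- by under eq_fun do rewrite cReN; exact: is_deriveN.
- by under eq_fun do rewrite cImN; exact: is_deriveN.
Qed.

Lemma cderB z w t d d' : cder z t d -> cder w t d' -> cder (fun s => z s - w s) t (d - d').
Proof. by move=> zd /cderN; exact: cderD. Qed.

Lemma cderM z w t d d' : cder z t d -> cder w t d' ->
  cder (fun s => z s * w s) t (d * w t + z t * d').
Proof.
move=> [zR zI] [wR wI]; split; rewrite ?cReD ?cImD ?cReM ?cImM.
- under eq_fun do rewrite cReM.
  by apply: (is_derive_eqd (is_derive_sub (is_derive_mul zR wR) (is_derive_mul zI wI))); ring.
- under eq_fun do rewrite cImM.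
  by apply: (is_derive_eqd (is_derive_add (is_derive_mul zR wI) (is_derive_mul zI wR))); ring.
Qed.

Lemma cderZ (c : C) z t d : cder z t d -> cder (fun s => c * z s) t (c * d).
Proof. by move=> zd; apply: cder_eq (cderM (cder_cst t c) zd) _; ring. Qed.

Lemma cderX n z t d : cder z t d ->
  cder (fun s => z s ^+ n) t (n%:R * z t ^+ n.-1 * d).
Proof.
move=> zd; elim: n => [|n IH].
  by rewrite !mul0r; under eq_fun do rewrite expr0; exact: cder_cst.
under eq_fun do rewrite exprS.
apply: cder_eq (cderM zd IH) _; case: n {IH} => [|n] /=; first by rewrite !expr0; ring.
by rewrite -[n.+2%:R]natr1 exprS; ring.
Qed.

Lemma cder_real (f : R -> R) t a : is_derive t 1 f a -> cder (fun s => (f s)%:C) t a%:C.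
Proof. by move=> fa; split => //=; exact: is_derive_cst. Qed.

Lemma C1_cder z t : C1 z -> cder z t (path_deriv z t).
Proof.
move=> [[zR _] [zI _]]; split; rewrite /path_deriv /= derive1E.
- exact: derivableP (zR t).
- exact: derivableP (zI t).
Qed.

Lemma cder_path_deriv z t d : cder z t d -> path_deriv z t = d.
Proof.
move=> [[_ zR] [_ zI]]; apply: complex_eq; rewrite /path_deriv /= derive1E.
- exact: zR.
- exact: zI.
Qed.

Definition cexp (x : C) : C := (expR (Re x) * cos (Im x)) +i* (expR (Re x) * sin (Im x)).

Lemma cexpD (x y : C) : cexp (x + y) = cexp x * cexp y.
Proof.
apply: complex_eq; rewrite ?cReM ?cImM /= ?cReD ?cImD expRD ?cosD ?sinD; ring.
Qed.

Lemma cexp0 : cexp 0 = 1.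
Proof. by apply: complex_eq; rewrite /= expR0 ?cos0 ?sin0 !mul1r. Qed.

Lemma cexp_neq0 (x : C) : cexp x != 0.
Proof.
apply/eqP => e0; have := cexpD x (- x).
by rewrite subrr cexp0 e0 mul0r => /eqP; rewrite oner_eq0.
Qed.

Lemma cexp_muln n (x : C) : cexp (n%:R * x) = cexp x ^+ n.
Proof.
elim: n => [|n IH]; first by rewrite mul0r cexp0 expr0.
by rewrite -natr1 mulrDl mul1r cexpD IH exprSr.
Qed.

Lemma cder_cexp z t d : cder z t d -> cder (fun s => cexp (z s)) t (d * cexp (z t)).
Proof.
move=> [zR zI].
have eR := is_derive_chain (is_derive_expR (Re (z t))) zR.
have cI := is_derive_chain (is_derive_cos (Im (z t))) zI.
have sI := is_derive_chain (is_derive_sin (Im (z t))) zI.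
split; rewrite /= ?cReM ?cImM /=.
- by apply: (is_derive_eqd (is_derive_mul eR cI)); ring.
- by apply: (is_derive_eqd (is_derive_mul eR sI)); ring.
Qed.

(* Principal determination of the logarithm, on the half plane Re x > 0. *)
Definition clog (x : C) : C := (2^-1 * ln (Re x ^+ 2 + Im x ^+ 2)) +i* atan (Im x / Re x).

Lemma clogK (x : C) : 0 < Re x -> cexp (clog x) = x.
Proof.
move=> x0; set a := Re x; set b := Im x.
have n0 : 0 < a ^+ 2 + b ^+ 2 by rewrite ltr_wpDr ?sqr_ge0 // exprn_gt0.
have eE : expR (2^-1 * ln (a ^+ 2 + b ^+ 2)) = Num.sqrt (a ^+ 2 + b ^+ 2).
  apply/eqP; rewrite -(@eqrXn2 _ 2) ?expR_ge0 ?sqrtr_ge0 // sqr_sqrtr ?ltW //.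
  by rewrite -expRM_natl mulrA mulfV ?pnatr_eq0 // mul1r lnK.
have sE : Num.sqrt (1 + (b / a) ^+ 2) = Num.sqrt (a ^+ 2 + b ^+ 2) / a.
  have -> : 1 + (b / a) ^+ 2 = (a ^+ 2 + b ^+ 2) / a ^+ 2 by field; exact: lt0r_neq0.
  by rewrite sqrtrM ?ltW // sqrtrV ?sqr_ge0 // sqrtr_sqr gtr0_norm.
have s0 : Num.sqrt (a ^+ 2 + b ^+ 2) != 0 by rewrite sqrtr_eq0 -ltNge.
have cE : cos (atan (b / a)) = a / Num.sqrt (a ^+ 2 + b ^+ 2).
  by rewrite cos_atan sE invf_div.
have c0 : cos (atan (b / a)) != 0 by rewrite cE mulf_neq0 ?invr_eq0 // lt0r_neq0.
have tE : sin (atan (b / a)) = b / a * cos (atan (b / a)).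
  by rewrite -{2}(atanK (b / a)) /tan mulfVK.
apply: complex_eq => /=; rewrite -/a -/b eE ?tE cE.
- by field; rewrite s0.
- by field; rewrite s0 lt0r_neq0.
Qed.

Lemma cder_clog z t d : 0 < Re (z t) -> cder z t d ->
  cder (fun s => clog (z s)) t (d / z t).
Proof.
move=> z0 [zR zI]; set a := Re (z t); set b := Im (z t).
have n0 : 0 < a ^+ 2 + b ^+ 2 by rewrite ltr_wpDr ?sqr_ge0 // exprn_gt0.
have dz : d / z t = ((Re d * a + Im d * b) / (a ^+ 2 + b ^+ 2)) +i*
                    ((Im d * a - Re d * b) / (a ^+ 2 + b ^+ 2)).
  have zt0 : z t != 0.
    by apply: contraTneq z0 => ->; rewrite ltxx.
  apply: (mulIf zt0); rewrite mulfVK //; apply: complex_eq; rewrite ?cReM ?cImM /= -/a -/b;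
    by field; exact: lt0r_neq0.
rewrite dz; split => /=.
- have nD : is_derive t 1 (fun s => Re (z s) ^+ 2 + Im (z s) ^+ 2)
      (2 * (Re d * a + Im d * b)).
    under eq_fun do rewrite !expr2.
    apply: (is_derive_eqd (is_derive_add (is_derive_mul zR zR) (is_derive_mul zI zI))).
    by rewrite -/a -/b; ring.
  have kD : is_derive t 1 (fun=> 2^-1 : R) 0 := is_derive_cst _ _ _.
  have lD := is_derive_chain (g := fun s => Re (z s) ^+ 2 + Im (z s) ^+ 2)
    (is_derive1_ln n0) nD.
  apply: (is_derive_eqd (is_derive_mul kD lD)).
  by rewrite -/a -/b; field; exact: lt0r_neq0.
- have iD : is_derive t 1 (fun s => (Re (z s))^-1) (- (Re d / a ^+ 2)).
    have iD' : is_derive t 1 (fun s => (Re (z s))^-1) _ := is_deriveV (lt0r_neq0 z0) zR.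
    apply: (is_derive_eqd iD').
    by rewrite /GRing.scale /= -/a; field; exact: lt0r_neq0.
  apply: (is_derive_eqd (is_derive_chain (is_derive1_atan _) (is_derive_mul zI iD))).
  by rewrite -/a -/b; field; rewrite !lt0r_neq0.
Qed.

(** The principal branch of x ^ a, meaningful on the half plane Re x > 0. *)
Definition hpow (x : C) (a : R) : C := cexp (a%:C * clog x).

Lemma hpowD x a b : hpow x (a + b) = hpow x a * hpow x b.
Proof. by rewrite /hpow -cexpD -mulrDl -rmorphD. Qed.

Lemma hpow0 x : hpow x 0 = 1.
Proof. by rewrite /hpow mul0r cexp0. Qed.

Lemma hpow1 x : 0 < Re x -> hpow x 1 = x.
Proof. by move=> x0; rewrite /hpow mul1r clogK. Qed.

Lemma hpow_neq0 x a : hpow x a != 0.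
Proof. exact: cexp_neq0. Qed.

Lemma hpowN x a : hpow x (- a) = (hpow x a)^-1.
Proof.
apply: (mulfI (hpow_neq0 x a)).
by rewrite -hpowD subrr hpow0 divff // hpow_neq0.
Qed.

Lemma hpowXn x a n : hpow x a ^+ n = hpow x (n%:R * a).
Proof. by rewrite /hpow -cexp_muln mulrA rmorphM rmorph_nat. Qed.

Lemma cder_hpow z t d a : 0 < Re (z t) -> cder z t d ->
  cder (fun s => hpow (z s) a) t (a%:C * d / z t * hpow (z t) a).
Proof.
move=> z0 zd; apply: cder_eq (cder_cexp (cderZ a%:C (cder_clog z0 zd))) _.
by rewrite /hpow !mulrA.
Qed.

End ComplexCalculus.

(** * Continuity, primitives and connectedness of the unit interval *)

Section ComplexContinuity.
Variable R : realType.
Local Notation C := R[i].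
Local Notation Re := (@complex.Re R).
Local Notation Im := (@complex.Im R).
Implicit Types (z w : R -> C) (t : R) (d : C).
Local Notation mu := (@lebesgue_measure R).

Definition ccont z t :=
  (Re (z s) @[s --> t] --> Re (z t)) /\ (Im (z s) @[s --> t] --> Im (z t)).

Lemma ccont_cst (c : C) t : ccont (fun=> c) t.
Proof. by split; exact: cvg_cst. Qed.

Lemma ccontD z w t : ccont z t -> ccont w t -> ccont (fun s => z s + w s) t.
Proof.
move=> [zR zI] [wR wI]; split; rewrite ?cReD ?cImD.
- by under eq_fun do rewrite cReD; exact: cvgD.
- by under eq_fun do rewrite cImD; exact: cvgD.
Qed.

Lemma ccontM z w t : ccont z t -> ccont w t -> ccont (fun s => z s * w s) t.
Proof.
move=> [zR zI] [wR wI]; split; rewrite ?cReM ?cImM.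
- by under eq_fun do rewrite cReM; apply: cvgB; exact: cvgM.
- by under eq_fun do rewrite cImM; apply: cvgD; exact: cvgM.
Qed.

Lemma ccontN z t : ccont z t -> ccont (fun s => - z s) t.
Proof.
move=> zc; have -> : (fun s => - z s) = (fun s => -1 * z s).
  by apply/funext => s; rewrite mulN1r.
exact: ccontM (ccont_cst _ _) zc.
Qed.

Lemma ccontX n z t : ccont z t -> ccont (fun s => z s ^+ n) t.
Proof.
move=> zc; elim: n => [|n IH]; first exact: ccont_cst.
by under eq_fun do rewrite exprS; exact: ccontM.
Qed.

Lemma is_derive_continuous (f : R -> R) t a : is_derive t 1 f a -> {for t, continuous f}.
Proof.
by move=> [fd _]; apply: differentiable_continuous; exact/derivable1_diffP.
Qed.

Lemma cder_ccont z t d : cder z t d -> ccont z t.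
Proof. by move=> [zR zI]; split; [exact: is_derive_continuous zR | exact: is_derive_continuous zI]. Qed.

Lemma C1_ccont z t : C1 z -> ccont z t.
Proof. by move=> z1; exact: cder_ccont (C1_cder t z1). Qed.

Lemma C1_path_deriv_ccont z t : C1 z -> ccont (path_deriv z) t.
Proof. by move=> [[_ zR] [_ zI]]; split; [exact: zR | exact: zI]. Qed.

Lemma ccont_bounded z t : ccont z t ->
  exists K : R, \forall s \near t, `|z s| <= K%:C.
Proof.
move=> [zR zI]; pose a := Re (z t); pose b := Im (z t).
exists ((`|a| + 1) + (`|b| + 1)).
have nR : \forall s \near t, `|Re (z s)| < `|a| + 1.
  by apply: (cvgr_lt _ (cvg_norm zR)); rewrite ltrDl.
have nI : \forall s \near t, `|Im (z s)| < `|b| + 1.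
  by apply: (cvgr_lt _ (cvg_norm zI)); rewrite ltrDl.
near=> s; have hR : `|Re (z s)| < `|a| + 1 by near: s.
have hI : `|Im (z s)| < `|b| + 1 by near: s.
move: hR hI; case: (z s) => x y /= hR hI.
have -> : x +i* y = x%:C + 'i * y%:C by simpc.
apply: le_trans (ler_normD _ _) _; rewrite normrM normCi mul1r.
by rewrite !normc_def /= !expr0n /= !addr0 !sqrtr_sqr -rmorphD /= lecR lerD // ltW.
Unshelve. all: by end_near. Qed.

Lemma ccont_Re_gt z t a : ccont z t -> a < Re (z t) -> \forall s \near t, a < Re (z s).
Proof. by move=> [zR _] az; exact: (cvgr_gt _ zR _ az). Qed.

Lemma near_ball t (P : R -> Prop) : (\forall s \near t, P s) ->
  exists2 e : R, 0 < e & forall s, `|s - t| < e -> P s.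
Proof.
move=> /nbhs_ballP[e /= e0 eP]; exists e => // s st; apply: eP.
by rewrite /ball /= distrC.
Qed.

Lemma zero_derivative_constant z (a b : R) : a <= b ->
  (forall t, a <= t <= b -> cder z t 0) -> z a = z b.
Proof.
have real0 (f : R -> R) : a <= b ->
    (forall t, a <= t <= b -> is_derive t 1 f 0) -> f a = f b.
  rewrite le_eqVlt => /predU1P[-> //|ab] f0.
  have [||c _] := @MVT R f (fun=> 0) a b ab.
  - by move=> x; rewrite in_itv /= => /andP[ax xb]; apply: f0; rewrite !ltW.
  - apply: derivable_within_continuous => x; rewrite in_itv /= => xab.
    by have [] := f0 x xab.
  - by rewrite mul0r => /eqP; rewrite subr_eq0 => /eqP.
move=> ab z0; apply: complex_eq.
- by apply: (real0 (fun s => Re (z s))) => // t /z0[].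
- by apply: (real0 (fun s => Im (z s))) => // t /z0[].
Qed.

Lemma ccont_within z (A : set R) : (forall t, A t -> ccont z t) ->
  {within A, continuous (fun s => Re (z s))} /\ {within A, continuous (fun s => Im (z s))}.
Proof.
move=> zc; split; apply: continuous_in_subspaceT => t /set_mem At; by case: (zc t At).
Qed.

Lemma complex_integral_primitive (f F : R -> C) :
  (forall t, 0 <= t <= 1 -> ccont f t) ->
  (forall t, 0 <= t <= 1 -> cder F t (f t)) ->
  complex_integral f = F 1 - F 0.
Proof.
move=> fc Ff; have [fR fI] : {within `[0, 1], continuous (fun s => Re (f s))} /\
    {within `[0, 1], continuous (fun s => Im (f s))}.
  by apply: ccont_within => t /=; rewrite in_itv /=; exact: fc.
have realI (g G : R -> R) : {within `[0, 1], continuous g} ->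
    (forall t, 0 <= t <= 1 -> is_derive t 1 G (g t)) ->
    Rintegral mu `[0, 1] g = G 1 - G 0.
  move=> gc Gg; rewrite /Rintegral (@continuous_FTC2 _ g G) ?ltr01 //.
    split=> [t||].
    - by rewrite in_itv /= => /andP[t0 t1]; have [|] := Gg t; rewrite ?ltW.
    - apply: cvg_at_right_filter; apply: is_derive_continuous (Gg 0 _).
      by rewrite lexx ler01.
    - apply: cvg_at_left_filter; apply: is_derive_continuous (Gg 1 _).
      by rewrite lexx ler01.
  move=> t; rewrite in_itv /= => /andP[t0 t1]; rewrite derive1E.
  by have [|_ ->] := Gg t; rewrite ?ltW.
apply: complex_eq; rewrite ?cReD ?cImD ?cReN ?cImN /=.
- by apply: (realI _ (fun s => Re (F s))) => // t /Ff[].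
- by apply: (realI _ (fun s => Im (F s))) => // t /Ff[].
Qed.

Lemma eq_complex_integral (f g : R -> C) :
  (forall t, 0 <= t <= 1 -> f t = g t) -> complex_integral f = complex_integral g.
Proof.
move=> fg; congr (_ +i* _); apply: eq_Rintegral => t /set_mem /=;
  by rewrite in_itv /= => /fg ->.
Qed.

Lemma primitive_exists (f : R -> C) : (forall t, ccont f t) ->
  exists F : R -> C, forall t, 0 <= t <= 1 -> cder F t (f t).
Proof.
have realP (g : R -> R) : continuous g ->
    exists G : R -> R, forall t, 0 <= t <= 1 -> is_derive t 1 G (g t).
  (* Integration starts at -1 and the integrand is considered up to 2, so that 0 and 1 are interior
     points and the derivative is two-sided there. *)
  move=> gc; exists (fun x => \int[mu]_(s in `[-1, x]) g s)%R => t /andP[t0 t1].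
  have gi : mu.-integrable `[-1, 2] (EFin \o g).
    apply: continuous_compact_integrable; first exact: segment_compact.
    exact: continuous_subspaceT.
  have [|||Gd GE] := @continuous_FTC1_closed _ g (-1) t 2 _ gi.
  - by rewrite (le_lt_trans t1) // ltr1n.
  - by rewrite (lt_le_trans _ t0) // ltrN10.
  - exact: gc.
  by apply: DeriveDef; [exact: Gd | rewrite -derive1E; exact: GE].
move=> fc; have [G1 G1E] := realP (fun s => Re (f s)) (fun t => (fc t).1).
have [G2 G2E] := realP (fun s => Im (f s)) (fun t => (fc t).2).
by exists (fun s => G1 s +i* G2 s) => t t01; split; [exact: G1E | exact: G2E].
Qed.

(** Near the supremum of the points satisfying [P], the property passes from such a point to one
    strictly beyond the supremum, unless the supremum is 1. *)
Lemma unit_interval_connected (P : R -> Prop) :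
  (forall t0, 0 <= t0 <= 1 -> exists2 e : R, 0 < e &
     forall t t', 0 <= t <= 1 -> 0 <= t' <= 1 -> `|t - t0| < e -> `|t' - t0| < e ->
       P t -> P t') ->
  P 0 -> P 1.
Proof.
move=> Ploc P0; pose A := [set t | 0 <= t <= 1 /\ P t].
have A0 : A 0 by split=> //; rewrite lexx ler01.
have Aub : has_ubound A by exists 1 => t [/andP[]].
have Asup : has_sup A by split=> //; exists 0.
have s01 : 0 <= sup A <= 1.
  rewrite (ub_le_sup Aub A0) /=.
  by apply: ge_sup; [exists 0 | move=> t [/andP[]]].
have [e e0 eP] := Ploc _ s01.
have [t [t01 Pt] te] := sup_adherent e0 Asup.
have ts : t <= sup A by apply: ub_le_sup.
have ets : `|t - sup A| < e.
  by rewrite distrC ger0_norm ?subr_ge0 // ltrBlDr -ltrBlDl.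
pose t' := Num.min 1 (sup A + e / 2).
have e20 : 0 < e / 2 by rewrite divr_gt0.
have e2e : e / 2 < e by rewrite ltr_pdivrMr // mulr_natr mulr2n ltrDl.
have st' : sup A <= t'.
  by rewrite le_min; case/andP: s01 => _ -> /=; rewrite lerDl ltW.
have t'01 : 0 <= t' <= 1.
  by case/andP: s01 => s0 _; rewrite (le_trans s0 st') /= ge_min lexx.
have et's : `|t' - sup A| < e.
  rewrite ger0_norm ?subr_ge0 // ltrBlDl; apply: le_lt_trans (_ : sup A + e / 2 < _).
    by rewrite ge_min lexx orbT.
  by rewrite ltrD2l.
have At' : A t' by split=> //; exact: (eP t t').
have : t' <= sup A by exact: ub_le_sup.
rewrite ge_min; case/orP => [s1|]; last by rewrite gerDl leNgt e20.
have <- : t' = 1 by apply: le_anti; case/andP: t'01 => _ -> /=; exact: le_trans s1 st'.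
by case: At'.
Qed.

End ComplexContinuity.

(** * Primitives by integration along rays *)

Section RadialPrimitive.
Variable R : realType.
Local Notation C := R[i].
Local Notation Re := (@complex.Re R).
Local Notation Im := (@complex.Im R).
Variables (a b : nat) (e : C) (beta : R).
Hypothesis beta_ge0 : 0 <= beta.

(* Primitive of v ^ a (1 + e v ^ b) ^ (- beta) dv, obtained by integrating along
   the segment from 0 to u, on which 1 + e v ^ b has positive real part. *)
Definition radial_primitive (u : C) : C := complex_integral (fun s =>
  u ^+ a.+1 * s%:C ^+ a * hpow (1 + e * s%:C ^+ b.+1 * u ^+ b.+1) (- beta)).

Let radial_Re (q : C) (s : R) : 0 <= s <= 1 ->
  Re (1 + s%:C ^+ b.+1 * q) = (1 - s ^+ b.+1) + s ^+ b.+1 * Re (1 + q).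
Proof. by move=> _; rewrite -rmorphXn /= !cReD cReM /= mul0r subr0; ring. Qed.

(** The point 1 + s ^ (b + 1) q lies on the segment from 1 to 1 + q. *)
Lemma radial_Re_ge (q : C) (s eta : R) : 0 <= s <= 1 -> eta <= 1 ->
  eta <= Re (1 + q) -> eta <= Re (1 + s%:C ^+ b.+1 * q).
Proof.
move=> s01 eta1 etaq; rewrite radial_Re //.
have /andP[s0 s1] := s01; have sb0 : 0 <= s ^+ b.+1 by rewrite exprn_ge0.
have sb1 : s ^+ b.+1 <= 1 by rewrite exprn_ile1.
move: (s ^+ b.+1) (Re _) sb0 sb1 etaq => x y x0 x1 xy; nra.
Qed.

Lemma hpow_bound (w : C) (x eta : R) : 0 <= x -> 0 < eta -> eta <= Re w ->
  `|hpow w (- x)| <= (expR (- x * (2^-1 * ln (eta ^+ 2))))%:C.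
Proof.
move=> x0 eta0 etaw; have -> : `|hpow w (- x)| =
    (expR (- x * (2^-1 * ln (Re w ^+ 2 + Im w ^+ 2))))%:C.
  rewrite normc_def /hpow /cexp /= !mul0r subr0 !addr0.
  set v := expR _; set y := _ * atan _.
  have -> : (v * cos y) ^+ 2 + (v * sin y) ^+ 2 = v ^+ 2.
    by rewrite !exprMn -mulrDr cos2Dsin2 mulr1.
  by rewrite sqrtr_sqr ger0_norm // expR_ge0.
rewrite lecR ler_expR !mulNr lerN2 ler_wpM2l // ler_wpM2l ?invr_ge0 //.
have n0 : 0 < eta ^+ 2 by rewrite exprn_gt0.
have le2 : eta ^+ 2 <= Re w ^+ 2 + Im w ^+ 2.
  rewrite -[leLHS]addr0 lerD ?sqr_ge0 // lerXn2r ?nnegrE ?(ltW eta0) //.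
  exact: le_trans (ltW eta0) etaw.
by rewrite ler_ln ?posrE // (lt_le_trans n0).
Qed.

Section AlongPath.
Variables (u u' : R -> C) (t0 : R).
Hypothesis u_der : \forall t \near t0, cder u t (u' t).
Hypothesis u'_cont : ccont u' t0.
Hypothesis Re_gt0 : 0 < Re (1 + e * u t0 ^+ b.+1).

Let q t := e * u t ^+ b.+1.
Let q' t := e * (b.+1%:R * u t ^+ b * u' t).
Let phi t (s : R) := u t ^+ a.+1 * s%:C ^+ a * hpow (1 + e * s%:C ^+ b.+1 * u t ^+ b.+1) (- beta).
Let dphi t (s : R) := s%:C ^+ a *
  (a.+1%:R * u t ^+ a * u' t * hpow (1 + s%:C ^+ b.+1 * q t) (- beta) -
   beta%:C * (s%:C ^+ b.+1 * q' t) * u t ^+ a.+1 *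
     hpow (1 + s%:C ^+ b.+1 * q t) (- (beta + 1))).

Let hpow_pred (w : C) : 0 < Re w -> hpow w (- (beta + 1)) = hpow w (- beta) / w.
Proof. by move=> w0; rewrite opprD hpowD hpowN [hpow w (- 1)]hpowN hpow1. Qed.

Let phiE t s : phi t s = u t ^+ a.+1 * s%:C ^+ a * hpow (1 + s%:C ^+ b.+1 * q t) (- beta).
Proof. by rewrite /phi /q [s%:C ^+ _ * (_ * _)]mulrCA mulrA. Qed.

Let cder_t t s : cder u t (u' t) -> 0 < Re (1 + s%:C ^+ b.+1 * q t) ->
  cder (phi ^~ s) t (dphi t s).
Proof.
move=> ud w0; have -> : phi ^~ s = fun t => u t ^+ a.+1 * s%:C ^+ a *
    hpow (1 + s%:C ^+ b.+1 * q t) (- beta) by apply/funext => x; rewrite phiE.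
have qd : cder (fun x => 1 + s%:C ^+ b.+1 * q x) t (0 + s%:C ^+ b.+1 * q' t).
  by apply: cderD; [exact: cder_cst | apply/cderZ/cderZ; exact: cderX].
apply: cder_eq (cderM (cderM (cderX a.+1 ud) (cder_cst t (s%:C ^+ a))) (cder_hpow _ w0 qd)) _.
by rewrite /dphi hpow_pred // /= add0r mulr0 addr0 rmorphN; ring.
Qed.

Let cder_id (s : R) : cder (fun x : R => x%:C) s 1.
Proof. by apply: cder_eq (cder_real (is_derive_id s 1)) _. Qed.

Let hpow_cont t s x : 0 < Re (1 + s%:C ^+ b.+1 * q t) ->
  ccont (fun s : R => hpow (1 + s%:C ^+ b.+1 * q t) x) s.
Proof.
move=> w0; have qd : cder (fun x : R => 1 + x%:C ^+ b.+1 * q t) s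
    (0 + (b.+1%:R * s%:C ^+ b * 1 * q t + s%:C ^+ b.+1 * 0)).
  apply: cderD; first exact: cder_cst.
  by apply: cderM; [apply: cderX; exact: cder_id | exact: cder_cst].
exact: cder_ccont (cder_hpow x w0 qd).
Qed.

Let phi_cont t s : 0 < Re (1 + s%:C ^+ b.+1 * q t) -> ccont (phi t) s.
Proof.
move=> w0; have -> : phi t = fun s : R => u t ^+ a.+1 * s%:C ^+ a *
    hpow (1 + s%:C ^+ b.+1 * q t) (- beta) by apply/funext => x; rewrite phiE.
apply: ccontM; last exact: hpow_cont.
apply: ccontM; first exact: ccont_cst.
by apply: ccontX; exact: cder_ccont (cder_id s).
Qed.

Let u_t0 : cder u t0 (u' t0).
Proof. exact: nbhs_singleton u_der. Qed.

(** The idea of the Poincare lemma: the derivative of the integrand in t is the derivative in s of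
    this function. Its integral over [0, 1] is then [theta 1 - theta 0], the expected derivative of
    the primitive. *)
Let theta (s : R) := s%:C ^+ a.+1 * (u t0 ^+ a * u' t0) * hpow (1 + s%:C ^+ b.+1 * q t0) (- beta).

Let w_neq0 s : 0 < Re (1 + s%:C ^+ b.+1 * q t0) -> 1 + s%:C ^+ b.+1 * q t0 != 0.
Proof. by move=> w0; apply: contraTneq w0 => ->; rewrite ltxx. Qed.

Let cder_theta s : 0 < Re (1 + s%:C ^+ b.+1 * q t0) -> cder theta s (dphi t0 s).
Proof.
move=> w0; have qd : cder (fun x : R => 1 + x%:C ^+ b.+1 * q t0) s
    (0 + (b.+1%:R * s%:C ^+ b * 1 * q t0 + s%:C ^+ b.+1 * 0)).
  apply: cderD; first exact: cder_cst.
  by apply: cderM; [apply: cderX; exact: cder_id | exact: cder_cst].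
apply: cder_eq (cderM (cderM (cderX a.+1 (cder_id s)) (cder_cst s _)) (cder_hpow _ w0 qd)) _.
rewrite /dphi hpow_pred // rmorphN /=; move: (w_neq0 w0); move: (hpow _ _) => H.
rewrite !add0r !mulr0 !addr0 !mulr1 /q /q' !exprS.
move: (s%:C) (u t0) => x y w0'; field; exact: w0'.
Qed.

Let dphi_cont s : 0 < Re (1 + s%:C ^+ b.+1 * q t0) -> ccont (dphi t0) s.
Proof.
move=> w0; have sc := cder_ccont (cder_id s).
have hc x := hpow_cont x w0.
apply: ccontM; first exact: ccontX.
apply: ccontD; first by apply: ccontM => //; exact: ccont_cst.
apply: ccontN; apply: ccontM => //; apply: ccontM; last exact: ccont_cst.
apply: ccontM; first exact: ccont_cst.
by apply: ccontM; [exact: ccontX | exact: ccont_cst].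
Qed.

Let q_cont : ccont q t0.
Proof. by apply: ccontM; [exact: ccont_cst | apply: ccontX; exact: cder_ccont u_t0]. Qed.

(** The domination for differentiating under the integral: near [t0], and for all s in [0, 1], the
    real part of the base stays above [eta], which bounds its negative powers. *)
Let dphi_bounded : exists K : R, exists2 d : R, 0 < d & forall t, `|t - t0| < d ->
  [/\ cder u t (u' t), forall s, 0 <= s <= 1 -> 0 < Re (1 + s%:C ^+ b.+1 * q t)
    & forall s, 0 <= s <= 1 -> `|dphi t s| <= K%:C].
Proof.
have uc := cder_ccont u_t0.
(* Halving leaves room for a neighbourhood of [t0]; the cap at 1 is the one [radial_Re_ge] asks
   for. *)
pose eta := Num.min 1 (Re (1 + q t0) / 2).
have eta0 : 0 < eta by rewrite lt_min ltr01 divr_gt0.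
have eta1 : eta <= 1 by rewrite ge_min lexx.
have eta_lt : eta < Re (1 + q t0).
  rewrite /eta gt_min; apply/orP; right.
  by rewrite ltr_pdivrMr // mulr_natr mulr2n ltrDl.
have c1 : ccont (fun t => a.+1%:R * u t ^+ a * u' t) t0.
  by apply: ccontM => //; apply: ccontM; [exact: ccont_cst | exact: ccontX].
have c2 : ccont (fun t => beta%:C * q' t * u t ^+ a.+1) t0.
  apply: ccontM; last exact: ccontX.
  apply: ccontM; first exact: ccont_cst.
  apply: ccontM; first exact: ccont_cst.
  by apply: ccontM => //; apply: ccontM; [exact: ccont_cst | exact: ccontX].
have [K1 K1E] := ccont_bounded c1; have [K2 K2E] := ccont_bounded c2.
have wc : ccont (fun t => 1 + q t) t0 by apply: ccontD => //; exact: ccont_cst.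
pose H x := expR (- x * (2^-1 * ln (eta ^+ 2))).
exists (K1 * H beta + K2 * H (beta + 1)).
have [d d0 dE] : exists2 d : R, 0 < d & forall t, `|t - t0| < d ->
    [/\ cder u t (u' t), eta < Re (1 + q t), `|a.+1%:R * u t ^+ a * u' t| <= K1%:C
      & `|beta%:C * q' t * u t ^+ a.+1| <= K2%:C].
  apply: near_ball; near=> t; split; near: t => //.
  exact: (ccont_Re_gt wc).
exists d => // t /dE[ud wt b1 b2].
have weta s : 0 <= s <= 1 -> eta <= Re (1 + s%:C ^+ b.+1 * q t).
  by move=> s01; apply: radial_Re_ge => //; exact: ltW.
split=> // s s01; first exact: lt_le_trans eta0 (weta s s01).
have /andP[s0 s1] := s01.
have snorm n : `|s%:C ^+ n| <= 1.
  rewrite normrX exprn_ile1 //.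
  by rewrite normc_def /= expr0n addr0 sqrtr_sqr ger0_norm // lecR.
have hb x : 0 <= x -> `|hpow (1 + s%:C ^+ b.+1 * q t) (- x)| <= (H x)%:C.
  by move=> x0; exact: (hpow_bound x0 eta0 (weta s s01)).
rewrite /dphi normrM -[leRHS]mul1r ler_pM // rmorphD !rmorphM /=.
apply: le_trans (ler_normB _ _) _; apply: lerD.
  by rewrite normrM ler_pM // hb.
rewrite normrM ler_pM //; last by rewrite hb // addr_ge0.
have -> : beta%:C * (s%:C ^+ b.+1 * q' t) * u t ^+ a.+1 =
  s%:C ^+ b.+1 * (beta%:C * q' t * u t ^+ a.+1) by ring.
by rewrite normrM -[leRHS]mul1r ler_pM.
Unshelve. all: by end_near. Qed.

Lemma cder_radial_primitive :
  cder (fun t => radial_primitive (u t)) t0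
    (u t0 ^+ a * u' t0 * hpow (1 + e * u t0 ^+ b.+1) (- beta)).
Proof.
have [K [d d0 dE]] := dphi_bounded.
have in_ball t : t \in `](t0 - d), (t0 + d)[ -> `|t - t0| < d.
  by rewrite in_itv /= ltr_distl.
have Ia : `](t0 - d), (t0 + d)[%classic t0.
  by rewrite /= in_itv /= ltrBlDr !ltrDl d0.
have in01 (s : R) : `[0, 1]%classic s -> 0 <= s <= 1 by rewrite /= in_itv.
have K0 : 0 <= K.
  have tt : `|t0 - t0| < d by rewrite subrr normr0.
  have [_ _ bnd] := dE t0 tt; have := bnd 0; rewrite lexx ler01 => /(_ isT).
  by move=> /(le_trans (normr_ge0 _)); rewrite lecR.
(* Differentiation under the integral is applied to real functions; [p] is the real or the imaginary
   part. *)
have real_part (p : C -> R) :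
    (forall z t y, cder z t y -> is_derive t 1 (fun s => p (z s)) (p y)) ->
    (forall z t, ccont z t -> p (z s) @[s --> t] --> p (z t)) ->
    (forall x : C, `|p x| %:C <= `|x|) ->
    is_derive t0 1 (fun t => Rintegral lebesgue_measure `[0, 1] (fun s => p (phi t s)))
      (Rintegral lebesgue_measure `[0, 1] (fun s => p (dphi t0 s))).
  move=> pder pcont pnorm.
  have intf t : `](t0 - d), (t0 + d)[%classic t ->
      lebesgue_measure.-integrable `[0, 1] (EFin \o (fun s : R => p (phi t s))).
    move=> /in_ball/dE[ud w0 _]; apply: continuous_compact_integrable.
      exact: segment_compact.
    apply: continuous_in_subspaceT => s /set_mem/in01 s01.
    by apply: pcont; apply: phi_cont; exact: w0.
  have derf t s : `](t0 - d), (t0 + d)[%classic t -> `[0, 1]%classic s ->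
      is_derive t 1 (fun t => p (phi t s)) (p (dphi t s)).
    by move=> /in_ball/dE[ud w0 _] /in01 s01; apply: pder; apply: cder_t => //; exact: w0.
  have d1E t s : `](t0 - d), (t0 + d)[%classic t -> `[0, 1]%classic s ->
      partial1of2 (fun t (s : R) => p (phi t s)) t s = p (dphi t s).
    by move=> It Is; rewrite partial1of2E; have [_ ->] := derf _ _ It Is.
  have intG : lebesgue_measure.-integrable `[0, 1] (EFin \o (fun _ : R => K)).
    apply: continuous_compact_integrable; first exact: segment_compact.
    by apply: continuous_subspaceT => x; exact: cvg_cst.
  have bound t s : `](t0 - d), (t0 + d)[%classic t -> `[0, 1]%classic s ->
      `|partial1of2 (fun t (s : R) => p (phi t s)) t s| <= K.
    move=> It Is; rewrite d1E // -lecR; apply: le_trans (pnorm _) _.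
    by have /in_ball/dE[_ _] := It; apply; exact: in01.
  have der1 t s : `](t0 - d), (t0 + d)[%classic t -> `[0, 1]%classic s ->
      derivable (fun t => p (phi t s)) t 1.
    by move=> It Is; have [] := derf _ _ It Is.
  have mI : measurable (`[0, 1]%classic : set R) by exact: measurable_itv.
  have D := @derivable_under_integral R _ _ lebesgue_measure
    (fun t (s : R) => p (phi t s)) _ mI t0 _ _ Ia intf der1 (fun=> K) (fun=> K0) intG bound.
  have DE := @differentiation_under_integral R _ _ lebesgue_measure
    (fun t (s : R) => p (phi t s)) _ mI t0 _ _ Ia intf der1 (fun=> K) (fun=> K0) intG bound.
  apply: DeriveDef; [exact: D | ].
  rewrite -derive1E DE; apply: eq_Rintegral => s /set_mem Is.
  exact: d1E.
have [_ w0 _] : [/\ cder u t0 (u' t0), forall s, 0 <= s <= 1 -> 0 < Re (1 + s%:C ^+ b.+1 * q t0)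
    & forall s, 0 <= s <= 1 -> `|dphi t0 s| <= K%:C].
  by apply: dE; rewrite subrr normr0.
have thetaE : complex_integral (dphi t0) = theta 1 - theta 0.
  apply: complex_integral_primitive => s s01; first exact: dphi_cont (w0 s s01).
  exact: cder_theta (w0 s s01).
have -> : u t0 ^+ a * u' t0 * hpow (1 + e * u t0 ^+ b.+1) (- beta) = complex_integral (dphi t0).
  by rewrite thetaE /theta !expr1n expr0n /= !mul0r subr0 !mul1r.
split.
- apply: (real_part Re) => [z t y []//|z t []//|x]; exact: normc_ge_Re.
- apply: (real_part Im) => [z t y []//|z t []//|x].
  by rewrite normc_def lecR -sqrtr_sqr ler_sqrt ?addr_ge0 ?sqr_ge0 // lerDr sqr_ge0.
Qed.

End AlongPath.
End RadialPrimitive.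

Section IntegralScaling.
Variable R : realType.
Local Notation C := R[i].
Local Notation Re := (@complex.Re R).
Local Notation Im := (@complex.Im R).

Lemma complex_integralZ (c : C) (f : R -> C) : (forall t, 0 <= t <= 1 -> ccont f t) ->
  complex_integral (fun t => c * f t) = c * complex_integral f.
Proof.
move=> fc; have [fR fI] : {within `[0, 1], continuous (fun s => Re (f s))} /\
    {within `[0, 1], continuous (fun s => Im (f s))}.
  by apply: ccont_within => t /=; rewrite in_itv /=; exact: fc.
have int (g : R -> R) : {within `[0, 1], continuous g} ->
    lebesgue_measure.-integrable `[0, 1] (EFin \o g).
  by move=> gc; apply: continuous_compact_integrable => //; exact: segment_compact.
have intZ (k : R) (g : R -> R) : {within `[0, 1], continuous g} ->
    lebesgue_measure.-integrable `[0, 1] (EFin \o (fun s => k * g s)).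
  by move=> gc; apply: int => s; apply: continuousM; [exact: cvg_cst | exact: gc].
have mI : measurable (`[0, 1]%classic : set R) by exact: measurable_itv.
apply: complex_eq; rewrite ?cReM ?cImM /=.
- under eq_Rintegral do rewrite cReM.
  rewrite RintegralB //; [| exact: intZ | exact: intZ].
  by rewrite !RintegralZl //; exact: int.
- under eq_Rintegral do rewrite cImM.
  rewrite RintegralD //; [| exact: intZ | exact: intZ].
  by rewrite !RintegralZl //; exact: int.
Qed.

Lemma radial_integrand_ccont a b (e : C) beta (u : C) s : 0 <= s <= 1 ->
  0 < Re (1 + e * u ^+ b.+1) ->
  ccont (fun s : R => u ^+ a.+1 * s%:C ^+ a *
    hpow (1 + e * s%:C ^+ b.+1 * u ^+ b.+1) beta) s.
Proof.
move=> s01 q0; have sd : cder (fun x : R => x%:C) s 1.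
  by apply: cder_eq (cder_real (is_derive_id s 1)) _.
have w0 : 0 < Re (1 + e * s%:C ^+ b.+1 * u ^+ b.+1).
  rewrite [e * _]mulrC -mulrA.
  set eta := Num.min 1 (Re (1 + e * u ^+ b.+1)).
  have eta0 : 0 < eta by rewrite lt_min ltr01 q0.
  have eta1 : eta <= 1 by rewrite ge_min lexx.
  have etaq : eta <= Re (1 + e * u ^+ b.+1) by rewrite ge_min lexx orbT.
  exact: lt_le_trans eta0 (radial_Re_ge b s01 eta1 etaq).
apply: ccontM; first by apply: ccontM; [exact: ccont_cst | apply: ccontX; exact: cder_ccont sd].
have wd : cder (fun x : R => 1 + e * x%:C ^+ b.+1 * u ^+ b.+1) s
    (0 + (e * (b.+1%:R * s%:C ^+ b * 1) * u ^+ b.+1 + e * s%:C ^+ b.+1 * 0)).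
  apply: cderD; first exact: cder_cst.
  apply: cderM; last exact: cder_cst.
  by apply: cderZ; exact: (cderX b.+1 sd).
exact: cder_ccont (cder_hpow beta w0 wd).
Qed.

Lemma radial_primitive_homogeneous a b (e : C) beta (omega u : C) :
  omega ^+ b.+1 = 1 -> 0 < Re (1 + e * u ^+ b.+1) ->
  radial_primitive a b e beta (omega * u) = omega ^+ a.+1 * radial_primitive a b e beta u.
Proof.
move=> o1 q0; rewrite /radial_primitive -complex_integralZ; last first.
  by move=> s s01; exact: radial_integrand_ccont.
apply: eq_complex_integral => s _.
by rewrite !exprMn o1 mul1r !mulrA.
Qed.

End IntegralScaling.

(** * Local primitives on the curve and their jumps *)

Section Charts.
Variable R : realType.
Local Notation C := R[i].
Local Notation Re := (@complex.Re R).
Local Notation Im := (@complex.Im R).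
Variables (m : nat) (zeta : C).
Hypotheses (m_odd : odd m) (m_gt1 : (1 < m)%N).
Hypothesis prim_zeta : m.-primitive_root zeta.

Let m_gt0 : (0 < m)%N. Proof. exact: ltnW. Qed.
Let m_neq0 : m%:R != 0 :> C. Proof. by rewrite pnatr_eq0 -lt0n. Qed.
Let mR_neq0 : m%:R != 0 :> R. Proof. by rewrite pnatr_eq0 -lt0n. Qed.
(* Chart true i covers Re y ^ 2 > 0, with y the branch (-1) ^ i of the square
   root of 1 + x ^ m; chart false i covers Re y ^ 2 < 1, with x the branch
   - zeta ^ i of the m-th root of y ^ 2 - 1. *)
Definition chart (k : bool) (i : nat) (x y : C) : Prop :=
  if k then 0 < Re (1 + x ^+ m) /\ y = (-1) ^+ i * hpow (1 + x ^+ m) 2^-1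
  else 0 < Re (1 - y ^+ 2) /\ x = - zeta ^+ i * hpow (1 - y ^+ 2) m%:R^-1.

(** A primitive of x ^ (j - 1) dx / y. On charts of the first kind y is a sign times the principal
    root of 1 + x ^ m. On the others dx / y = (2 / m) dy / x ^ (m - 1), and x ^ (j - m) is expanded
    from x = - zeta ^ i (1 - y ^ 2) ^ (1 / m), with zeta ^ m = 1. *)
Definition potential (k : bool) (i j : nat) (x y : C) : C :=
  if k then (-1) ^+ i * radial_primitive j.-1 m.-1 1 2^-1 x
  else 2 / m%:R * (-1) ^+ (m - j) * zeta ^+ (i * j) *
       radial_primitive 0 1 (-1) ((m - j)%:R / m%:R) y.

Definition smooth_at (z z' : R -> C) t :=
  (\forall s \near t, cder z s (z' s)) /\ ccont z' t.

Lemma smooth_at_cder z z' t : smooth_at z z' t -> cder z t (z' t).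
Proof. by case=> zd _; exact: nbhs_singleton zd. Qed.

Lemma C1_smooth z t : C1 z -> smooth_at z (path_deriv z) t.
Proof.
move=> z1; split; last exact: C1_path_deriv_ccont.
by near=> s; exact: C1_cder.
Unshelve. all: by end_near. Qed.

Lemma cder_potential k i j (x y x' y' : R -> C) t : (0 < j < m)%N ->
  smooth_at x x' t -> smooth_at y y' t ->
  tangent m (x t) (y t) (x' t) (y' t) -> chart k i (x t) (y t) ->
  cder (fun s => potential k i j (x s) (y s)) t
    (x t ^+ j.-1 * theta m (x t) (y t) (x' t) (y' t)).
Proof.
case/andP=> j_gt0 jm [xd x'c] [yd y'c] txy; have [dx dy] := tangent_theta m_odd m_gt1 txy.
case: txy => cxy _; rewrite /on_curve addrC in cxy.
move: (theta _ _ _ _ _) dx dy => th dx dy.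
case: k => -[w0 def]; rewrite /potential.
- have w0' : 0 < Re (1 + 1 * x t ^+ m.-1.+1) by rewrite mul1r prednK.
  apply: cder_eq (cderZ ((-1) ^+ i) (cder_radial_primitive j.-1 _ xd x'c w0')) _.
    by rewrite invr_ge0.
  rewrite mul1r prednK // dx hpowN def.
  move: (hpow_neq0 (1 + x t ^+ m) 2^-1); move: (hpow _ _) => h h0.
  have s1 : (-1) ^+ i * (-1) ^+ i = 1 :> C by rewrite -expr2 sqrr_sign.
  transitivity ((-1) ^+ i * (-1) ^+ i * (x t ^+ j.-1 * th)); last by rewrite s1 mul1r.
  by field.
- have w0' : 0 < Re (1 + -1 * y t ^+ 2) by rewrite mulN1r.
  apply: cder_eq (cderZ _ (cder_radial_primitive 0 _ yd y'c w0')) _.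
    by rewrite divr_ge0.
  rewrite mulN1r expr0 mul1r dy.
  set h := hpow (1 - y t ^+ 2) m%:R^-1.
  have h0 : h != 0 by exact: hpow_neq0.
  have -> : hpow (1 - y t ^+ 2) (- ((m - j)%:R / m%:R)) = h ^- (m - j).
    by rewrite hpowN -hpowXn.
  have hx : x t ^+ m.-1 = (-1) ^+ m.-1 * zeta ^+ (i * m.-1) * h ^+ j.-1 * h ^+ (m - j).
    rewrite def -/h exprMn (exprNn (zeta ^+ i)) -exprM -[RHS]mulrA -exprD; congr (_ * h ^+ _).
    by move: j_gt0 jm; clear; lia.
  have hj : x t ^+ j.-1 = (-1) ^+ j.-1 * zeta ^+ (i * j.-1) * h ^+ j.-1.
    by rewrite def -/h exprMn (exprNn (zeta ^+ i)) -exprM.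
  rewrite hx hj.
  have zz : zeta ^+ (i * j) * zeta ^+ (i * m.-1) = zeta ^+ (i * j.-1).
    rewrite -exprD -mulnDr; have -> : (j + m.-1 = m + j.-1)%N by move: j_gt0 jm; clear; lia.
    by rewrite mulnDr exprD mulnC exprM (prim_expr_order prim_zeta) expr1n mul1r.
  have ss : (-1) ^+ (m - j) * (-1) ^+ m.-1 = (-1) ^+ j.-1 :> C.
    rewrite -exprD -signr_odd -[RHS]signr_odd; congr ((-1) ^+ _); congr nat_of_bool.
    rewrite oddD oddB; last exact: ltnW.
    by rewrite -!subn1 !oddB // m_odd /=; case: (odd j).
  rewrite -zz -ss.
  have hm0 : h ^+ (m - j) != 0 by exact: expf_neq0.
  move: (h ^+ (m - j)) (h ^+ j.-1) hm0 => H H' H0.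
  by field; rewrite H0 m_neq0.
Qed.

Lemma chart_exists (x y : C) : on_curve m x y -> exists k i, chart k i x y.
Proof.
rewrite /on_curve => cxy; have [w0|w0] := ltP 0 (Re (1 + x ^+ m)).
- exists true; pose h := hpow (1 + x ^+ m) 2^-1.
  have h2 : h ^+ 2 = y ^+ 2.
    by rewrite /h hpowXn mulfV ?pnatr_eq0 // hpow1 // cxy addrC.
  have /orP[/eqP yh|/eqP yh] : (y == h) || (y == - h) by rewrite -eqf_sqr h2.
    by exists 0%N; split; rewrite ?expr0 ?mul1r.
  by exists 1%N; split; rewrite ?expr1 ?mulN1r.
- exists false; have w1 : 0 < Re (1 - y ^+ 2).
    by rewrite cxy addrC !cReD !cReN cReD in w0 *; move: w0; rewrite /=; lra.
  pose h := hpow (1 - y ^+ 2) m%:R^-1; have h0 : h != 0 by exact: hpow_neq0.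
  have hm : h ^+ m = - x ^+ m.
    by rewrite /h hpowXn mulfV // hpow1 // cxy opprD addrCA subrr addr0.
  have x0 : (- x / h) ^+ m = 1.
    rewrite expr_div_n hm exprNn -signr_odd m_odd expr1 mulN1r divff //.
    by rewrite -hm expf_neq0.
  have [i iE] := prim_rootP prim_zeta x0.
  by exists i; split=> //; rewrite -/h mulNr -iE mulfVK // opprK.
Qed.

Definition chart_dom (k : bool) (x y : C) := if k then 0 < Re (1 + x ^+ m) else 0 < Re (1 - y ^+ 2).

(** The ratio of a coordinate to the principal root it should be: on the curve, a sign or an m-th
    root of unity. Its derivative along a path is 0, which is why a path staying in the domain of a
    chart stays in the chart. *)
Definition branch (k : bool) (x y : C) : C :=
  if k then y * hpow (1 + x ^+ m) (- 2^-1) else - x * hpow (1 - y ^+ 2) (- m%:R^-1).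

Lemma chart_branch k i x y : chart k i x y <->
  chart_dom k x y /\ branch k x y = if k then (-1) ^+ i else zeta ^+ i.
Proof.
case: k; rewrite /chart /chart_dom /branch hpowN.
- have h0 := hpow_neq0 (1 + x ^+ m) 2^-1; split=> -[w0 e]; split=> //.
    by rewrite e mulfK.
  by rewrite -e mulfVK.
- have h0 := hpow_neq0 (1 - y ^+ 2) m%:R^-1; split=> -[w0 e]; split=> //.
    by rewrite e !mulNr opprK mulfK.
  by rewrite -e mulNr mulfVK // opprK.
Qed.

Lemma chart_propagates k i (x y x' y' : R -> C) (a b : R) : a <= b ->
  (forall t, a <= t <= b -> [/\ cder x t (x' t), cder y t (y' t),
     tangent m (x t) (y t) (x' t) (y' t) & chart_dom k (x t) (y t)]) ->
  chart k i (x a) (y a) <-> chart k i (x b) (y b).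
Proof.
move=> ab H; have [_ _ _ da] : [/\ cder x a (x' a), cder y a (y' a),
    tangent m (x a) (y a) (x' a) (y' a) & chart_dom k (x a) (y a)].
  by apply: H; rewrite lexx ab.
have [_ _ _ db] : [/\ cder x b (x' b), cder y b (y' b),
    tangent m (x b) (y b) (x' b) (y' b) & chart_dom k (x b) (y b)].
  by apply: H; rewrite lexx ab.
suff bE : branch k (x a) (y a) = branch k (x b) (y b).
  by rewrite !chart_branch bE; split=> -[].
apply: (@zero_derivative_constant _ (fun t => branch k (x t) (y t))) => // t /H[xd yd [cxy txy] dt].
rewrite /on_curve addrC in cxy; rewrite /chart_dom in dt.
case: k dt {da db H} => w0; rewrite /branch.
- have wd : cder (fun s => 1 + x s ^+ m) t (0 + m%:R * x t ^+ m.-1 * x' t).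
    by apply: cderD; [exact: cder_cst | exact: cderX].
  apply: cder_eq (cderM yd (cder_hpow _ w0 wd)) _.
  have w0' : 1 + x t ^+ m != 0 by apply: contraTneq w0 => ->; rewrite ltxx.
  rewrite add0r -txy rmorphN fmorphV rmorph_nat; move: (hpow _ _) => h.
  have y0 : y t != 0 by apply: contraNneq w0' => y0; rewrite -cxy y0 expr0n.
  by rewrite -cxy; field.
- have wd : cder (fun s => 1 - y s ^+ 2) t (0 - 2%:R * y t ^+ 2.-1 * y' t).
    by apply: cderB; [exact: cder_cst | exact: cderX].
  apply: cder_eq (cderM (cderN xd) (cder_hpow _ w0 wd)) _.
  have w0' : 1 - y t ^+ 2 != 0 by apply: contraTneq w0 => ->; rewrite ltxx.
  have wE : 1 - y t ^+ 2 = - (x t ^+ m.-1 * x t).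
    by rewrite -exprSr prednK // cxy opprD addrA subrr add0r.
  rewrite sub0r /= expr1 txy wE rmorphN fmorphV rmorph_nat; move: (hpow _ _) => h.
  have : x t ^+ m.-1 * x t != 0 by rewrite -oppr_eq0 -wE.
  rewrite mulf_eq0 negb_or => /andP[xm0 x0]; move: (x t ^+ m.-1) xm0 => X X0.
  by field; rewrite m_neq0 X0 x0.
Qed.

Lemma potential_increment k i j (x y x' y' : R -> C) (F : R -> C) (a b : R) :
  (0 < j < m)%N -> a <= b ->
  (forall t, a <= t <= b -> [/\ smooth_at x x' t, smooth_at y y' t,
     tangent m (x t) (y t) (x' t) (y' t) & chart_dom k (x t) (y t)]) ->
  chart k i (x a) (y a) ->
  (forall t, a <= t <= b -> cder F t (x t ^+ j.-1 * theta m (x t) (y t) (x' t) (y' t))) ->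
  F a - potential k i j (x a) (y a) = F b - potential k i j (x b) (y b).
Proof.
move=> jm ab H ca Fd.
apply: (@zero_derivative_constant _ (fun t => F t - potential k i j (x t) (y t))) => // t tab.
have [xs ys txy dt] := H t tab; have /andP[at_ tb] := tab.
have ct : chart k i (x t) (y t).
  have [|+ _] := @chart_propagates k i x y x' y' a t at_; last by apply.
  move=> s /andP[sa st]; have [|xs' ys' ts ds] := H s; first by rewrite sa (le_trans st).
  by split=> //; exact: smooth_at_cder.
apply: cder_eq (cderB (Fd t tab) (cder_potential jm xs ys txy ct)) _.
by rewrite subrr.
Qed.

(** The point over y ^ 2 = 1 / 2 with x ^ m = - 1 / 2 and x real negative; it belongs to the chart
    of index 0 of each kind. *)
Let base_x : C := - hpow 2^-1 m%:R^-1.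
Let base_y : C := hpow 2^-1 2^-1.

(** The first potential is based at (0, 1), the second at (- 1, 0). Their difference is the integral
    of x ^ (j - 1) dx / y from (0, 1) to (- 1, 0), a Beta value that is nowhere evaluated. *)
Definition period_constant (j : nat) : C :=
  potential true 0 j base_x base_y - potential false 0 j base_x base_y.

Let Re_half : 0 < Re (2^-1 : C).
Proof.
have -> : (2^-1 : C) = (2^-1 : R)%:C by rewrite fmorphV rmorph_nat.
by rewrite /= invr_gt0.
Qed.

Lemma potential_true0 j (u v : C) :
  potential true 0 j u v = radial_primitive j.-1 m.-1 1 2^-1 u.
Proof. exact: mul1r. Qed.

Lemma potential_rotate i j (u v : C) : (0 < j < m)%N -> 0 < Re (1 + u ^+ m) ->
  potential true 0 j (zeta ^+ i * u) v = zeta ^+ (i * j) * potential true 0 j u v.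
Proof.
case/andP => j_gt0 _ u0; rewrite !potential_true0.
have zm : (zeta ^+ i) ^+ m.-1.+1 = 1.
  by rewrite prednK // -exprM mulnC exprM (prim_expr_order prim_zeta) expr1n.
have u0' : 0 < Re (1 + 1 * u ^+ m.-1.+1).
  by have -> : 1 * u ^+ m.-1.+1 = u ^+ m by rewrite prednK //; exact: mul1r.
by rewrite (radial_primitive_homogeneous j.-1 2^-1 zm u0') prednK // exprM.
Qed.

Lemma potential_rotate_false i j (u u' v : C) :
  potential false i j u' v = zeta ^+ (i * j) * potential false 0 j u v.
Proof.
rewrite /potential mul0n expr0 mulr1; move: (radial_primitive _ _ _ _ _) => x.
by rewrite mulrAC mulrC.
Qed.

(** Both potentials are primitives of the same form, so their difference is constant along paths in
    the overlap. There y ^ 2 ranges over the convex strip 0 < Re < 1, and at y ^ 2 = 1 / 2 the point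
    is the base point rotated by zeta ^ i. *)
Lemma switch_chart0 i j (x y : C) : (0 < j < m)%N ->
  chart true 0 x y -> chart false i x y ->
  potential true 0 j x y - potential false i j x y = zeta ^+ (i * j) * period_constant j.
Proof.
move=> jm [w0 yE] [w1 xE]; rewrite expr0 mul1r in yE.
have y2 : y ^+ 2 = 1 + x ^+ m.
  by rewrite yE hpowXn mulfV ?pnatr_eq0 // hpow1.
(* Join the point to the fibre over y ^ 2 = 1/2 along a segment in y ^ 2. *)
pose dq : C := y ^+ 2 - 2^-1; pose q (s : R) : C := 2^-1 + s%:C * dq.
pose Y s := hpow (q s) 2^-1; pose X s := - zeta ^+ i * hpow (1 - q s) m%:R^-1.
pose Y' s := (2^-1)%:C * dq * hpow (q s) (2^-1 - 1).
pose X' s := zeta ^+ i * ((m%:R^-1)%:C * dq * hpow (1 - q s) (m%:R^-1 - 1)).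
have qd s : cder q s dq.
  have := cderD (cder_cst s (2^-1 : C)) (cderM (cder_real (is_derive_id s 1)) (cder_cst s dq)).
  by move/cder_eq; apply; rewrite mul1r mulr0 add0r addr0.
have qd1 s : cder (fun s => 1 - q s) s (- dq).
  by apply: cder_eq (cderB (cder_cst s 1) (qd s)) _; rewrite sub0r.
have ReqE s : Re (q s) = (1 - s) / 2 + s * Re (y ^+ 2).
  rewrite /q /dq cReD cReM /= mul0r subr0 cReD cReN.
  have -> : (2^-1 : C) = (2^-1 : R)%:C by rewrite fmorphV rmorph_nat.
  by rewrite /=; field.
have Re1 : Re (1 - y ^+ 2) = 1 - Re (y ^+ 2) by rewrite cReD cReN.
rewrite -y2 in w0; rewrite Re1 subr_gt0 in w1.
have q0 s : 0 <= s <= 1 -> 0 < Re (q s).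
  case/andP => s0 s1; rewrite ReqE; move: (Re (y ^+ 2)) w0 w1 => v v0 v1; nra.
have q1 s : 0 <= s <= 1 -> 0 < Re (1 - q s).
  case/andP => s0 s1; rewrite cReD cReN ReqE /=.
  by move: (Re (y ^+ 2)) w0 w1 => v v0 v1; nra.
have hpow_pred (w : C) r : 0 < Re w -> hpow w (r - 1) = hpow w r / w.
  by move=> w0'; rewrite hpowD hpowN hpow1.
have sY s : 0 <= s <= 1 -> smooth_at Y Y' s.
  move=> s01; split.
    have := ccont_Re_gt (cder_ccont (qd s)) (q0 s s01).
    apply: filterS => r rq; apply: cder_eq (cder_hpow 2^-1 rq (qd r)) _.
    by rewrite /Y' hpow_pred // !mulrA [RHS]mulrAC.
  apply: ccontM; first exact: ccont_cst.
  exact: cder_ccont (cder_hpow _ (q0 s s01) (qd s)).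
have sX s : 0 <= s <= 1 -> smooth_at X X' s.
  move=> s01; split.
    have := ccont_Re_gt (cder_ccont (qd1 s)) (q1 s s01).
    apply: filterS => r rq; apply: cder_eq (cderZ _ (cder_hpow m%:R^-1 rq (qd1 r))) _.
    by rewrite /X' hpow_pred //; ring.
  apply: ccontM; first exact: ccont_cst.
  apply: ccontM; first exact: ccont_cst.
  exact: cder_ccont (cder_hpow _ (q1 s s01) (qd1 s)).
have Y2 s : 0 <= s <= 1 -> Y s ^+ 2 = q s.
  by move=> s01; rewrite /Y hpowXn mulfV ?pnatr_eq0 // hpow1 // q0.
have Xm s : 0 <= s <= 1 -> X s ^+ m = - (1 - q s).
  move=> s01; rewrite /X exprMn exprNn -exprM mulnC exprM (prim_expr_order prim_zeta).
  rewrite expr1n mulr1 hpowXn mulfV // hpow1 ?q1 //.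
  by rewrite -signr_odd m_odd expr1 mulN1r.
have cXY s : 0 <= s <= 1 -> chart true 0 (X s) (Y s) /\ chart false i (X s) (Y s).
  move=> s01; rewrite /chart expr0 mul1r Xm // Y2 // opprB addrCA subrr addr0.
  by split; split=> //; [exact: q0 | exact: q1].
have tXY s : 0 <= s <= 1 -> tangent m (X s) (Y s) (X' s) (Y' s).
  move=> s01; split; first by rewrite /on_curve Y2 // Xm // opprB subrK.
  rewrite /X' /Y'.
  have -> : 2 * Y s * ((2^-1)%:C * dq * hpow (q s) (2^-1 - 1)) = dq.
    transitivity (2 * (2^-1)%:C * dq * (Y s * hpow (q s) (2^-1 - 1))); first by ring.
    rewrite /Y -hpowD.
    have -> : 2^-1 + (2^-1 - 1) = 0 :> R by field.
    by rewrite hpow0 mulr1 fmorphV rmorph_nat mulfV ?mul1r // pnatr_eq0.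
  have -> : X s ^+ m.-1 = zeta ^+ (i * m.-1) * hpow (1 - q s) (m.-1%:R * m%:R^-1).
    rewrite /X exprMn exprNn -exprM hpowXn -signr_odd.
    have -> : odd m.-1 = false by move: m_odd m_gt0; case: (m) => // n /= /negbTE.
    by rewrite expr0 mul1r.
  transitivity ((m%:R * (m%:R^-1)%:C) * (zeta ^+ (i * m.-1) * zeta ^+ i) * dq *
    (hpow (1 - q s) (m.-1%:R * m%:R^-1) * hpow (1 - q s) (m%:R^-1 - 1))); last by ring.
  rewrite -hpowD -exprD -mulnSr prednK // mulnC exprM (prim_expr_order prim_zeta) expr1n.
  have -> : m.-1%:R * m%:R^-1 + (m%:R^-1 - 1) = 0 :> R.
    by rewrite -[in m%:R](prednK m_gt0) -natr1; field; rewrite natr1 prednK.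
  by rewrite hpow0 fmorphV rmorph_nat mulfV // !mul1r mulr1.
have DE := @zero_derivative_constant _
  (fun s => potential true 0 j (X s) (Y s) - potential false i j (X s) (Y s)) 0 1 ler01.
have {}DE := DE (fun t t01 => cder_eq (cderB
  (cder_potential jm (sX t t01) (sY t t01) (tXY t t01) (cXY t t01).1)
  (cder_potential jm (sX t t01) (sY t t01) (tXY t t01) (cXY t t01).2)) (subrr _)).
have q1E : q 1 = y ^+ 2 by rewrite /q /dq mul1r addrC subrK.
have q0E : q 0 = 2^-1 by rewrite /q mul0r addr0.
have Y1 : Y 1 = y by rewrite /Y q1E y2 -yE.
have X1 : X 1 = x by rewrite /X q1E -xE.
have half1 : 1 - 2^-1 = 2^-1 :> C by field.
have Y0 : Y 0 = base_y by rewrite /Y q0E.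
have X0 : X 0 = zeta ^+ i * base_x by rewrite /X q0E half1 /base_x mulrN mulNr.
rewrite Y1 X1 Y0 X0 in DE; rewrite -{}DE.
have -> : potential true 0 j (zeta ^+ i * base_x) base_y =
          zeta ^+ (i * j) * potential true 0 j base_x base_y.
  apply: potential_rotate => //; rewrite /base_x exprNn hpowXn mulfV // hpow1 //.
  by rewrite -signr_odd m_odd expr1 mulN1r half1.
have -> : potential false i j (zeta ^+ i * base_x) base_y =
          zeta ^+ (i * j) * potential false 0 j base_x base_y.
  exact: potential_rotate_false.
by rewrite /period_constant mulrBr.
Qed.

Lemma sign_mul_self (b : nat) : (-1) ^+ b * (-1) ^+ b = 1 :> C.
Proof. by rewrite -expr2 sqrr_sign. Qed.

(** Replacing y by (-1) ^ a y reduces to a = 0, since the second potential is odd in y. *)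
Lemma switch_chart a i j (x y : C) : (0 < j < m)%N ->
  chart true a x y -> chart false i x y ->
  potential true a j x y - potential false i j x y =
  (-1) ^+ a * zeta ^+ (i * j) * period_constant j.
Proof.
move=> jm [w0 yE] [w1 xE].
have c0 : chart true 0 x ((-1) ^+ a * y).
  by split=> //; rewrite yE expr0 mulrA sign_mul_self.
have y2 : ((-1) ^+ a * y) ^+ 2 = y ^+ 2 by rewrite exprMn sqrr_sign mul1r.
have c1 : chart false i x ((-1) ^+ a * y) by split; rewrite y2.
rewrite -mulrA -(switch_chart0 jm c0 c1) /potential expr0 mul1r.
rewrite radial_primitive_homogeneous ?sqrr_sign ?mulN1r // expr1.
rewrite mulrBr; congr (_ - _); transitivity ((-1) ^+ a * (-1) ^+ a *
  (2 / m%:R * (-1) ^+ (m - j) * zeta ^+ (i * j) *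
    radial_primitive 0 1 (-1) ((m - j)%:R / m%:R) y)); last by ring.
by rewrite sign_mul_self mul1r.
Qed.

Let rC : {rmorphism rat -> C} := ratr.

(** The point is that [F], which is 0 or a signed monomial, does not depend on j: jumps are elements
    of Q[t]. *)
Lemma potential_difference k i k' i' (x y : C) : chart k i x y -> chart k' i' x y ->
  exists F : {poly rat}, forall j, (0 < j < m)%N ->
    potential k i j x y - potential k' i' j x y =
    period_constant j * (map_poly rC F).[zeta ^+ j].
Proof.
move=> c c'; have same : k = k' -> exists F : {poly rat}, forall j, (0 < j < m)%N ->
    potential k i j x y - potential k' i' j x y =
    period_constant j * (map_poly rC F).[zeta ^+ j].
  move=> kk; rewrite -{}kk in c' *; exists 0 => j _.
  rewrite rmorph0 horner0 mulr0; apply/eqP; rewrite subr_eq0; apply/eqP.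
  move/chart_branch: c => [_ e]; move/chart_branch: c' => [_]; rewrite e => {}e.
  by rewrite /potential; case: (k) e => [->|e] //; rewrite !exprM e.
have eval_sign a l j : (map_poly rC ((-1) ^+ a *: 'X^l)).[zeta ^+ j] =
    (-1) ^+ a * zeta ^+ (l * j).
  rewrite map_polyZ map_polyXn hornerZ hornerXn -exprM mulnC.
  by rewrite rmorphXn rmorphN1.
case: k k' c c' same => [] [] c c' same; try exact: same.
- exists ((-1) ^+ i *: 'X^i') => j jm.
  by rewrite (switch_chart jm c c') eval_sign mulrC.
- exists (- ((-1) ^+ i' *: 'X^i)) => j jm.
  by rewrite rmorphN hornerN eval_sign -opprB (switch_chart jm c' c) mulrN mulrC.
Qed.

End Charts.

(** * Periods of an arbitrary loop *)

Section LoopPeriods.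
Variable R : realType.
Local Notation C := R[i].
Local Notation Re := (@complex.Re R).
Local Notation Im := (@complex.Im R).

(** At the ends of the interval [f] is known on one side only, so the derivative is computed as a
    one-sided limit. This is needed because loops lie on the curve for t in [0, 1] only. *)
Lemma is_derive_zero_unit (f : R -> R) (t a : R) : 0 <= t <= 1 ->
  (forall s, 0 <= s <= 1 -> f s = 0) -> is_derive t 1 f a -> a = 0.
Proof.
move=> /[dup] t01 /andP[t0 t1] f0 [fd fE].
have cv : h^-1 *: (f (h *: 1 + t) - f t) @[h --> 0^'] --> a by rewrite -fE; exact: fd.
have [tlt|tge] := ltP t 1.
- have cvr := cvg_dnbhs_at_right cv; symmetry; apply: (cvg_unique _ _ cvr) => //.
  apply: cvg_near_cst; near=> h; rewrite !f0 //; first by rewrite subrr scaler0.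
  have h0 : 0 < h by [].
  have ht : h <= 1 - t by near: h; apply: nbhs_right_le; rewrite subr_gt0.
  by rewrite /GRing.scale /= mulr1 addr_ge0 ?(ltW h0) //= -lerBrDr.
- have cvl := cvg_dnbhs_at_left cv; symmetry; apply: (cvg_unique _ _ cvl) => //.
  apply: cvg_near_cst; near=> h; rewrite !f0 //; first by rewrite subrr scaler0.
  have h0 : h < 0 by [].
  have ht : - t <= h by near: h; apply: nbhs_left_ge; rewrite oppr_lt0 (lt_le_trans ltr01).
  rewrite /GRing.scale /= mulr1 -lerBlDr sub0r ht /=.
  by rewrite (le_trans _ t1) // gerDr ltW.
Unshelve. all: by end_near. Qed.

Variables (m : nat) (zeta : C).
Hypotheses (m_odd : odd m) (m_gt1 : (1 < m)%N).
Hypothesis prim_zeta : m.-primitive_root zeta.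

Lemma loop_tangent (x y : R -> C) t : loop m x y -> 0 <= t <= 1 ->
  tangent m (x t) (y t) (path_deriv x t) (path_deriv y t).
Proof.
move=> [x1 y1 cxy _ _] t01; split; first exact: cxy.
pose z s := y s ^+ 2 - (x s ^+ m + 1).
have zd : cder z t (2%:R * y t ^+ 2.-1 * path_deriv y t -
    (m%:R * x t ^+ m.-1 * path_deriv x t + 0)).
  apply: cderB; first by apply: cderX; exact: C1_cder.
  by apply: cderD; [apply: cderX; exact: C1_cder | exact: cder_cst].
have z0 s : 0 <= s <= 1 -> z s = 0 by move=> s01; rewrite /z (cxy s s01) subrr.
have d0 : 2%:R * y t ^+ 2.-1 * path_deriv y t -
    (m%:R * x t ^+ m.-1 * path_deriv x t + 0) = 0.
  case: zd => zR zI; apply: complex_eq.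
  - by apply: is_derive_zero_unit t01 _ zR => s s01; rewrite z0.
  - by apply: is_derive_zero_unit t01 _ zI => s s01; rewrite z0.
by move/eqP: d0; rewrite addr0 subr_eq0 /= expr1 => /eqP.
Qed.

Definition theta_along (j : nat) (x y : R -> C) (t : R) : C :=
  x t ^+ j.-1 * theta m (x t) (y t) (path_deriv x t) (path_deriv y t).

Lemma theta_along_ccont j (x y : R -> C) t : C1 x -> C1 y -> ccont (theta_along j x y) t.
Proof.
move=> x1 y1; have xc := C1_ccont t x1; have yc := C1_ccont t y1.
have x'c := C1_path_deriv_ccont t x1; have y'c := C1_path_deriv_ccont t y1.
apply: ccontM; first exact: ccontX.
apply: ccontD; first exact: ccontM.
apply: ccontN; apply: ccontM => //.
by apply: ccontM => //; exact: ccont_cst.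
Qed.

Let rC : {rmorphism rat -> C} := ratr.

(** Along the loop, a primitive of the form minus the local potential changes only when the chart
    does, by a jump from [potential_difference]. At t = 1 the starting point and chart are found
    again, so the potentials cancel and the period is the sum of the jumps. *)
Lemma loop_periods (x y : R -> C) : loop m x y ->
  exists F : {poly rat}, forall j, (0 < j < m)%N ->
    complex_integral (theta_along j x y) =
    period_constant m zeta j * (map_poly rC F).[zeta ^+ j].
Proof.
move=> lxy; have [x1 y1 cxy x01 y01] := lxy.
have /choice[Phi PhiE] : forall j, exists F : R -> C, forall t, 0 <= t <= 1 ->
    cder F t (theta_along j x y t).
  by move=> j; apply: primitive_exists => t; exact: theta_along_ccont.
have in0 : 0 <= (0 : R) <= 1 by rewrite lexx ler01.
have in1 : 0 <= (1 : R) <= 1 by rewrite lexx ler01.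
have [k0 [i0 c0]] := chart_exists m_odd m_gt1 prim_zeta (cxy 0 in0).
pose P t := forall k i, chart m zeta k i (x t) (y t) ->
  exists F : {poly rat}, forall j, (0 < j < m)%N ->
    Phi j t - potential m zeta k i j (x t) (y t) =
    Phi j 0 - potential m zeta k0 i0 j (x 0) (y 0) +
    period_constant m zeta j * (map_poly rC F).[zeta ^+ j].
have P0 : P 0.
  move=> k i c; have [F FE] := potential_difference m_odd m_gt1 prim_zeta c0 c.
  by exists F => j jm; rewrite -FE // addrA subrK.
have : P 1.
  apply: unit_interval_connected P0 => t0 t001.
  have [k1 [i1 c1]] := chart_exists m_odd m_gt1 prim_zeta (cxy t0 t001).
  have [e e0 eE] : exists2 e : R, 0 < e & forall s, `|s - t0| < e ->
      chart_dom m k1 (x s) (y s).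
    apply: near_ball; have /chart_branch[d1 _] := c1.
    have xc := C1_ccont t0 x1; have yc := C1_ccont t0 y1.
    case: k1 c1 d1 => _ d1; rewrite /chart_dom.
    - apply: (ccont_Re_gt (z := fun s => 1 + x s ^+ m)) => //.
      by apply: ccontD; [exact: ccont_cst | exact: ccontX].
    - apply: (ccont_Re_gt (z := fun s => 1 - y s ^+ 2)) => //.
      by apply: ccontD; [exact: ccont_cst | apply: ccontN; exact: ccontX].
  have seg (a b t : R) : 0 <= a -> b <= 1 -> `|a - t0| < e -> `|b - t0| < e ->
      a <= t <= b -> 0 <= t <= 1 /\ chart_dom m k1 (x t) (y t).
    move=> a0 b1 ae be /andP[a_t t_b]; split.
      by rewrite (le_trans a0 a_t) (le_trans t_b b1).
    apply: eE; move: ae be; rewrite !ltr_norml => /andP[ae _] /andP[_ be].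
    by rewrite (lt_le_trans ae) ?lerD2r //= (le_lt_trans _ be) // lerD2r.
  have propag (a b : R) : a <= b -> 0 <= a -> b <= 1 -> `|a - t0| < e -> `|b - t0| < e ->
      chart m zeta k1 i1 (x a) (y a) <-> chart m zeta k1 i1 (x b) (y b).
    move=> ab a0 b1 ae be.
    apply: (@chart_propagates R m zeta m_gt1 k1 i1 x y (path_deriv x) (path_deriv y) a b) => // t tab.
    have [t01 dt] := seg _ _ _ a0 b1 ae be tab.
    by split; [exact: C1_cder | exact: C1_cder | exact: loop_tangent | ].
  have incr (a b : R) j : (0 < j < m)%N -> a <= b -> 0 <= a -> b <= 1 ->
      `|a - t0| < e -> `|b - t0| < e -> chart m zeta k1 i1 (x a) (y a) ->
      Phi j a - potential m zeta k1 i1 j (x a) (y a) =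
      Phi j b - potential m zeta k1 i1 j (x b) (y b).
    move=> jm ab a0 b1 ae be ca.
    apply: (@potential_increment R m zeta m_odd m_gt1 prim_zeta k1 i1 j x y
      (path_deriv x) (path_deriv y) (Phi j) a b) => // t tab.
      have [t01 dt] := seg _ _ _ a0 b1 ae be tab.
      by split; [exact: C1_smooth | exact: C1_smooth | exact: loop_tangent | ].
    by apply: PhiE; have [] := seg _ _ _ a0 b1 ae be tab.
  have e_t0 : `|t0 - t0| < e by rewrite subrr normr0.
  exists e => // t t' /andP[ta tb] /andP[t'a t'b] te t'e Pt k i c.
  have c1all s : 0 <= s -> s <= 1 -> `|s - t0| < e -> chart m zeta k1 i1 (x s) (y s).
    move=> s0 s1 se; have /andP[t0a t0b] := t001; have [st|/ltW ts] := leP t0 s.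
    - by apply/(propag t0 s).
    - by apply/(propag s t0).
  have [F FE] := Pt k1 i1 (c1all t ta tb te).
  have [G GE] := potential_difference m_odd m_gt1 prim_zeta (c1all t' t'a t'b t'e) c.
  exists (F + G) => j jm; rewrite rmorphD hornerD mulrDr addrA -FE // -GE //.
  have -> : Phi j t - potential m zeta k1 i1 j (x t) (y t) =
            Phi j t' - potential m zeta k1 i1 j (x t') (y t').
    have [tt'|/ltW t't] := leP t t'; first by apply: incr => //; exact: c1all.
    by symmetry; apply: incr => //; exact: c1all.
  by rewrite addrA subrK.
move=> /(_ k0 i0); rewrite -x01 -y01 => /(_ c0)[F FE]; exists F => j jm.
rewrite (complex_integral_primitive (F := Phi j)); last first.
- exact: PhiE.
- by move=> t _; exact: theta_along_ccont.
have := FE j jm; move/(congr1 (fun z => z + potential m zeta k0 i0 j (x 0) (y 0))).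
by rewrite subrK addrAC subrK => ->; rewrite addrAC subrr add0r.
Qed.

End LoopPeriods.

(** * A loop all of whose periods are nonzero *)

Section ExplicitLoop.
Variable R : realType.
Local Notation C := R[i].
Local Notation Re := (@complex.Re R).
Local Notation Im := (@complex.Im R).
Implicit Types u w : R -> R.

Definition continuously_derivable u :=
  exists2 u' : R -> R, (forall t : R, is_derive t 1 u (u' t)) & continuous u'.

Lemma continuously_derivable_C1 u : continuously_derivable u -> real_C1 u.
Proof.
move=> [u' ud u'c]; split=> [t|]; first by have [] := ud t.
have -> // : derive1 u = u'.
by apply/funext => t; rewrite derive1E; have [_ ->] := ud t.
Qed.

Lemma cont_derivable_continuous u : continuously_derivable u -> continuous u.
Proof. by move=> [u' ud _] t; exact: is_derive_continuous (ud t). Qed.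

Lemma cont_derivable_cst (a : R) : continuously_derivable (fun=> a).
Proof. by exists (fun=> 0) => t; [exact: is_derive_cst | exact: cvg_cst]. Qed.

Lemma cont_derivable_id : continuously_derivable id.
Proof. by exists (fun=> 1) => t; [exact: is_derive_id | exact: cvg_cst]. Qed.

Lemma cont_derivableD u w : continuously_derivable u -> continuously_derivable w ->
  continuously_derivable (fun t => u t + w t).
Proof.
move=> [u' ud u'c] [w' wd w'c]; exists (fun t => u' t + w' t) => t.
  exact: is_derive_add.
by apply: cvgD; [exact: u'c | exact: w'c].
Qed.

Lemma cont_derivableM u w : continuously_derivable u -> continuously_derivable w ->
  continuously_derivable (fun t => u t * w t).
Proof.
move=> uc wc; have [u' ud u'c] := uc; have [w' wd w'c] := wc.
exists (fun t => u' t * w t + u t * w' t) => t; first exact: is_derive_mul.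
apply: cvgD; apply: cvgM.
- exact: u'c.
- exact: cont_derivable_continuous wc t.
- exact: cont_derivable_continuous uc t.
- exact: w'c.
Qed.

Lemma cont_derivableX n u : continuously_derivable u ->
  continuously_derivable (fun t => u t ^+ n).
Proof.
move=> uc; elim: n => [|n IH]; first exact: cont_derivable_cst.
by under eq_fun do rewrite exprS; exact: cont_derivableM.
Qed.

Lemma cont_derivable_expR u : continuously_derivable u ->
  continuously_derivable (fun t => expR (u t)).
Proof.
move=> uc; have [u' ud u'c] := uc; exists (fun t => expR (u t) * u' t) => t.
  exact: is_derive_chain (is_derive_expR (u t)) (ud t).
apply: cvgM; last exact: u'c.
apply: (continuous_comp (g := expR)); first exact: cont_derivable_continuous uc t.
exact: continuous_expR.
Qed.

Lemma cont_derivable_inv u : (forall t, 0 < u t) -> continuously_derivable u ->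
  continuously_derivable (fun t => (u t)^-1).
Proof.
move=> u0 uc; have [u' ud u'c] := uc; exists (fun t => - (u t ^- 2) * u' t) => t.
  have iD : is_derive t 1 (fun s => (u s)^-1) _ := is_deriveV (lt0r_neq0 (u0 t)) (ud t).
  exact: is_derive_eqd iD _.
apply: cvgM; last exact: u'c.
apply: cvgN; apply: cvgV; first by rewrite expf_neq0 // lt0r_neq0.
have uc2 := cont_derivable_continuous (cont_derivableX 2 uc).
exact: uc2.
Qed.

Lemma cont_derivable_ln u : (forall t, 0 < u t) -> continuously_derivable u ->
  continuously_derivable (fun t => ln (u t)).
Proof.
move=> u0 uc; have [u' ud u'c] := uc; exists (fun t => (u t)^-1 * u' t) => t.
  exact: is_derive_chain (is_derive1_ln (u0 t)) (ud t).
apply: cvgM; last exact: u'c.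
exact: cont_derivable_continuous (cont_derivable_inv u0 uc) t.
Qed.

(** This function lets x pass from one ray to the other at v = 0 while the loop stays C^1. *)
Lemma cont_derivable_square_abs : continuously_derivable (fun s : R => s * `|s|).
Proof.
exists (fun s => 2 * `|s|) => t; last first.
  by apply: cvgM; [exact: cvg_cst | apply: cvg_norm; exact: cvg_id].
have bound (h : R) : `|(h + t) * `|h + t| - t * `|t| - 2 * `|t| * h| <= h ^+ 2.
  rewrite ler_norml; have [ht|ht] := leP 0 (h + t); have [t0|t0] := leP 0 t;
    rewrite ?(ger0_norm ht) ?(ger0_norm t0) ?(ltr0_norm ht) ?(ltr0_norm t0); nra.
have cv : h^-1 *: (((h *: (1 : R) + t) * `|h *: (1 : R) + t|) - t * `|t|) @[h --> 0^'] --> 2 * `|t|.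
  apply/cvgrPdist_le => eps eps0; near=> h.
  have h0 : h != 0 by near: h; exact: nbhs_dnbhs_neq.
  have he : `|h| <= eps.
    near: h; apply: dnbhs0_le => //.
  rewrite /GRing.scale /= mulr1 distrC.
  have -> : h^-1 * ((h + t) * `|h + t| - t * `|t|) - 2 * `|t| =
    h^-1 * ((h + t) * `|h + t| - t * `|t| - 2 * `|t| * h) by field.
  rewrite normrM normfV; apply: le_trans he.
  rewrite ler_pdivrMl ?normr_gt0 //; apply: le_trans (bound h) _.
  by rewrite -expr2 -normrX ler_norm.
apply: DeriveDef; first by apply/cvg_ex; exists (2 * `|t|); exact: cv.
exact: cvg_lim cv.
Unshelve. all: by end_near. Qed.

Lemma is_derive_pow n u (t a : R) : is_derive t 1 u a ->
  is_derive t 1 (fun s => u s ^+ n) (n%:R * u t ^+ n.-1 * a).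
Proof.
move=> ua; elim: n => [|n IH].
  by rewrite !mul0r; exact: is_derive_cst.
have -> : (fun s => u s ^+ n.+1) = fun s => u s * u s ^+ n.
  by apply/funext => s; rewrite exprS.
apply: (is_derive_eqd (is_derive_mul ua IH)); case: n {IH} => [|n] /=; first by rewrite !expr0; ring.
by rewrite -[n.+2%:R]natr1 exprS; ring.
Qed.

(** Positivity is asked in the open interval only: at the ends of the two halves of the loop x = 0,
    and the formula for the integrand divides by a power of x. *)
Lemma positive_derivative_lt (f f' : R -> R) (a b : R) : a < b ->
  (forall t : R, a <= t <= b -> is_derive t 1 f (f' t)) ->
  (forall t, a < t < b -> 0 < f' t) -> f a < f b.
Proof.
move=> ab fd f0; have [||c] := @MVT R f f' a b ab.
- by move=> x; rewrite in_itv /= => /andP[ax xb]; apply: fd; rewrite !ltW.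
- apply: derivable_within_continuous => x; rewrite in_itv /= => xab.
  by have [] := fd x xab.
- rewrite in_itv /= => cab e; rewrite -subr_gt0 e mulr_gt0 ?f0 // subr_gt0 //.
Qed.

Variables (m : nat) (zeta : C).
Hypotheses (m_odd : odd m) (m_gt1 : (1 < m)%N).
Hypothesis prim_zeta : m.-primitive_root zeta.

(* The loop runs from (0, -1) to (0, 1) with x on the ray R_{<= 0} and returns
   with x on its image by zeta; with P = p ^ (2 m) and Q = v ^ (4 m) it is the
   rational parametrization y = (P - Q) / (P + Q), 1 - y ^ 2 = 4 P Q / (P + Q) ^ 2,
   the m-th root of which is E p ^ 2 v ^ 4. *)
Let p (t : R) : R := 4 * t * (1 - t).
Let v (t : R) : R := 2 * t - 1.
Let D (t : R) : R := p t ^+ (2 * m) + v t ^+ (4 * m).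
Let yr (t : R) : R := (p t ^+ (2 * m) - v t ^+ (4 * m)) / D t.
(** The m-th root of 4 / D ^ 2, through the exponential. *)
Let E (t : R) : R := expR (m%:R^-1 * (ln 4 - 2 * ln (D t))).
Let xi (t : R) : R := E t * p t ^+ 2 * v t ^+ 4.
(** Equal to - [xi] up to t = 1 / 2 and to [xi] afterwards; the coefficients in [x] are chosen so
    that x is - [xi] and then - zeta times [xi]. *)
Let sg (t : R) : R := E t * p t ^+ 2 * (v t ^+ 2 * (v t * `|v t|)).
Let y (t : R) : C := (yr t)%:C.
Let x (t : R) : C := (- ((1 + zeta) / 2)) * (xi t)%:C + ((1 - zeta) / 2) * (sg t)%:C.

Let m_gt0 : (0 < m)%N. Proof. exact: ltnW. Qed.
Let mR_neq0 : m%:R != 0 :> R. Proof. by rewrite pnatr_eq0 -lt0n. Qed.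

Let pv t : p t = 1 - v t ^+ 2. Proof. by rewrite /p /v; ring. Qed.

Let D_gt0 t : 0 < D t.
Proof.
rewrite /D !exprM; have [v0|v0] := eqVneq (v t) 0.
  by rewrite pv v0 !expr0n /= subr0 !expr1n (gtn_eqF m_gt0) addr0.
apply: ltr_wpDl; first by rewrite exprn_ge0 // sqr_ge0.
by rewrite exprn_gt0 // (exprM _ 2 2) exprn_even_gt0 // sqrf_eq0.
Qed.

Let vC : continuously_derivable v.
Proof.
apply: cont_derivableD; last exact: cont_derivable_cst.
by apply: cont_derivableM; [exact: cont_derivable_cst | exact: cont_derivable_id].
Qed.

Let pC : continuously_derivable p.
Proof.
have -> : p = fun t => 1 + -1 * v t ^+ 2 by apply/funext => t; rewrite pv mulN1r.
apply: cont_derivableD; first exact: cont_derivable_cst.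
by apply: cont_derivableM; [exact: cont_derivable_cst | exact: cont_derivableX].
Qed.

Let DC : continuously_derivable D.
Proof. by apply: cont_derivableD; exact: cont_derivableX. Qed.

Let EC : continuously_derivable E.
Proof.
apply: cont_derivable_expR; apply: cont_derivableM; first exact: cont_derivable_cst.
have -> : (fun t => ln 4 - 2 * ln (D t)) = fun t => ln 4 + (- 2) * ln (D t).
  by apply/funext => t; rewrite mulNr.
apply: cont_derivableD; first exact: cont_derivable_cst.
by apply: cont_derivableM; [exact: cont_derivable_cst | exact: cont_derivable_ln].
Qed.

Let Ep2C : continuously_derivable (fun t => E t * p t ^+ 2).
Proof. by apply: cont_derivableM => //; exact: cont_derivableX. Qed.

Let xiC : continuously_derivable xi.
Proof. by apply: cont_derivableM => //; exact: cont_derivableX. Qed.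

Let sgC : continuously_derivable sg.
Proof.
apply: cont_derivableM => //; apply: cont_derivableM; first exact: cont_derivableX.
have [h' hd hc] := cont_derivable_square_abs; have [v' vd v'c] := vC.
exists (fun t => h' (v t) * v' t) => t; first exact: is_derive_chain (hd (v t)) (vd t).
apply: cvgM; last exact: v'c.
apply: (continuous_comp (g := h')); last exact: hc.
exact: cont_derivable_continuous vC t.
Qed.

Let yrC : continuously_derivable yr.
Proof.
apply: cont_derivableM; last exact: cont_derivable_inv.
have -> : (fun t => p t ^+ (2 * m) - v t ^+ (4 * m)) =
  fun t => p t ^+ (2 * m) + (-1) * v t ^+ (4 * m) by apply/funext => t; rewrite mulN1r.
apply: cont_derivableD; first exact: cont_derivableX.
by apply: cont_derivableM; [exact: cont_derivable_cst | exact: cont_derivableX].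
Qed.

Let C1_real u : continuously_derivable u -> C1 (fun t => (u t)%:C).
Proof. by move=> uc; split; apply: continuously_derivable_C1 => //; exact: cont_derivable_cst. Qed.

Let C1x : C1 x.
Proof.
have lin (a b : R) : continuously_derivable (fun t => a * xi t + b * sg t).
  by apply: cont_derivableD; apply: cont_derivableM => //; exact: cont_derivable_cst.
split; apply: continuously_derivable_C1.
- have -> : (fun t => Re (x t)) = fun t => Re (- ((1 + zeta) / 2)) * xi t + Re ((1 - zeta) / 2) * sg t.
    by apply/funext => t; rewrite /x cReD !cReM /= !mulr0 !subr0.
  exact: lin.
- have -> : (fun t => Im (x t)) = fun t => Im (- ((1 + zeta) / 2)) * xi t + Im ((1 - zeta) / 2) * sg t.
    by apply/funext => t; rewrite /x cImD !cImM /= !mulr0 !add0r.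
  exact: lin.
Qed.

Let xE1 t : t <= 1 / 2 -> x t = - (xi t)%:C.
Proof.
move=> t2; have v0 : v t <= 0 by rewrite /v; lra.
rewrite /x; have -> : sg t = - xi t by rewrite /sg /xi ler0_norm //; ring.
by rewrite rmorphN; field.
Qed.

Let xE2 t : 1 / 2 <= t -> x t = - zeta * (xi t)%:C.
Proof.
move=> t2; have v0 : 0 <= v t by rewrite /v; lra.
rewrite /x; have -> : sg t = xi t by rewrite /sg /xi ger0_norm //; ring.
by field.
Qed.

Let xi_m t : xi t ^+ m = 1 - yr t ^+ 2.
Proof.
have D0 := lt0r_neq0 (D_gt0 t).
have Em : E t ^+ m = 4 / D t ^+ 2.
  rewrite /E -expRM_natl mulrA mulfV // mul1r expRD expRN expRM_natl !lnK ?posrE //.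
have -> : xi t ^+ m = E t ^+ m * p t ^+ (2 * m) * v t ^+ (4 * m).
  by rewrite /xi; move: (E t) (p t) (v t) => a b c; rewrite 2!exprMn -!exprM.
rewrite Em /yr.
have DE : D t = p t ^+ (2 * m) + v t ^+ (4 * m) by [].
move: (p t ^+ _) (v t ^+ _) (D t) D0 DE => P Q d d0 dE.
have -> : P = d - Q by rewrite dE addrK.
by field.
Qed.

Let xi_gt0 t : 0 < t < 1 -> t != 1 / 2 -> 0 < xi t.
Proof.
move=> /andP[t0 t1] t2; have p0 : 0 < p t by rewrite /p; nra.
have v0 : v t != 0 by apply: contra t2 => /eqP; rewrite /v => v0; apply/eqP; lra.
rewrite /xi; apply: mulr_gt0; last by rewrite exprn_even_gt0 // v0 orbT.
by apply: mulr_gt0; [exact: expR_gt0 | exact: exprn_gt0].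
Qed.

Let y'r (t : R) : R := - (16 * m%:R * p t ^+ (2 * m).-1 * v t ^+ (4 * m).-1) / D t ^+ 2.

Let yr_derive (t : R) : is_derive t 1 yr (y'r t).
Proof.
have D0 := lt0r_neq0 (D_gt0 t).
have v'E : is_derive t 1 v 2.
  apply: (is_derive_eqd (is_derive_sub (is_derive_mul (is_derive_cst (2 : R) t 1)
    (is_derive_id t 1)) (is_derive_cst (1 : R) t 1))).
  by rewrite /cst; ring.
have p'E : is_derive t 1 p (- (4 * v t)).
  have -> : p = fun t => 1 - v t * v t by apply/funext => s; rewrite pv expr2.
  apply: (is_derive_eqd (is_derive_sub (is_derive_cst (1 : R) t 1) (is_derive_mul v'E v'E))).
  by ring.
have P'E := is_derive_pow (2 * m) p'E; have Q'E := is_derive_pow (4 * m) v'E.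
have D'E : is_derive t 1 D _ := is_derive_add P'E Q'E.
have I'E : is_derive t 1 (fun s => (D s)^-1) _ := is_deriveV D0 D'E.
apply: (is_derive_eqd (is_derive_mul (is_derive_sub P'E Q'E) I'E)).
rewrite /y'r /GRing.scale /=.
have DE : D t = p t ^+ (2 * m) + v t ^+ (4 * m) by [].
have PE : p t ^+ (2 * m) = p t * p t ^+ (2 * m).-1.
  by rewrite -exprS prednK // muln_gt0.
have QE : v t ^+ (4 * m) = v t * v t ^+ (4 * m).-1.
  by rewrite -exprS prednK // muln_gt0.
rewrite PE QE in DE *; rewrite !natrM.
have := pv t; move: (p t ^+ _) (v t ^+ _) (D t) D0 DE => P Q d d0 dE pE.
have dE' : p t * P = d - v t * Q by rewrite dE addrK.
transitivity (((2 * m%:R * P * - (4 * v t) - 4 * m%:R * Q * 2) * d -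
   (p t * P - v t * Q) * (2 * m%:R * P * - (4 * v t) + 4 * m%:R * Q * 2)) / d ^+ 2).
  by field.
congr (_ / _); rewrite dE.
transitivity (- (16 * m%:R * P * Q) * (v t ^+ 2 + p t)); first by ring.
by rewrite pE addrC subrK mulr1.
Qed.

Let y'r_gt0 t : 0 < t < 1 / 2 -> 0 < y'r t.
Proof.
move=> /andP[t0 t2]; have p0 : 0 < p t by rewrite /p; nra.
have v0 : v t < 0 by rewrite /v; lra.
rewrite /y'r divr_gt0 ?exprn_gt0 // oppr_gt0 pmulr_rlt0.
  by rewrite exprn_odd_lt0 // -subn1 oddB ?muln_gt0 // oddM.
by rewrite !mulr_gt0 ?exprn_gt0 ?ltr0n.
Qed.

Let y'r_lt0 t : 1 / 2 < t < 1 -> y'r t < 0.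
Proof.
move=> /andP[t2 t1]; have p0 : 0 < p t by rewrite /p; nra.
have v0 : 0 < v t by rewrite /v; lra.
rewrite /y'r mulNr oppr_lt0 divr_gt0 ?exprn_gt0 //.
by rewrite !mulr_gt0 ?exprn_gt0 ?ltr0n.
Qed.

Let explicit_loop : loop m x y.
Proof.
have xm t : x t ^+ m = - (xi t ^+ m)%:C.
  have sgn : (-1) ^+ m = -1 :> C by rewrite -signr_odd m_odd.
  have [t2|/ltW t2] := leP t (1 / 2).
    by rewrite xE1 // exprNn sgn mulN1r rmorphXn.
  rewrite xE2 // exprMn exprNn (prim_expr_order prim_zeta) mulr1 sgn mulN1r.
  by rewrite rmorphXn.
have p0 : p 0 = 0 by rewrite /p; ring.
have p1 : p 1 = 0 by rewrite /p; ring.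
have xi0 : xi 0 = 0 by rewrite /xi p0 expr0n mulr0 mul0r.
have xi1 : xi 1 = 0 by rewrite /xi p1 expr0n mulr0 mul0r.
split => //.
- exact: C1_real.
- move=> t _; rewrite /on_curve xm xi_m /y -rmorphXn rmorphB rmorph1 /=.
  by rewrite opprB subrK.
- rewrite xE1; last by rewrite divr_ge0.
  rewrite xE2; last by lra.
  by rewrite xi0 xi1 oppr0 mulr0.
- have v0 : v 0 ^+ (4 * m) = 1.
    have v4 : v 0 ^+ 4 = 1 by rewrite /v; ring.
    by rewrite exprM v4 expr1n.
  have v1 : v 1 ^+ (4 * m) = 1.
    have v4 : v 1 ^+ 4 = 1 by rewrite /v; ring.
    by rewrite exprM v4 expr1n.
  by rewrite /y /yr /D p0 p1 v0 v1.
Qed.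

Lemma loop_exists : exists x y : R -> C, loop m x y /\
  forall j, (0 < j < m)%N -> complex_integral (theta_along m j x y) != 0.
Proof.
exists x, y; split=> [|j /andP[j_gt0 jm]]; first exact: explicit_loop.
have lxy := explicit_loop; have [x1 y1 _ _ _] := lxy.
have [G GE] : exists F : R -> C, forall t, 0 <= t <= 1 -> cder F t (theta_along m j x y t).
  by apply: primitive_exists => t; exact: theta_along_ccont.
have int0 : complex_integral (theta_along m j x y) = G 1 - G 0.
  by apply: complex_integral_primitive GE => t _; exact: theta_along_ccont.
(* With this factor the integrand is a positive multiple of y' (1 - conj(zeta ^ j)) on the first
   half, where y' > 0, and of y' (zeta ^ j - 1) on the second, where y' < 0. Its real part is
   positive on both because Re (zeta ^ j) < 1, so the primitive cannot take the same value at 0 and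
   1. *)
pose c : C := (-1) ^+ j * ((zeta ^+ j)^* - 1).
have zj_norm : `|zeta ^+ j| = 1.
  apply/eqP; rewrite -(@pexpr_eq1 _ _ m) // -normrX -exprM mulnC exprM.
  by rewrite (prim_expr_order prim_zeta) expr1n normr1.
have zzbar : (zeta ^+ j)^* * zeta ^+ j = 1.
  by rewrite mulrC -normCK zj_norm expr1n.
have zj1 : zeta ^+ j != 1.
  by rewrite -(prim_order_dvd prim_zeta) gtnNdvd.
have Re_lt : Re (zeta ^+ j) < 1.
  have : `|zeta ^+ j| ^+ 2 = 1 by rewrite zj_norm expr1n.
  rewrite normc_sq => /(congr1 Re) /= e.
  rewrite lt_neqAle; apply/andP; split.
    apply: contra zj1 => /eqP r1; apply/eqP/complex_eq => //=.
    by move: e; rewrite r1 expr1n => /eqP; rewrite -subr_eq0 addrAC subrr add0r sqrf_eq0 => /eqP.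
  move: e; move: (Re _) (Im _) => a b e; nra.
have thE (t : R) (eps : C) : 0 < t < 1 -> t != 1 / 2 -> eps ^+ m = 1 -> x t = - eps * (xi t)%:C ->
    c * theta_along m j x y t =
    - ((zeta ^+ j)^* - 1) * eps ^+ j * (2 / m%:R * y'r t * xi t ^+ j.-1 / xi t ^+ m.-1)%:C.
  move=> t01 t2 epsm xE; have t01' : 0 <= t <= 1 by case/andP: t01 => *; rewrite !ltW.
  have [_ dyE] := tangent_theta m_odd m_gt1 (loop_tangent lxy t01').
  rewrite /theta_along; move: (theta _ _ _ _ _) dyE => th dyE.
  have y'E : path_deriv y t = (y'r t)%:C by apply: cder_path_deriv; exact: cder_real.
  rewrite y'E in dyE.
  have xi0 : (xi t)%:C != 0 by rewrite (inj_eq (@complexI _)) lt0r_neq0 // xi_gt0.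
  have eps0 : eps != 0.
    by apply: contraNneq (oner_neq0 C) => e0; rewrite -epsm e0 expr0n gtn_eqF.
  have mC0 : m%:R != 0 :> C by rewrite pnatr_eq0 -lt0n.
  have xm : x t ^+ m.-1 = eps ^+ m.-1 * (xi t)%:C ^+ m.-1.
    rewrite xE exprMn exprNn -signr_odd.
    have -> : odd m.-1 = false by move: m_odd m_gt0; case: (m) => // n /= /negbTE.
    by rewrite expr0 mul1r.
  have em : eps ^+ m.-1 = eps^-1.
    by apply: (mulIf eps0); rewrite -exprSr prednK // epsm mulVf.
  have thE : th = 2 / m%:R * (y'r t)%:C * eps / (xi t)%:C ^+ m.-1.
    rewrite dyE xm em; move: ((xi t)%:C ^+ m.-1) (expf_neq0 m.-1 xi0) => X X0.
    by field; rewrite X0 mC0 eps0.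
  rewrite thE xE /c {thE dyE xm xE y'E}; move: (xi t) (y'r t) ((zeta ^+ j)^* ) => X Y Z.
  rewrite exprMn (exprNn eps) !rmorphM !fmorphV !rmorphXn !rmorph_nat.
  have -> : eps ^+ j = eps ^+ j.-1 * eps by rewrite -exprSr prednK.
  have -> : (-1) ^+ j = - (-1) ^+ j.-1 :> C by rewrite -[in LHS](prednK j_gt0) exprS mulN1r.
  transitivity (- (Z - 1) * ((-1) ^+ j.-1 * (-1) ^+ j.-1) * (eps ^+ j.-1 * eps) *
    (2 / m%:R * Y%:C * X%:C ^+ j.-1 / X%:C ^+ m.-1)); first by rewrite /=; ring.
  by rewrite sign_mul_self mulr1.
have Re_conj : Re ((zeta ^+ j)^*) = Re (zeta ^+ j) by case: (zeta ^+ j).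
have cG (t : R) : 0 <= t <= 1 -> is_derive t 1 (fun s => Re (c * G s)) (Re (c * theta_along m j x y t)).
  by move=> t01; case: (cderZ c (GE t t01)).
have rho_gt0 (t : R) : 0 < t < 1 -> t != 1 / 2 -> 0 < 2 / m%:R * xi t ^+ j.-1 / xi t ^+ m.-1.
  move=> t01 t2; have xi0 := xi_gt0 t01 t2.
  by rewrite !mulr_gt0 ?invr_gt0 ?exprn_gt0 ?ltr0n.
have half01 : (0 : R) < 1 / 2 by lra.
have half1 : (1 / 2 : R) < 1 by lra.
have lt1 : Re (c * G 0) < Re (c * G (1 / 2)).
  apply: (@positive_derivative_lt (fun s => Re (c * G s))
    (fun t => Re (c * theta_along m j x y t)) _ _ half01).
    by move=> t /andP[t0 t2]; apply: cG; lra.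
  move=> t t02; have t01 : 0 < t < 1 by lra.
  have t2 : t != 1 / 2 by apply/eqP; lra.
  rewrite (thE t 1) ?expr1n //; last by rewrite mulN1r xE1 //; lra.
  rewrite mulr1 cReM /= mulr0 subr0 cReN cReD Re_conj cReN /=.
  have := rho_gt0 t t01 t2; have := y'r_gt0 t02; move: Re_lt.
  have -> : 2 / m%:R * y'r t * xi t ^+ j.-1 / xi t ^+ m.-1 =
    y'r t * (2 / m%:R * xi t ^+ j.-1 / xi t ^+ m.-1) by ring.
  by move=> r1 y0 rho0; apply: mulr_gt0; [move: r1; lra | exact: mulr_gt0].
have lt2 : Re (c * G (1 / 2)) < Re (c * G 1).
  apply: (@positive_derivative_lt (fun s => Re (c * G s))
    (fun t => Re (c * theta_along m j x y t)) _ _ half1).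
    by move=> t /andP[t0 t2]; apply: cG; lra.
  move=> t t02; have t01 : 0 < t < 1 by lra.
  have t2 : t != 1 / 2 by apply/eqP; lra.
  rewrite (thE t zeta) ?(prim_expr_order prim_zeta) //; last by rewrite xE2 //; lra.
  rewrite mulNr mulrBl zzbar mul1r opprB cReM /= mulr0 subr0 cReD cReN /=.
  have := rho_gt0 t t01 t2; have := y'r_lt0 t02; move: Re_lt.
  have -> : 2 / m%:R * y'r t * xi t ^+ j.-1 / xi t ^+ m.-1 =
    y'r t * (2 / m%:R * xi t ^+ j.-1 / xi t ^+ m.-1) by ring.
  move=> r1 y0 rho0; have r2 : Re (zeta ^+ j) - 1 < 0 by rewrite subr_lt0.
  by rewrite (nmulr_rgt0 _ r2) (nmulr_rlt0 _ y0).
rewrite int0 subr_eq0; apply/eqP => G10; move: (lt_trans lt1 lt2).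
by rewrite G10 ltxx.
Qed.

End ExplicitLoop.

(** * The rational homology of J_m and of X_m *)

Section GeometricPeriods.
Variable R : realType.
Local Notation C := R[i].
Let rC : {rmorphism rat -> C} := ratr.

Lemma complex_integral_sum (s : seq nat) (c : nat -> C) (f : nat -> R -> C) :
  (forall j t, ccont (f j) t) ->
  complex_integral (fun t => \sum_(j <- s) c j * f j t) =
  \sum_(j <- s) c j * complex_integral (f j).
Proof.
move=> fc; have /choice[G GE] : forall j, exists F : R -> C, forall t, 0 <= t <= 1 ->
    cder F t (f j t) by move=> j; apply: primitive_exists.
rewrite (complex_integral_primitive (F := fun t => \sum_(j <- s) c j * G j t)).
- rewrite -sumrB; apply: eq_bigr => j _.
  have -> : complex_integral (f j) = G j 1 - G j 0.
    by apply: complex_integral_primitive => [t _|t t01]; [exact: fc | exact: GE].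
  by rewrite mulrBr.
- move=> t _; elim: s => [|j s IH].
    by under eq_fun do rewrite big_nil; exact: ccont_cst.
  under eq_fun do rewrite big_cons.
  by apply: ccontD => //; apply: ccontM; [exact: ccont_cst | exact: fc].
- move=> t t01; elim: s => [|j s IH].
    by under eq_fun do rewrite big_nil; rewrite big_nil; exact: cder_cst.
  under eq_fun do rewrite big_cons; rewrite big_cons.
  by apply: cderD => //; apply: cderZ; exact: GE.
Qed.

Lemma C1_of_cder (z z' : R -> C) : (forall t, cder z t (z' t)) -> (forall t, ccont z' t) -> C1 z.
Proof.
move=> zd zc; split; apply: continuously_derivable_C1.
- exists (fun t => complex.Re (z' t)) => t; first by case: (zd t).
  by case: (zc t).
- exists (fun t => complex.Im (z' t)) => t; first by case: (zd t).
  by case: (zc t).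
Qed.

Variables (m : nat) (zeta : C).
Hypotheses (m_odd : odd m) (m_gt1 : (1 < m)%N).
Hypothesis prim_zeta : m.-primitive_root zeta.
Let g := m.-1./2.
Let m_gt0 : (0 < m)%N. Proof. exact: ltnW. Qed.

Lemma period_coord (w : oneform R) (x y : R -> C) : regular_forms m w -> loop m x y ->
  period x y w = \sum_(1 <= j < g.+1) regular_coord m w j *
                   complex_integral (theta_along m j x y).
Proof.
move=> wreg lxy; have [x1 y1 _ _ _] := lxy.
rewrite -complex_integral_sum; last by move=> j t; exact: theta_along_ccont.
apply: eq_complex_integral => t t01.
rewrite (regular_coordE m_odd m_gt1 wreg (loop_tangent lxy t01)).
by apply: eq_bigr => j _; rewrite mulrA.
Qed.

Lemma rotated_loop i (x y : R -> C) : loop m x y ->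
  loop m (fun t => zeta ^+ i * x t) y /\
  forall j, (0 < j)%N -> complex_integral (theta_along m j (fun t => zeta ^+ i * x t) y) =
    (zeta ^+ j) ^+ i * complex_integral (theta_along m j x y).
Proof.
move=> [x1 y1 cxy x01 y01].
have xd t : cder (fun t => zeta ^+ i * x t) t (zeta ^+ i * path_deriv x t).
  by apply: cderZ; exact: C1_cder.
split=> [|j j_gt0].
  split=> //; last by rewrite x01.
    apply: (C1_of_cder xd) => t; apply: ccontM; first exact: ccont_cst.
    exact: C1_path_deriv_ccont.
  move=> t t01; rewrite /on_curve exprMn -exprM mulnC exprM (prim_expr_order prim_zeta).
  by rewrite expr1n mul1r; exact: cxy.
rewrite -complex_integralZ; last by move=> t _; exact: theta_along_ccont.
apply: eq_complex_integral => t _; rewrite /theta_along (cder_path_deriv (xd t)) exprMn.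
rewrite -[zeta ^+ j ^+ i]exprM mulnC exprM -[in RHS](prednK j_gt0) exprS.
by move: (zeta ^+ i) => z; rewrite /theta; ring.
Qed.

Let Phi : {poly rat} := \sum_(i < m) 'X^i.

Let root_Phi z : root (map_poly rC Phi) z -> exists2 j, (0 < j < m)%N & z = zeta ^+ j.
Proof.
have PhiX : (map_poly rC Phi).[z] = \sum_(i < m) z ^+ i.
  rewrite raddf_sum horner_sum; apply: eq_bigr => i _.
  by rewrite /= map_polyXn hornerXn.
move=> /rootP; rewrite PhiX => sz0.
have zm : z ^+ m = 1 by apply/eqP; rewrite -subr_eq0 subrX1 sz0 mulr0.
have [i zE] := prim_rootP prim_zeta zm; exists (val i) => //=; rewrite ltn_ord andbT lt0n.
apply/eqP => i0; move: sz0; rewrite zE i0 expr0.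
under eq_bigr do rewrite expr1n; rewrite sumr_const card_ord => /eqP.
by rewrite pnatr_eq0 (gtn_eqF m_gt0).
Qed.

Let Phi_root j : (0 < j < m)%N -> (map_poly rC Phi).[zeta ^+ j] = 0.
Proof.
case/andP => j_gt0 jm; have PhiX : (map_poly rC Phi).[zeta ^+ j] = \sum_(i < m) (zeta ^+ j) ^+ i.
  rewrite raddf_sum horner_sum; apply: eq_bigr => i _.
  by rewrite /= map_polyXn hornerXn.
have : (zeta ^+ j - 1) * (map_poly rC Phi).[zeta ^+ j] = 0.
  by rewrite PhiX -subrX1 -exprM mulnC exprM (prim_expr_order prim_zeta) expr1n subrr.
move/eqP; rewrite mulf_eq0 subr_eq0 -(prim_order_dvd prim_zeta) gtnNdvd //=.
by move/eqP.
Qed.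

(* The element F0 of Q[t] / Phi giving the periods of the loop of [loop_exists]
   has no zero among the roots of Phi, hence is a unit: up to the factors c j,
   the period lattice spans the whole algebra Q[t] / Phi. *)
Lemma normalized_periods : exists c : nat -> C,
  (forall j, (0 < j < m)%N -> c j != 0) /\
  (forall x y : R -> C, loop m x y -> exists F : {poly rat}, forall j, (0 < j < m)%N ->
     complex_integral (theta_along m j x y) = c j * (map_poly rC F).[zeta ^+ j]) /\
  (forall i, exists x y : R -> C, loop m x y /\ forall j, (0 < j < m)%N ->
     complex_integral (theta_along m j x y) = c j * (zeta ^+ j) ^+ i).
Proof.
have [x0 [y0 [l0 nz0]]] := loop_exists m_odd m_gt1 prim_zeta.
have [F0 F0E] := loop_periods m_odd m_gt1 prim_zeta l0.
exists (fun j => complex_integral (theta_along m j x0 y0)); split=> //.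
have evalM (P Q : {poly rat}) z :
    (map_poly rC (P * Q)).[z] = (map_poly rC P).[z] * (map_poly rC Q).[z].
  by rewrite rmorphM hornerM.
have F0nz j : (0 < j < m)%N -> (map_poly rC F0).[zeta ^+ j] != 0.
  by move=> jm; have := nz0 j jm; rewrite F0E // mulf_eq0 negb_or => /andP[].
have cop : coprimep F0 Phi.
  rewrite -(coprimep_map rC) /coprimep; apply/negPn/negP => sz.
  have [z] := closed_rootP _ sz; rewrite root_gcd => /andP[zF /root_Phi[j jm zE]].
  by have := F0nz j jm; rewrite -zE (rootP zF) eqxx.
have [[a b] /= ab] := Bezout_eq1_coprimepP _ _ cop.
have aF0 j : (0 < j < m)%N -> (map_poly rC a).[zeta ^+ j] * (map_poly rC F0).[zeta ^+ j] = 1.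
  move=> jm; have := congr1 (fun P => (map_poly rC P).[zeta ^+ j]) ab.
  rewrite /= rmorphD /= hornerD !evalM rmorph1 hornerC => <-.
  by rewrite Phi_root // mulr0 addr0.
split=> [x y lxy|i].
  have [F FE] := loop_periods m_odd m_gt1 prim_zeta lxy.
  exists (a * F) => j jm; rewrite (FE j jm) (F0E j jm) evalM -[RHS]mulrA; congr (_ * _).
  by rewrite [RHS]mulrA [X in X * _]mulrC (aF0 j jm) mul1r.
have [li IE] := rotated_loop i l0.
by exists (fun t => zeta ^+ i * x0 t), y0; split=> // j /andP[j_gt0 _]; rewrite IE // mulrC.
Qed.

(** Covers both tori: J_m with a = m and M = 1 below, X_m with a = p and M = p ^ (k - 1). The roots
    involved are the zeta ^ j with a not dividing j. *)
Definition quotient_torus (W : set (oneform R)) : torus R :=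
  Torus W (lattice (t := curve_jacobian R m)).

Section Quotient.
Variables (a M : nat) (W : set (oneform R)).
Hypotheses (m_aM : m = (a * M)%N) (a_gt0 : (0 < a)%N) (M_gt0 : (0 < M)%N).
Let S : pred nat := fun j => ~~ (a %| j)%N.
Hypothesis W_regular : forall w, W w -> regular_forms m w.
Hypothesis W_coord : forall w, W w ->
  forall j, (0 < j <= g)%N -> ~~ S j -> regular_coord m w j = 0.
Variable c : nat -> C.
Hypothesis c_loop : forall x y : R -> C, loop m x y ->
  exists F : {poly rat}, forall j, (0 < j < m)%N ->
     complex_integral (theta_along m j x y) = c j * (map_poly rC F).[zeta ^+ j].
Hypothesis c_rot : forall i, exists x y : R -> C, loop m x y /\ forall j, (0 < j < m)%N ->
     complex_integral (theta_along m j x y) = c j * (zeta ^+ j) ^+ i.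
Let X := quotient_torus W.
Let coord : ambient X -> nat -> C := @regular_coord R m.

Let g_lt j : (0 < j < g.+1)%N -> (0 < j < m)%N.
Proof. by case/andP => -> /=; rewrite /g; move: m_odd m_gt1; clear; lia. Qed.

(** Coordinates whose index is divisible by a vanish on [W], so all j from 1 to g may be included.
    The right-hand side no longer depends on a, which allows J_m and X_m to be compared. *)
Lemma functional_full F w : W w -> functional m zeta S (X := X) coord c F w =
  \sum_(1 <= j < g.+1) regular_coord m w j * (c j * (map_poly rC F).[zeta ^+ j]).
Proof.
move=> Ww; rewrite /functional -(big_mkord (fun j => S j && (j.*2 < m)%N)
  (fun j => coord w j * (c j * (map_poly rC F).[zeta ^+ j]))).
have gm : (g.+1 <= m)%N by rewrite /g; move: m_odd m_gt1; clear; lia.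
rewrite [LHS]big_mkcond (big_cat_nat _ gm) //= [X in _ + X]big_nat [X in _ + X]big1 ?addr0; last first.
  move=> j /andP[gj jm]; case: ifP => // /andP[_ j2]; exfalso.
  by move: gj j2; rewrite /g; move: m_odd; clear; lia.
rewrite big_ltn // /S dvdn0 /= add0r !big_nat; apply: eq_bigr => j /andP[j_gt0 jg].
have j2 : (j.*2 < m)%N by move: jg j_gt0; rewrite /g; move: m_odd m_gt1; clear; lia.
rewrite j2 andbT; case: ifP => // /negbT Sj.
by rewrite W_coord ?mul0r // j_gt0.
Qed.

(** Loops give polynomials by [c_loop]; conversely the rotated loops of [c_rot] give the monomials,
    hence all rational polynomials. *)
Lemma quotient_H1rat l : H1rat (X := X) l <->
  exists F, forall w, W w -> l w = functional m zeta S (X := X) coord c F w.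
Proof.
split=> [[s [q [u [uL lE]]]]|[F lE]].
  have /choice[F FE] : forall i, exists F, forall w, W w -> u i w =
      functional m zeta S (X := X) coord c F w.
    move=> i; have [x [y [lxy ->]]] := uL i; have [F FE] := c_loop lxy.
    exists F => w Ww; rewrite functional_full // period_coord //; last exact: W_regular.
    by rewrite !big_nat; apply: eq_bigr => j /g_lt jm; rewrite FE.
  exists (\sum_i q i *: F i) => w Ww; rewrite lE // functional_sum.
  by apply: eq_bigr => i _; rewrite FE.
have /choice[xs /choice[ys xyE]] := c_rot.
exists (size F), (fun i => F`_i), (fun i => period (xs i) (ys i)); split.
  by move=> i; exists (xs i), (ys i); split=> //; case: (xyE i).
move=> w Ww; rewrite lE // functional_full //.
under [RHS]eq_bigr => i _.
  rewrite period_coord; [| exact: W_regular | by case: (xyE i)].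
  rewrite mulr_sumr; over.
rewrite /= exchange_big !big_nat; apply: eq_bigr => j /g_lt jm /=.
rewrite horner_coef size_map_poly !mulr_sumr; apply: eq_bigr => i _.
have [_ ->] := xyE i; rewrite // coef_map /=; ring.
Qed.

(** This is (t ^ m - 1) / (t ^ M - 1), which vanishes at zeta ^ j exactly when a does not divide
    j. *)
Let Psi : {poly rat} := \sum_(i < a) 'X^(i * M).

Let S_mod j : S (j %% m)%N = S j.
Proof. by rewrite /S /dvdn m_aM modn_dvdm // dvdn_mulr. Qed.

Let S_opp j : (j <= m)%N -> S (m - j)%N = S j.
Proof. by move=> jm; rewrite /S dvdn_subr // m_aM dvdn_mulr. Qed.

Let S_half j : S j -> j.*2 != m.
Proof. by move=> _; apply/eqP => jm; move: m_odd; rewrite -jm odd_double. Qed.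

Let Psi_root j : S j -> root (map_poly rC Psi) (zeta ^+ j).
Proof.
move=> Sj; apply/rootP; set z := zeta ^+ j.
have PsiX : (map_poly rC Psi).[z] = \sum_(i < a) (z ^+ M) ^+ i.
  rewrite raddf_sum horner_sum; apply: eq_bigr => i _.
  by rewrite /= map_polyXn hornerXn -exprM mulnC.
have : (z ^+ M - 1) * (map_poly rC Psi).[z] = 0.
  rewrite PsiX -subrX1 -exprM mulnC -m_aM /z -exprM mulnC exprM.
  by rewrite (prim_expr_order prim_zeta) expr1n subrr.
move/eqP; rewrite mulf_eq0 subr_eq0 /z -exprM -(prim_order_dvd prim_zeta).
by rewrite {1}m_aM dvdn_pmul2r // (negPf (Sj : ~~ _)) /= => /eqP.
Qed.

Let card_S : #|[pred j : 'I_m | S j]| = ((a - 1) * M)%N.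
Proof.
have dvd_count : (\sum_(j < m) (a %| j) = M)%N.
  have := divn_count_dvd a m; rewrite {1}m_aM mulKn // => ->.
  rewrite -(big_mkord xpredT (fun j => nat_of_bool (a %| j)%N)) big_ltn // dvdn0 addnC.
  rewrite -[in RHS](prednK m_gt0) big_nat_recr //= prednK //; congr (_ + _)%N.
  by rewrite m_aM dvdn_mulr.
rewrite -sum1_card big_mkcond /=.
have : (\sum_(j < m) (if j \in [pred j : 'I_m | S j] then 1 else 0) + \sum_(j < m) (a %| j) = m)%N.
  rewrite -big_split -[RHS]card_ord -sum1_card; apply: eq_bigr => j _.
  by rewrite inE /S; case: (a %| j)%N.
by rewrite dvd_count mulnBl mul1n -m_aM => sumE; rewrite -[X in (X - _)%N]sumE addnK.
Qed.

Let size_Psi : size Psi = #|[pred j : 'I_m | S j]|.+1.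
Proof.
rewrite card_S /Psi; case: a a_gt0 => // b _; rewrite subn1 /=.
rewrite big_ord_recr /= addrC size_addl size_polyXn //.
apply: leq_ltn_trans (size_sum _ _ _) _; rewrite ltnS; apply/bigmax_leqP => i _.
by rewrite size_polyXn ltn_mul2r M_gt0 /=.
Qed.

Hypothesis c_neq0 : forall j, (0 < j < m)%N -> c j != 0.
Hypothesis W_theta : forall j, (0 < j <= g)%N -> S j -> W (theta_form m 'X^(j.-1)).

Let half_g j : S j && (j.*2 < m)%N -> (0 < j <= g)%N.
Proof.
case/andP => Sj j2; have j_gt0 : (0 < j)%N by rewrite lt0n; apply: contraNneq Sj => ->; exact: dvdn0.
by rewrite j_gt0 /g; move: j2 m_odd; clear; lia.
Qed.

Let c_half j : S j && (j.*2 < m)%N -> c j != 0.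
Proof. by move=> /half_g jg; apply: c_neq0; apply: g_lt; rewrite ltnS. Qed.

Let W_dual j : S j && (j.*2 < m)%N -> exists2 w, cot (t := X) w &
  forall i, S i && (i.*2 < m)%N -> coord w i = (i == j)%:R.
Proof.
move=> hj; have jg := half_g hj; have /andP[Sj _] := hj.
exists (theta_form m 'X^(j.-1)); first exact: W_theta.
by move=> i /half_g/andP[i_gt0 _]; exact: regular_coord_theta_form.
Qed.

Definition quotient_model n (e : 'I_n -> (ambient X -> C)) (he : H1basis e) :=
  torus_model prim_zeta S_mod S_opp S_half c_half W_dual quotient_H1rat size_Psi Psi_root he.

Lemma quotient_functional_inj F G :
  (forall w, W w -> functional m zeta S (X := X) coord c F w =
                    functional m zeta S (X := X) coord c G w) ->
  forall j, S j -> (map_poly rC F).[zeta ^+ j] = (map_poly rC G).[zeta ^+ j].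
Proof.
move=> FG j Sj.
exact: (functional_inj prim_zeta S_mod S_opp S_half c_half W_dual FG Sj).
Qed.

End Quotient.
End GeometricPeriods.

Unset Implicit Arguments.

Theorem proposition7p2p4 (R : realType) (p k : nat)
    (hp : prime p) (hodd : odd p) (hk : (0 < k)%N)
    (n : nat) (e : 'I_n -> (oneform R -> R[i]))
    (he : H1basis (X := curve_jacobian R (p ^ k)) e)
    (r : nat) (e' : 'I_r -> (oneform R -> R[i]))
    (he' : H1basis (X := simple_factor R p k) e')
    (B : 'M[rat]_(n, r)) (hB : projection_matrix p k e e' B) :
  restriction_iso B
    (mumford_tate (X := curve_jacobian R (p ^ k)) e)
    (mumford_tate (X := simple_factor R p k) e').
Proof.
pose m := (p ^ k)%N.
have m_odd : odd m by rewrite oddX hodd orbT.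
have m_gt1 : (1 < m)%N by rewrite -(expn0 p) ltn_exp2l // prime_gt1.
have m_gt0 := ltnW m_gt1.
have p_gt0 := prime_gt0 hp.
have pm : (p %| m)%N by rewrite dvdn_exp.
have mE : m = (p * p ^ k.-1)%N by rewrite -expnS prednK.
have q_gt0 : (0 < p ^ k.-1)%N by rewrite expn_gt0 p_gt0.
have [zeta prim_zeta] := prim_root_exists R[i] m_gt0.
have [c [c_neq0 [c_loop c_rot]]] := normalized_periods m_odd m_gt1 prim_zeta.
pose W : set (oneform R) := cot (t := curve_jacobian R m).
pose W' : set (oneform R) := cot (t := simple_factor R p k).
have W_regular w : W w -> regular_forms m w by [].
have W_coord w : W w -> forall j, (0 < j <= m.-1./2)%N -> ~~ ~~ (m %| j)%N ->
    regular_coord m w j = 0.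
  move=> _ j /andP[j_gt0 jg] /negPn /(dvdn_leq j_gt0).
  by move: jg j_gt0; clear -m_gt1; lia.
have W_theta j : (0 < j <= m.-1./2)%N -> ~~ (m %| j)%N -> W (theta_form m 'X^(j.-1)).
  by move=> jg _; exact: theta_form_regular.
have W'_regular w : W' w -> regular_forms m w by case.
have W'_coord w : W' w -> forall j, (0 < j <= m.-1./2)%N -> ~~ ~~ (p %| j)%N ->
    regular_coord m w j = 0.
  move=> [wreg /(trace_kernelP hp hodd hk wreg) w0] j jg /negPn; exact: w0.
have W'_theta j : (0 < j <= m.-1./2)%N -> ~~ (p %| j)%N -> W' (theta_form m 'X^(j.-1)).
  move=> jg pj; have reg := theta_form_regular R m_odd m_gt1 jg.
  split=> //; apply/(trace_kernelP hp hodd hk reg) => i /andP[i_gt0 _] pi.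
  rewrite regular_coord_theta_form //; case: eqP => // ij.
  by rewrite -ij pi in pj.
have [F [T [y [model eF hodgeE interp]]]] := quotient_model m_odd m_gt1 prim_zeta
  (esym (muln1 m)) m_gt0 isT W_regular W_coord c_loop c_rot c_neq0 W_theta he.
have [F' [T' [y' [model' eF' hodgeE' _]]]] := quotient_model m_odd m_gt1 prim_zeta
  mE p_gt0 q_gt0 W'_regular W'_coord c_loop c_rot c_neq0 W'_theta he'.
(* The same constants [c] normalize both tori, so what remains is that [B] sends [E' j] to [E j]: an
   equality at zeta ^ j between F_i and the combination of the F'_l with coefficients from [B]. *)
apply: (restriction_iso_of_models hp hodd hk model model' interp hodgeE hodgeE') => j pj.
apply/colP => i; rewrite !mxE.
transitivity (map_poly (ratr : rat -> R[i]) (\sum_l B i l *: F' l)).[zeta ^+ j].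
  rewrite raddf_sum horner_sum; apply: eq_bigr => l _.
  by rewrite !mxE /= map_polyZ hornerZ.
apply: (quotient_functional_inj m_odd m_gt1 prim_zeta mE c_neq0 W'_theta _ pj) => w W'w.
have Ww : W w by exact: W'_regular.
(* On the smaller cotangent space the functional of F_i is the same for both index sets. It is
   therefore [e i w], which [hB] expands in the basis [e']. *)
rewrite functional_sum (functional_full zeta m_odd m_gt1 W'_coord c (F i) W'w).
rewrite -(functional_full zeta m_odd m_gt1 W_coord c (F i) Ww) -eF // (hB i w W'w).
by apply: eq_bigr => l _; rewrite eF'.
Qed.
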